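(* Let $\alpha\le\beta\le 1$ be real numbers, set $\lambda:=\alpha+\beta$, and let $K(x,y)=x^\alpha y^\beta+x^\beta y^\alpha$ for $(x,y)\in(0,\infty)^2$. Let $b$ be a daughter distribution function satisfying the following conditions for all $(x,y)\in(0,\infty)^2$: (i) $\int_0^{x+y} z\,b(z,x,y)\,dz=x+y$ and $b(z,x,y)=0$ for $z>x+y$; (ii) there is a non-negative function $\bar b$ such that $b(z,x,y)=\bar b(z,x,y)\mathbf 1_{(0,x)}(z)+\bar b(z,y,x)\mathbf 1_{(0,y)}(z)$ for $z\in(0,\infty)$, $\int_0^x z\,\bar b(z,x,y)\,dz=x$, and $\bar b(z,x,y)=0$ for $z>x$; (iii) $\int_0^{x+y} b(z,x,y)\,dz\le\beta_0$ for some constant $\beta_0>2$ independent of $(x,y)$; (iv) $\int_0^x \bar b(z,x,y)^p\,dz\le \frac{B_p}{2}x^{1-p}$ for some constants $p\in(1,2)$ and $B_p>0$ independent of $(x,y)$. Let $f^{in}\in X_0\cap X_1^+$ with $\varrho:=M_1(f^{in})>0$. (a) If $\lambda\in[1,2]$, then there is at least one mass-conserving weak solution $f$ to the collision-induced breakage equation with initial condition $f^{in}$ on $[0,\infty)$. (b) If $\lambda\in[0,1)$ and $\alpha\ge 0$, then there is at least one mass-conserving weak solution $f$ to the collision-induced breakage equation with initial condition $f^{in}$ on $[0,T_0(f^{in}))$, where $$T_0(f^{in}):=\frac{M_0(f^{in})^{\lambda-1}}{(1-\lambda)(\beta_0-2)\varrho^\lambda}\in(0,\infty).$$ (c) Furthermore,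 the solution $f$ whose existence is asserted in (a), respectively (b), can be taken to have the following property: whenever $f^{in}\in X_m$ for some $m>1$, one has $f\in L^\infty((0,t),X_m)$ with $M_m(f(t))\le M_m(f^{in})$ for all $t>0$ in case (a) and all $t\in(0,T_0(f^{in}))$ in case (b).
   Context: Functions are measurable. For $m\in\mathbb R$, $X_m:=L^1((0,\infty),x^m dx)$ with norm $\|h\|_{X_m}=\int_0^\infty x^m|h(x)|\,dx$, $M_m(h):=\int_0^\infty x^m h(x)\,dx$, and $X_m^+$ is the cone of (a.e.) non-negative elements of $X_m$; $X_{0,w}$ is $X_0=L^1(0,\infty)$ with its weak topology. A daughter distribution function is a non-negative measurable function $b$ on $(0,\infty)^3$. The collision-induced breakage equation with collision kernel $K$, daughter distribution function $b$ and initial condition $f^{in}$ is $\partial_t f=\mathcal Bf$, $f(0)=f^{in}$, with $$\mathcal B f(x)=\frac12\int_x^\infty\int_0^y b(x,y-z,z)K(y-z,z)f(y-z)f(z)\,dz\,dy-\int_0^\infty K(x,y)f(x)f(y)\,dy.$$ Weak solution: for $T\in(0,\infty]$, a weak solution on $[0,T)$ is a non-negative $f\in C([0,T),X_{0,w})\cap L^\infty((0,T),X_1^+)$ such that $(s,x,y)\mapsto K(x,y)f(s,x)f(s,y)\in L^1((0,t)\times(0,\infty)^2)$ and $$\int_0^\infty\phi(x)(f(t,x)-f^{in}(x))\,dx=\frac12\int_0^t\int_0^\infty\int_0^\infty\zeta_\phi(x,y)K(x,y)f(s,x)f(s,y)\,dy\,dx\,ds$$ for all $t\in(0,T)$ and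 $\phi\in L^\infty(0,\infty)$, where $\zeta_\phi(x,y):=\int_0^{x+y}\phi(z)b(z,x,y)\,dz-\phi(x)-\phi(y)$. It is mass-conserving on $[0,T)$ if moreover $M_1(f(t))=M_1(f^{in})$ for all $t\in[0,T)$. *)

(* Defs.v *)
From mathcomp Require Import all_boot all_order all_algebra.
From mathcomp Require Import all_classical all_reals all_analysis.

Set Implicit Arguments.
Unset Strict Implicit.
Unset Printing Implicit Defensive.

Import Order.TTheory GRing.Theory Num.Theory.
Import numFieldNormedType.Exports.

Local Open Scope classical_set_scope.
Local Open Scope ring_scope.

(* A function on (0, oo) is a total function R -> R of which only the values
   on (0, oo) are used.  Measurability is Borel measurability, and elements of
   Lebesgue spaces are handled through representatives. *)

Notation leb := lebesgue_measure.

Definition pos {R : realType} : set R := `]0, +oo[%classic.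

Definition time_interval {R : realType} (T : \bar R) : set R :=
  [set t | 0 <= t /\ (t%:E < T)%E].

Definition open_time_interval {R : realType} (T : \bar R) : set R :=
  [set t | 0 < t /\ (t%:E < T)%E].

Definition ae_nonneg {R : realType} (h : R -> R) : Prop :=
  {ae leb, forall x : R, pos x -> 0 <= h x}.

Definition in_Linfty {R : realType} (phi : R -> R) : Prop :=
  measurable_fun pos phi /\
  exists C : R, {ae leb, forall x : R, pos x -> `|phi x| <= C}.

Definition in_X {R : realType} (m : R) (h : R -> R) : Prop :=
  leb.-integrable pos (fun x => (x `^ m * h x)%:E).

Definition normX {R : realType} (m : R) (h : R -> R) : \bar R :=
  (\int[leb]_(x in pos) (x `^ m * `|h x|)%:E)%E.

Definition moment {R : realType} (m : R) (h : R -> R) : \bar R :=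
  (\int[leb]_(x in pos) (x `^ m * h x)%:E)%E.

Definition in_Xplus {R : realType} (m : R) (h : R -> R) : Prop :=
  in_X m h /\ ae_nonneg h.

(* Boundedness makes [l] compatible with a.e. equality on (0, oo), so that
   these are the continuous linear forms on the quotient space X_m. *)
Definition dual_X {R : realType} (m : R) (l : (R -> R) -> R) : Prop :=
  (forall (a : R) (u v : R -> R), in_X m u -> in_X m v ->
     l (fun x => a * u x + v x) = a * l u + l v) /\
  (exists C : R, forall u : R -> R, in_X m u ->
     (`|l u|%:E <= C%:E * normX m u)%E).

(* Continuity for the initial topology of the family of all continuous linear
   forms on X_m. *)
Definition weakly_continuous {R : realType} (m : R) (T : \bar R)
    (f : R -> R -> R) : Prop :=
  (forall t : R, time_interval T t -> in_X m (f t)) /\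
  (forall l : (R -> R) -> R, dual_X m l ->
     {within time_interval T, continuous (fun t : R => l (f t))}).

Definition simple_X {R : realType} (m : R) (u : R -> R -> R) : Prop :=
  exists (k : nat) (A : 'I_k -> set R) (h : 'I_k -> R -> R),
    [/\ (forall i, measurable (A i)), (forall i, in_X m (h i)) &
        forall t x : R, u t x = \sum_(i < k) \1_(A i) t * h i x].

(* Strong (Bochner) measurability of f : (0, T) -> X_m. *)
Definition strongly_measurable_X {R : realType} (m : R) (T : \bar R)
    (f : R -> R -> R) : Prop :=
  exists s : nat -> R -> R -> R,
    (forall n, simple_X m (s n)) /\
    {ae leb, forall t : R, open_time_interval T t ->
       normX m (fun x => s n t x - f t x) @[n --> \oo] --> 0%E}.

Definition in_Linfty_X {R : realType} (m : R) (T : \bar R)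
    (f : R -> R -> R) : Prop :=
  [/\ {ae leb, forall t : R, open_time_interval T t -> in_X m (f t)},
      strongly_measurable_X m T f &
      exists C : R, {ae leb, forall t : R, open_time_interval T t ->
                       (normX m (f t) <= C%:E)%E}].

(* In [b z x y] and [bbar z x y], z is the size of the fragment and x, y are
   the sizes of the colliding particles. *)
Definition nonneg_measurable3 {R : realType} (b : R -> R -> R -> R) : Prop :=
  measurable_fun (pos `*` (pos `*` pos))
    (fun u : R * (R * R) => b u.1 u.2.1 u.2.2) /\
  (forall z x y : R, 0 < z -> 0 < x -> 0 < y -> 0 <= b z x y).

Definition daughter_distribution {R : realType} (b : R -> R -> R -> R) : Prop :=
  nonneg_measurable3 b.

Definition zeta {R : realType} (b : R -> R -> R -> R) (phi : R -> R)
    (x y : R) : R :=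
  Rintegral leb `]0, x + y[ (fun z => phi z * b z x y) - phi x - phi y.

Definition weak_solution {R : realType} (K : R -> R -> R)
    (b : R -> R -> R -> R) (fin : R -> R) (T : \bar R)
    (f : R -> R -> R) : Prop :=
  [/\ (forall t : R, time_interval T t -> ae_nonneg (f t)),
      weakly_continuous 0 T f,
      in_Linfty_X 1 T f,
      (forall t : R, open_time_interval T t ->
         (leb \x (leb \x leb))%E.-integrable (`]0, t[ `*` (pos `*` pos))
           (fun u : R * (R * R) =>
              (K u.2.1 u.2.2 * f u.1 u.2.1 * f u.1 u.2.2)%:E)) &
      (forall (t : R) (phi : R -> R), open_time_interval T t -> in_Linfty phi ->
         (\int[leb]_(x in pos) (phi x * (f t x - fin x))%:E =
          2^-1%:E *
          \int[leb]_(s in `]0%R, t[) \int[leb]_(x in pos) \int[leb]_(y in pos)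
             (zeta b phi x y * K x y * f s x * f s y)%:E)%E)].

Definition mass_conserving_weak_solution {R : realType} (K : R -> R -> R)
    (b : R -> R -> R -> R) (fin : R -> R) (T : \bar R)
    (f : R -> R -> R) : Prop :=
  weak_solution K b fin T f /\
  (forall t : R, time_interval T t -> moment 1 (f t) = moment 1 fin).

Definition power_kernel {R : realType} (alpha beta x y : R) : R :=
  x `^ alpha * y `^ beta + x `^ beta * y `^ alpha.

Definition mass_preserving {R : realType} (b : R -> R -> R -> R) : Prop :=
  forall x y : R, 0 < x -> 0 < y ->
    (\int[leb]_(z in `]0%R, (x + y)%R[) (z * b z x y)%:E = (x + y)%:E)%E /\
    (forall z : R, x + y < z -> b z x y = 0).

Definition no_mass_transfer {R : realType} (b bbar : R -> R -> R -> R) : Prop :=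
  forall x y : R, 0 < x -> 0 < y ->
    [/\ (forall z : R, 0 < z ->
           b z x y = bbar z x y * \1_`]0, x[ z + bbar z y x * \1_`]0, y[ z),
        (\int[leb]_(z in `]0%R, x[) (z * bbar z x y)%:E = x%:E)%E &
        (forall z : R, x < z -> bbar z x y = 0)].

Definition fragments_bounded {R : realType} (b : R -> R -> R -> R)
    (beta0 : R) : Prop :=
  forall x y : R, 0 < x -> 0 < y ->
    (\int[leb]_(z in `]0%R, (x + y)%R[) (b z x y)%:E <= beta0%:E)%E.

Definition power_integrable {R : realType} (bbar : R -> R -> R -> R)
    (p Bp : R) : Prop :=
  forall x y : R, 0 < x -> 0 < y ->
    (\int[leb]_(z in `]0%R, x[) (bbar z x y `^ p)%:E
       <= (Bp / 2 * x `^ (1 - p))%:E)%E.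

(* [fine] is harmless for fin in X_0 and X_1: both moments are then finite. *)
Definition T0 {R : realType} (lambda beta0 : R) (fin : R -> R) : R :=
  fine (moment 0 fin) `^ (lambda - 1) /
  ((1 - lambda) * (beta0 - 2) * fine (moment 1 fin) `^ lambda).

Definition moments_controlled {R : realType} (fin : R -> R) (T : \bar R)
    (f : R -> R -> R) : Prop :=
  forall m : R, 1 < m -> in_X m fin ->
    forall t : R, open_time_interval T t ->
      in_Linfty_X m t%:E f /\ (moment m (f t) <= moment m fin)%E.

(* Main.v *)
From HB Require Import structures.
Require Import Defs.
From mathcomp Require Import all_boot all_order all_algebra.
From mathcomp Require Import all_classical all_reals all_analysis.
From mathcomp Require Import measurable_realfun.
From mathcomp Require Import ring lra.
Import Order.TTheory GRing.Theory Num.Theory.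
Import numFieldNormedType.Exports.
Local Open Scope classical_set_scope.
Local Open Scope ring_scope.

Set Implicit Arguments.
Unset Strict Implicit.
Unset Printing Implicit Defensive.

(** Why the theorem is true.

    The two particles of a collision break independently of each other in the
    size variable: condition (ii) writes [b] as the sum of the fragments of one
    particle and of the fragments of the other ([particle_fragments]), and no
    fragment is larger than the particle that it comes from.  A test function
    [phi] with [phi x / x] nondecreasing therefore loses value at each
    collision, and [phi x = x] keeps it exactly ([fragments_le],
    [fragments_mass]).  This makes mass conservation and the decay of [M_m],
    [m > 1], and of the mass carried by sizes above [M], hold already at the
    level of approximations, and is the reason for part (c).

    Approximations come from the explicit Euler scheme for the kernel truncated
    at height [n + 1] ([euler]).  One step is described by the identity
    [breaks]: the moment of [phi] after the step plus what collisions destroy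
    equals the moment before plus what they create.  Every term is
    non-negative, so nothing has to be integrable and one test function after
    another can be inserted.

    Four estimates are uniform in [n].  Mass and superlinear moments: above.
    Number: a collision creates at most [beta0 - 2] particles, so the number
    [m] grows at a rate at most [(beta0 - 2) M_alpha M_beta], and interpolation
    of [M_alpha] and [M_beta] between [m] and the mass [rho] bounds this by
    [(beta0 - 2) rho^lambda m^(2 - lambda)] ([mom_interpolation],
    [step_number]).  For [lambda >= 1] the exponent is at most one and Gronwall's
    inequality gives a bound on every bounded time interval; for [lambda < 1]
    the differential equation [m' = (beta0 - 2) rho^lambda m^(2 - lambda)] blows
    up exactly at [T0] ([number_bound_global], [number_bound_local]).  Small
    sets: the number of particles in a set of measure at most [r] is controlled
    together with the moment of the weight [min 1 ((r / x)^theta)].  By the [L^p]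
    bound (iv) this weight dominates both the fragments that fall into the set
    and the weight of its own fragments, so that the pair satisfies a closed
    Gronwall inequality ([small_weight], [path_small_set]).  Time: bounded
    moments are Lipschitz ([path_lipschitz]).

    These estimates say that the densities [(1 + x) f_n(t, x)] are uniformly
    countably additive for each [t] and equicontinuous in [t].  A diagonal
    extraction over rational times and rays, Dynkin's theorem and the
    Radon-Nikodym theorem give a subsequence that converges on every measurable
    set at every time ([setwise_compactness], [approx_compactness]); Lebesgue
    differentiation supplies a representative of the limit that is measurable in
    [(t, x)] jointly ([limit_exists]).

    Since [alpha] and [beta] lie in [0, 1], [K x y <= 2 (1 + x) (1 + y)].  The
    collision terms are thus quadratic pairings of the weighted densities with
    bounded symbols, and setwise convergence with uniform countable additivity
    passes to the limit in such a pairing, one variable at a time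
    ([pairing_cvg], [pairing2_cvg]).  This yields the equation for non-negative
    bounded test functions ([limit_equation]).

    What remains is to reach the precise notion of weak solution.  The limit is
    Lipschitz in time with values in [L^1], and the decay of tails upgrades this
    to continuity in [X_m], hence weak continuity and strong measurability
    ([sol_weakly_continuous], [sol_in_Linfty_X]).  A test function in
    [L^infinity] is split into its positive part, its negative part and a part
    that vanishes almost everywhere, the symmetry of [K] turns the one-particle
    identity into the symmetric form with [zeta], and Tonelli's theorem gives
    the integrability of the collision rate ([weak_formula],
    [collision_integrable]). *)

(** * Densities and setwise convergence *)

Section real_sequences.
Context {R : realType}.

Lemma near_inftyP (P : nat -> Prop) :
  (\forall n \near \oo, P n) <-> exists N, forall n, (N <= n)%N -> P n.
Proof.
split=> [[N _ H]|[N H]]; first by exists N => n; exact: H.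
by exists N => // n; exact: H.
Qed.

Lemma cvg_realP (a : nat -> R) (l : R) :
  (a n @[n --> \oo] --> l) <->
  (forall e, 0 < e -> exists N, forall n, (N <= n)%N -> `|a n - l| <= e).
Proof.
split=> [/cvgrPdist_le H e e0|H].
  have /near_inftyP[N HN] := H e e0.
  by exists N => n Nn; rewrite distrC; exact: HN.
apply/cvgrPdist_le => e e0; apply/near_inftyP.
by have [N HN] := H e e0; exists N => n Nn; rewrite distrC; exact: HN.
Qed.

Lemma cauchy_seq_cvg (a : nat -> R) :
  (forall e, 0 < e -> exists N, forall n, (N <= n)%N -> `|a n - a N| <= e) ->
  cvg (a n @[n --> \oo]).
Proof.
move=> H; apply: R_complete; apply: cauchy_exP => e e0.
have e20 : 0 < e / 2 by rewrite divr_gt0.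
have [N HN] := H _ e20; exists (a N); exists N => // n Nn /=.
rewrite /ball /= distrC; apply: (le_lt_trans (HN _ Nn)).
by rewrite ltr_pdivrMr// ltr_pMr// ltr1n.
Qed.

Lemma cvg_uniform_approx (a : nat -> R) :
  (forall e, 0 < e -> exists b : nat -> R, cvg (b n @[n --> \oo]) /\
     exists N, forall n, (N <= n)%N -> `|a n - b n| <= e) ->
  cvg (a n @[n --> \oo]).
Proof.
move=> H; apply: cauchy_seq_cvg => e e0.
have e40 : 0 < e / 4 by rewrite divr_gt0.
have [b [/cvg_realP bl [N1 H1]]] := H _ e40.
have [N2 H2] := bl _ e40.
pose N := maxn N1 N2; exists N => n Nn.
have N1N : (N1 <= N)%N by rewrite leq_maxl.
have N2N : (N2 <= N)%N by rewrite leq_maxr.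
have := H1 n (leq_trans N1N Nn); have := H1 N N1N.
have := H2 n (leq_trans N2N Nn); have := H2 N N2N.
rewrite !ler_norml => /andP[? ?] /andP[? ?] /andP[? ?] /andP[? ?].
by apply/andP; split; lra.
Qed.

Lemma is_cvg_seqB (a b : nat -> R) : cvg (a n @[n --> \oo]) ->
  cvg (b n @[n --> \oo]) -> cvg (a n - b n @[n --> \oo]).
Proof. by move=> ca cb; exact: is_cvgB. Qed.

Lemma lim_seqB (a b : nat -> R) : cvg (a n @[n --> \oo]) ->
  cvg (b n @[n --> \oo]) ->
  limn (fun n => a n - b n) = limn a - limn b.
Proof. by move=> ca cb; exact: limB. Qed.

Lemma lim_seqD (a b : nat -> R) : cvg (a n @[n --> \oo]) ->
  cvg (b n @[n --> \oo]) ->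
  limn (fun n => a n + b n) = limn a + limn b.
Proof. by move=> ca cb; exact: limD. Qed.

Lemma lim_seq_le (a : nat -> R) c : cvg (a n @[n --> \oo]) ->
  (forall n, a n <= c) -> limn a <= c.
Proof. by move=> ca ac; apply: limr_le => //; exact: nearW. Qed.

Lemma lim_seq_ge (a : nat -> R) c : cvg (a n @[n --> \oo]) ->
  (forall n, c <= a n) -> c <= limn a.
Proof. by move=> ca ac; apply: limr_ge => //; exact: nearW. Qed.

End real_sequences.

Section setwise.
Context d (T : measurableType d) (R : realType)
  (mu : {sigma_finite_measure set T -> \bar R}).

Definition density (w : T -> \bar R) :=
  measurable_fun setT w /\ forall x, (0 <= w x)%E.

(** The value is real rather than extended, so that the lemmas on limits and
    differences of real sequences apply; it is meaningful because every density
    below has a finite integral. *)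
Definition mass (w : T -> \bar R) (E : set T) : R :=
  fine (\int[mu]_(x in E) w x)%E.

Section mass_theory.
Variables (w : T -> \bar R) (C : R).
Hypotheses (dw : density w) (wC : (\int[mu]_x w x <= C%:E)%E).

Let mw (E : set T) : measurable_fun E w.
Proof. exact: measurable_funS dw.1. Qed.

Lemma massE E : measurable E -> (\int[mu]_(x in E) w x = (mass w E)%:E)%E.
Proof.
move=> mE; rewrite /mass fineK// ge0_fin_numE; last first.
  by apply: integral_ge0 => x _; exact: dw.2.
apply: le_lt_trans (ltry C); apply: le_trans wC.
by apply: ge0_subset_integral => // x _; exact: dw.2.
Qed.

Lemma mass_ge0 E : 0 <= mass w E.
Proof. by apply: fine_ge0; apply: integral_ge0 => x _; exact: dw.2. Qed.

Lemma massU A B : measurable A -> measurable B -> A `&` B = set0 ->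
  mass w (A `|` B) = mass w A + mass w B.
Proof.
move=> mA mB AB; apply: EFin_inj; rewrite EFinD -!massE//; last exact: measurableU.
rewrite ge0_integral_setU//; [by move=> x _; exact: dw.2|].
exact/disj_set2P.
Qed.


Lemma mass_le A B : measurable A -> measurable B -> A `<=` B ->
  mass w A <= mass w B.
Proof.
move=> mA mB AB; rewrite -lee_fin -!massE//.
by apply: ge0_subset_integral => // x _; exact: dw.2.
Qed.

Lemma massD A B : measurable A -> measurable B -> B `<=` A ->
  mass w (A `\` B) = mass w A - mass w B.
Proof.
move=> mA mB BA; rewrite -{2}(setDUK BA) massU//.
- by rewrite addrAC subrr add0r.
- exact: measurableD.
- by apply/seteqP; split => x //= -[Bx [_]].
Qed.

End mass_theory.

(** Uniform countable additivity: the form of equi-integrability that passes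
    to products and to weighted densities without a choice of cutoff. *)
Definition unif_countably_additive (u : nat -> T -> \bar R) :=
  forall E : nat -> set T, (forall j, measurable (E j)) ->
    (forall i j, (i <= j)%N -> E j `<=` E i) -> \bigcap_j E j = set0 ->
    forall e : R, 0 < e ->
      exists j, forall n, (\int[mu]_(x in E j) u n x <= e%:E)%E.

Section limits.
Variables (u : nat -> T -> \bar R) (C : R).
Hypotheses (du : forall n, density (u n)) (C0 : 0 <= C)
  (uC : forall n, (\int[mu]_x u n x <= C%:E)%E)
  (uca : unif_countably_additive u).

Let m n E := mass (u n) E.

Let uca_mass (E : nat -> set T) : (forall j, measurable (E j)) ->
    (forall i j, (i <= j)%N -> E j `<=` E i) -> \bigcap_j E j = set0 ->
    forall e : R, 0 < e -> exists N, forall j, (N <= j)%N -> forall n, m n (E j) <= e.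
Proof.
move=> mE Ei E0 e e0; have [N HN] := uca mE Ei E0 e0; exists N => j Nj n.
rewrite -lee_fin -(massE (du n) (uC n))//; apply: le_trans (HN n).
apply: ge0_subset_integral => //; [exact: measurable_funS (du n).1|
  by move=> x _; exact: (du n).2|exact: Ei].
Qed.

Let convergent : set (set T) :=
  [set E | measurable E /\ cvg (m n E @[n --> \oo])].

(** Differences are immediate. For increasing unions the complements of the
    partial unions decrease to the empty set, so uniform countable additivity
    makes the approximation by a partial union uniform in [n]. *)
Lemma convergent_lambda_system : convergent setT -> lambda_system setT convergent.
Proof.
move=> cT; split; [by []|exact: cT| |].
- move=> A B BA [mA cA] [mB cB]; split; first exact: measurableD.
  have -> : (fun n => m n (A `\` B)) = (fun n => m n A - m n B).
    by apply/funext => n; rewrite /m (massD (du n) (uC n)).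
  exact: is_cvg_seqB cA cB.
- move=> F ndF cF; have mF i : measurable (F i) by have [] := cF i.
  have mU : measurable (\bigcup_i F i) by exact: bigcup_measurable.
  split => //; apply: cvg_uniform_approx => e e0.
  pose D j := (\bigcup_i F i) `\` F j.
  have [] := @uca_mass D _ _ _ _ e0.
  + by move=> j; exact: measurableD.
  + by move=> i j ij; apply: setDS; apply/subsetPset; exact: ndF.
  + rewrite -subset0 => x Dx; have [[i _ Fix] _] := Dx 0%N I.
    by have [_] := Dx i I.
  move=> N /(_ N (leqnn _)) HN; exists (fun n => m n (F N)); split; first by have [] := cF N.
  exists 0%N => n _; have := HN n; rewrite /D /m (massD (du n) (uC n))//; last exact: bigcup_sup.
  move=> H; rewrite ger0_norm// subr_ge0; apply: (mass_le (du n) (uC n)) => //.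
  exact: bigcup_sup.
Qed.

(** Convergence on a generating pi-system is convergence on all measurable
    sets, by Dynkin's theorem. *)
Lemma cvg_all_measurable (G : set (set T)) : setI_closed G ->
  @measurable _ T = <<s G >> -> (forall E, G E -> convergent E) ->
  convergent setT -> forall E, measurable E -> cvg (m n E @[n --> \oo]).
Proof.
move=> GI mG cG cT E; rewrite mG => mE.
suff: <<s G >> `<=` convergent by move=> /(_ E mE)[].
apply: lambda_system_subset => //; exact: convergent_lambda_system.
Qed.

Section limit_measure.
Hypothesis cvgm : forall E, measurable E -> cvg (m n E @[n --> \oo]).

(** The limit of the masses, as a set function; uniform countable additivity
    makes it a measure (Vitali-Hahn-Saks, in the case where the uniformity is
    known), and the Radon-Nikodym theorem gives its density. *)
Definition lim_mass (E : set T) : \bar R := (limn (fun n => m n E))%:E.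

Let lim0 : lim_mass set0 = 0%E.
Proof.
rewrite /lim_mass (_ : (fun n => _) = cst 0) ?lim_cst//.
by apply/funext => n; rewrite /m /mass integral_set0.
Qed.

Let lim_ge0 E : (0 <= lim_mass E)%E.
Proof.
rewrite /lim_mass lee_fin; have [cE|/dvgP->//] := pselect (cvg (m n E @[n --> \oo])).
by apply: lim_seq_ge => // n; exact: (mass_ge0 (du n)).
Qed.

Let limU A B : measurable A -> measurable B -> A `&` B = set0 ->
  lim_mass (A `|` B) = (lim_mass A + lim_mass B)%E.
Proof.
move=> mA mB AB; rewrite /lim_mass -EFinD -(lim_seqD (cvgm mA) (cvgm mB)).
congr (limn _)%:E; apply/funext => n; rewrite /m (massU (du n) (uC n))//.
Qed.

Let lim_sigma_additive : semi_sigma_additive lim_mass.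
Proof.
move=> F mF tF mU.
pose S k := \big[setU/set0]_(i < k) F i; pose D k := (\bigcup_i F i) `\` S k.
have mS k : measurable (S k) by exact: bigsetU_measurable.
have SU k : S k `<=` \bigcup_i F i.
  by rewrite /S -bigcup_mkord => x [i _ Fix]; exists i.
have limS k : lim_mass (S k) = (\sum_(0 <= i < k) lim_mass (F i))%E.
  elim: k => [|k IH]; first by rewrite /S big_ord0 big_nil.
  rewrite /S big_ord_recr/= -/(S k) limU// ?IH ?big_nat_recr//=.
  rewrite -subset0 => x []; rewrite /S -bigcup_mkord => -[i /= ik Fix] Fkx.
  have ik' : i = k by apply: tF => //; exists x.
  by rewrite ik' ltnn in ik.
suff: lim_mass (S k) @[k --> \oo] --> lim_mass (\bigcup_n F n).
  by under eq_fun do rewrite limS.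
apply/fine_cvgP; split; first exact: nearW.
apply/cvg_realP => e e0.
have [] := @uca_mass D _ _ _ _ e0.
- by move=> j; exact: measurableD.
- move=> i j ij; apply: setDS; rewrite /S -!bigcup_mkord => x [k /= ki Fkx].
  by exists k => //=; exact: leq_trans ki ij.
- rewrite -subset0 => x Dx; have [[i _ Fix] _] := Dx 0%N I.
  have [_] := Dx i.+1 I; apply; rewrite /S -bigcup_mkord; exists i => //=.
move=> N HN; exists N => k Nk /=.
have cS := cvgm (mS k); have cU := cvgm mU.
rewrite distrC -(lim_seqB cU cS).
have cB := is_cvg_seqB cU cS; rewrite ger0_norm; last first.
  apply: lim_seq_ge => // n; rewrite subr_ge0; exact: (mass_le (du n) (uC n)).
apply: lim_seq_le => // n; have := HN k Nk n.
by rewrite /m (massD (du n) (uC n)).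
Qed.

HB.instance Definition _ := isMeasure.Build _ T R lim_mass
  lim0 lim_ge0 lim_sigma_additive.


Let lim_fin : fin_num_fun lim_mass.
Proof. by []. Qed.

HB.instance Definition _ := @Measure_isFinite.Build _ T R lim_mass lim_fin.

Let lim_dominated : lim_mass `<< mu.
Proof.
apply/null_content_dominatesP => A mA muA0.
rewrite /lim_mass (_ : (fun n => _) = cst 0) ?lim_cst//.
apply/funext => n; rewrite /m /mass null_set_integral//.
exact: measurable_funS (du n).1.
Qed.

Lemma lim_mass_density : exists v : T -> \bar R,
  [/\ density v, (forall x, v x \is a fin_num),
    (\int[mu]_x v x <= C%:E)%E &
    forall E, measurable E -> m n E @[n --> \oo] --> mass v E].
Proof.
have [v [v0 vfin vint vE]] := radon_nikodym_sigma_finite lim_dominated.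
exists v; split => //.
- by split => //; exact: measurable_int vint.
- rewrite -vE// /lim_mass lee_fin; apply: lim_seq_le; first exact: cvgm.
  move=> n; rewrite -lee_fin -(massE (du n) (uC n))//.
- move=> E mE; rewrite /mass -vE// /lim_mass /=; exact: cvgm.
Qed.

End limit_measure.
End limits.

Lemma setwise_limit_density (u : nat -> T -> \bar R) (C : R) :
  (forall n, density (u n)) -> (forall n, (\int[mu]_x u n x <= C%:E)%E) ->
  unif_countably_additive u ->
  (forall E, measurable E -> cvg (mass (u n) E @[n --> \oo])) ->
  exists v : T -> \bar R,
  [/\ density v, (forall x, v x \is a fin_num),
    (\int[mu]_x v x <= C%:E)%E &
    forall E, measurable E -> mass (u n) E @[n --> \oo] --> mass v E].
Proof. by move=> du uC uca cu; exact: lim_mass_density. Qed.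

(** Real valued for the same reason as [mass]; the test functions are bounded,
    so no value is lost. *)
Definition pairing (w : T -> \bar R) (g : T -> R) : R :=
  fine (\int[mu]_x ((g x)%:E * w x))%E.

Definition test_fun (M : R) (g : T -> R) :=
  measurable_fun setT g /\ forall x, 0 <= g x <= M.

Section pairing_theory.
Variables (w : T -> \bar R) (C : R).
Hypotheses (dw : density w) (wC : (\int[mu]_x w x <= C%:E)%E).

Lemma test_measurable M g : test_fun M g ->
  measurable_fun setT (fun x => (g x)%:E * w x)%E.
Proof.
by move=> [mg _]; apply: emeasurable_funM; [exact/measurable_EFinP|exact: dw.1].
Qed.

Lemma test_ge0 M g x : test_fun M g -> (0 <= (g x)%:E * w x)%E.
Proof.
move=> [_ /(_ x)/andP[g0 _]]; apply: mule_ge0; [by rewrite lee_fin|exact: dw.2].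
Qed.

Lemma pairingE M g : test_fun M g ->
  (\int[mu]_x ((g x)%:E * w x) = (pairing w g)%:E)%E.
Proof.
move=> tg; rewrite /pairing fineK// ge0_fin_numE; last first.
  by apply: integral_ge0 => x _; exact: test_ge0 tg.
have [x0|nT] := pselect (exists x : T, True); last first.
  rewrite (_ : setT = set0) ?integral_set0//.
  by rewrite -subset0 => x _; apply: nT; exists x.
have M0 : 0 <= M.
  by have [x _] := x0; have /andP[] := tg.2 x; exact: le_trans.
have le1 : (\int[mu]_x ((g x)%:E * w x) <= \int[mu]_x (M%:E * w x))%E.
  apply: ge0_le_integral => //.
  - by move=> x _; exact: test_ge0 tg.
  - exact: test_measurable tg.
  - by apply: emeasurable_funM => //; exact: dw.1.
  - move=> x _; apply: lee_wpmul2r; first exact: dw.2.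
    by rewrite lee_fin; have /andP[] := tg.2 x.
apply: (le_lt_trans le1); rewrite ge0_integralZl_EFin//; last 2 first.
  by move=> x _; exact: dw.2.
  exact: dw.1.
apply: (@le_lt_trans _ _ (M%:E * C%:E)%E); last by rewrite -EFinM ltry.
by apply: lee_wpmul2l => //; rewrite lee_fin.
Qed.

Lemma le_pairing M N g h : test_fun M g -> test_fun N h ->
  (forall x, g x <= h x) -> pairing w g <= pairing w h.
Proof.
move=> tg th gh; rewrite -lee_fin -(pairingE tg) -(pairingE th).
apply: ge0_le_integral => //.
- by move=> x _; exact: test_ge0 tg.
- exact: test_measurable tg.
- exact: test_measurable th.
- by move=> x _; apply: lee_wpmul2r; [exact: dw.2|rewrite lee_fin].
Qed.

Lemma test_funD M N g h : test_fun M g -> test_fun N h ->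
  test_fun (M + N) (fun x => g x + h x).
Proof.
move=> [mg Mg] [mh Nh]; split; first exact: measurable_funD.
by move=> x; have /andP[? ?] := Mg x; have /andP[? ?] := Nh x;
  rewrite addr_ge0//= lerD.
Qed.

Lemma test_funZ M c g : 0 <= c -> test_fun M g ->
  test_fun (c * M) (fun x => c * g x).
Proof.
move=> c0 [mg Mg]; split; first exact: measurable_funM.
by move=> x; have /andP[? ?] := Mg x; rewrite mulr_ge0//= ler_wpM2l.
Qed.

Lemma test_fun_indic E : measurable E -> test_fun 1 (\1_E : T -> R).
Proof.
move=> mE; split; first exact: measurable_indic.
by move=> x; rewrite indicE; case: (x \in E); rewrite /= ?lexx ?ler01.
Qed.

Lemma test_fun_cst c : 0 <= c -> test_fun c (cst c : T -> R).
Proof. by move=> c0; split => // x; rewrite /= c0 lexx. Qed.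

Lemma pairingD M N g h : test_fun M g -> test_fun N h ->
  pairing w (fun x => g x + h x) = pairing w g + pairing w h.
Proof.
move=> tg th; apply: EFin_inj; rewrite EFinD -(pairingE tg) -(pairingE th).
rewrite -(pairingE (test_funD tg th)) -ge0_integralD//.
- apply: eq_integral => x _; rewrite EFinD ge0_muleDl// lee_fin.
    by have /andP[] := tg.2 x.
  by have /andP[] := th.2 x.
- by move=> x _; exact: test_ge0 tg.
- exact: test_measurable tg.
- by move=> x _; exact: test_ge0 th.
- exact: test_measurable th.
Qed.

Lemma pairingZ M c g : 0 <= c -> test_fun M g ->
  pairing w (fun x => c * g x) = c * pairing w g.
Proof.
move=> c0 tg; apply: EFin_inj; rewrite EFinM -(pairingE tg).
rewrite -(pairingE (test_funZ c0 tg)) -ge0_integralZl_EFin//.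
- by apply: eq_integral => x _; rewrite EFinM muleA.
- by move=> x _; exact: test_ge0 tg.
- exact: test_measurable tg.
Qed.

Lemma pairing_indic E : measurable E -> pairing w \1_E = mass w E.
Proof.
move=> mE; rewrite /pairing /mass; congr fine.
rewrite [RHS]integral_mkcond; apply: eq_integral => x _.
rewrite patchE indicE; case: ifPn => _; by rewrite ?mul1e ?mul0e.
Qed.

Lemma pairing_ge0 M g : test_fun M g -> 0 <= pairing w g.
Proof.
by move=> tg; apply: fine_ge0; apply: integral_ge0 => x _; exact: test_ge0 tg.
Qed.

Lemma pairing_cst c : 0 <= c -> pairing w (cst c) <= c * C.
Proof.
move=> c0; rewrite -lee_fin -(pairingE (test_fun_cst c0)) EFinM.
rewrite /= ge0_integralZl_EFin//; last 2 first.
  by move=> x _; exact: dw.2.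
  exact: dw.1.
by apply: lee_wpmul2l; rewrite ?lee_fin.
Qed.

End pairing_theory.

Section pairing_limits.
Variables (u : nat -> T -> \bar R) (C : R).
Hypotheses (du : forall n, density (u n)) (C0 : 0 <= C)
  (uC : forall n, (\int[mu]_x u n x <= C%:E)%E)
  (uca : unif_countably_additive u).

(** Pointwise bounded convergence of test functions is uniform over a uniformly
    countably additive family: the sets where a later test function is
    still far from the limit decrease to the empty set. *)
Lemma pairing_cvg_uniform (M : R) (g : nat -> T -> R) (g0 : T -> R) :
  (forall j, test_fun M (g j)) -> test_fun M g0 -> 0 <= M ->
  (forall x, g j x @[j --> \oo] --> g0 x) ->
  forall e, 0 < e -> exists N, forall j, (N <= j)%N -> forall n,
    `|pairing (u n) (g j) - pairing (u n) g0| <= e.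
Proof.
move=> tg tg0 M0 gg0 e e0.
pose e1 := e / (C + M + 1).
have CM : 0 < C + M + 1 by rewrite ltr_wpDl// addr_ge0.
have e10 : 0 < e1 by rewrite divr_gt0.
pose B i := [set x | e1 < `|g i x - g0 x|].
have mB i : measurable (B i).
  rewrite (_ : B i = setT `&` (fun x => `|g i x - g0 x|) @^-1` `]e1, +oo[%classic).
    suff mf : measurable_fun setT (fun x => `|g i x - g0 x|) by exact: mf.
    apply: measurableT_comp => //.
    by apply: measurable_funB; [exact: (tg i).1|exact: tg0.1].
  by apply/seteqP; split=> x /=; rewrite in_itv/= andbT; tauto.
pose D j := \bigcup_(i in [set i | (j <= i)%N]) B i.
have mD j : measurable (D j) by apply: bigcup_measurable.
have [] := uca mD _ _ e10.
- by move=> i j ij x [k /= jk Bk]; exists k => //=; exact: leq_trans ij jk.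
- rewrite -subset0 => x Dx; have /cvg_realP/(_ _ e10)[N HN] := gg0 x.
  by have [k /= Nk] := Dx N I; rewrite /B /= ltNge HN.
move=> N HN; exists N => j Nj n.
have muD : mass (u n) (D N) <= e1.
  by rewrite -lee_fin -(massE (du n) (uC n))//; exact: HN.
have close x : `|g j x - g0 x| <= e1 + M * \1_(D N) x.
  rewrite indicE; have [xD|xD] := boolP (x \in D N).
    rewrite mulr1; apply: (@le_trans _ _ M); last by rewrite lerDr ltW.
    have /andP[? ?] := (tg j).2 x; have /andP[? ?] := tg0.2 x.
    by rewrite ler_norml; apply/andP; split; lra.
  rewrite mulr0 addr0 leNgt; apply/negP => Bx; move/negP: xD; apply.
  by rewrite inE; exists j.
have te := test_fun_cst (ltW e10).
have tD := test_funZ M0 (test_fun_indic (mD N)).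
have key (a b : T -> R) : test_fun M a -> test_fun M b ->
    (forall x, a x <= b x + (e1 + M * \1_(D N) x)) ->
    pairing (u n) a <= pairing (u n) b + e.
  move=> ta tb ab.
  have tbe := test_funD tb (test_funD te tD).
  apply: (le_trans (le_pairing (du n) (uC n) ta tbe ab)).
  rewrite (pairingD (du n) (uC n) tb (test_funD te tD)) lerD2l.
  rewrite (pairingD (du n) (uC n) te tD).
  rewrite (pairingZ (du n) (uC n) M0 (test_fun_indic (mD N))).
  rewrite pairing_indic//.
  have := pairing_cst (du n) (uC n) (ltW e10).
  have : M * mass (u n) (D N) <= M * e1 by rewrite ler_wpM2l.
  have : e1 * (C + M + 1) = e by rewrite /e1 divfK// gt_eqF.
  by rewrite /cst; move: e10; nra.
rewrite ler_norml lerBlDr lerBrDr [- e + _]addrC lerBlDr ![e + _]addrC.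
apply/andP; split; apply: key => //= x; have := close x; rewrite ler_norml => /andP[? ?]; lra.
Qed.

End pairing_limits.

Section staircase.

(** A finite sum of indicators below [g]: [floor (g / s)] steps of height [s],
    at most [k] of them. It reduces pairings to masses. *)
Fixpoint staircase (s : R) (g : T -> R) (k : nat) : T -> R :=
  if k is k'.+1 then fun x => staircase s g k' x +
    s * \1_[set y | k'.+1%:R * s <= g y] x
  else cst 0.

Lemma staircaseP s g k x : 0 < s -> 0 <= g x ->
  [/\ staircase s g k x <= g x, staircase s g k x <= k%:R * s &
   staircase s g k x = k%:R * s \/ g x - s <= staircase s g k x].
Proof.
move=> s0 g0; elim: k => [|k [IH1 IH2 IH3]] /=.
  by split; rewrite ?mul0r//; left.
have kS : k.+1%:R * s = k%:R * s + s by rewrite mulrSr mulrDl mul1r.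
rewrite kS indicE; case: (boolP (x \in _)); rewrite ?inE ?notin_setE /= => H.
  by rewrite mulr1; split; lra.
rewrite mulr0 addr0; have H' : g x < k%:R * s + s by rewrite ltNge; exact/negP.
by split; lra.
Qed.

Lemma staircase_level s (g : T -> R) (k : nat) : measurable_fun setT g ->
  measurable [set y | k.+1%:R * s <= g y].
Proof.
move=> mg; rewrite (_ : [set y | _] = setT `&` g @^-1` `[k.+1%:R * s, +oo[%classic).
  exact: mg.
by apply/seteqP; split=> x /=; rewrite in_itv/= andbT; tauto.
Qed.

Lemma test_fun_staircase s (g : T -> R) k : 0 <= s -> measurable_fun setT g ->
  exists M, test_fun M (staircase s g k).
Proof.
move=> s0 mg; elim: k => [|k [M IH]]; first by exists 0; exact: test_fun_cst.
exists (M + s * 1); apply: test_funD => //; apply: test_funZ => //.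
exact/test_fun_indic/staircase_level.
Qed.

End staircase.

Section pairing_setwise.
Variables (u : nat -> T -> \bar R) (C : R).
Hypotheses (du : forall n, density (u n)) (C0 : 0 <= C)
  (uC : forall n, (\int[mu]_x u n x <= C%:E)%E)
  (uca : unif_countably_additive u).
Variable v : T -> \bar R.
Hypotheses (dv : density v) (vC : (\int[mu]_x v x <= C%:E)%E)
  (uv : forall E, measurable E -> mass (u n) E @[n --> \oo] --> mass v E).

(** Linearity reduces the convergence to that of the masses of the level
    sets. *)
Let staircase_cvg s (g : T -> R) k : 0 <= s -> measurable_fun setT g ->
  pairing (u n) (staircase s g k) @[n --> \oo] --> pairing v (staircase s g k).
Proof.
move=> s0 mg; elim: k => [|k IH].
  have p0 w : pairing w (staircase s g 0) = 0.
    by rewrite /pairing /= integral0_eq// => x _; rewrite mul0e.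
  rewrite p0 (_ : (fun n => _) = cst 0); first exact: cvg_cst.
  by apply/funext => n; rewrite p0.
have [M tM] := test_fun_staircase k s0 mg.
have mE := staircase_level s k mg; have tE := test_fun_indic mE.
have pS w : density w -> (\int[mu]_x w x <= C%:E)%E ->
    pairing w (staircase s g k.+1) = pairing w (staircase s g k) +
      s * mass w [set y | k.+1%:R * s <= g y].
  move=> dw wC; rewrite [LHS](pairingD dw wC tM (test_funZ s0 tE)).
  by rewrite (pairingZ dw wC s0 tE) pairing_indic.
rewrite pS// (_ : (fun n => _) = (fun n => pairing (u n) (staircase s g k) +
      s * mass (u n) [set y | k.+1%:R * s <= g y])); last first.
  by apply/funext => n; exact: pS.
apply: cvgD => //; apply: cvgM; [exact: cvg_cst|exact: uv].
Qed.

(** The staircases approximate the test function uniformly, and all the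
    densities have mass at most [C]. *)
Lemma pairing_setwise_cvg M g : test_fun M g ->
  pairing (u n) g @[n --> \oo] --> pairing v g.
Proof.
move=> tg; apply/cvg_realP => e e0.
pose N := `|M| + 1; have N0 : 0 < N by rewrite ltr_wpDl.
have e1 : 0 < e / (4 * (C + 1)) by rewrite divr_gt0// mulr_gt0// ltr_wpDl.
have [k Hk] : exists k : nat, N / k.+1%:R <= e / (4 * (C + 1)).
  exists (Num.truncn (N / (e / (4 * (C + 1))))).
  rewrite ler_pdivrMr ?ltr0n// mulrC -ler_pdivrMr//.
  by rewrite ltW// truncnS_gt.
pose s := N / k.+1%:R; have s0 : 0 < s by rewrite divr_gt0// ltr0n.
have [L tL] := test_fun_staircase k.+1 (ltW s0) tg.1.
have gP x : staircase s g k.+1 x <= g x <= staircase s g k.+1 x + s.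
  have /andP[g0 gM] := tg.2 x.
  have [h1 h2 h3] := staircaseP k.+1 s0 g0; rewrite h1 andTb.
  case: h3 => [->|]; last by lra.
  have -> : k.+1%:R * s = N by rewrite /s mulrC divfK// pnatr_eq0.
  have := ler_norm M; rewrite /N; lra.
have ts := test_fun_cst (ltW s0).
have approx w : density w -> (\int[mu]_x w x <= C%:E)%E ->
    pairing w (staircase s g k.+1) <= pairing w g <=
    pairing w (staircase s g k.+1) + e / 4.
  move=> dw wC; apply/andP; split.
    by apply: (le_pairing dw wC tL tg) => x; have /andP[] := gP x.
  have tLs := test_funD tL ts.
  have : pairing w g <= pairing w (fun x => staircase s g k.+1 x + cst s x).
    by apply: (le_pairing dw wC tg tLs) => x; have /andP[] := gP x.
  move=> /le_trans; apply; rewrite (pairingD dw wC tL ts) lerD2l.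
  apply: (le_trans (pairing_cst dw wC (ltW s0))).
  apply: (@le_trans _ _ (e / (4 * (C + 1)) * (C + 1))).
    by apply: ler_pM => //; [exact: ltW|rewrite lerDl].
  by rewrite invfM mulrA mulfVK// gt_eqF// ltr_wpDl.
have e40 : 0 < e / 4 by rewrite divr_gt0.
have /cvg_realP/(_ _ e40)[K HK] := @staircase_cvg s g k.+1 (ltW s0) tg.1.
exists K => n Kn; have := HK n Kn.
have /andP[? ?] := approx _ dv vC; have /andP[? ?] := approx _ (du n) (uC n).
rewrite !ler_norml => /andP[? ?]; apply/andP; split; lra.
Qed.

(** Test functions that converge boundedly and pointwise may be paired with
    setwise convergent densities: both limits are taken at once. *)
Lemma pairing_cvg (M : R) (g : nat -> T -> R) (g0 : T -> R) : 0 <= M ->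
  (forall j, test_fun M (g j)) -> test_fun M g0 ->
  (forall x, g j x @[j --> \oo] --> g0 x) ->
  pairing (u n) (g n) @[n --> \oo] --> pairing v g0.
Proof.
move=> M0 tg tg0 gg0; apply/cvg_realP => e e0.
have e20 : 0 < e / 2 by rewrite divr_gt0.
have [N1 H1] := pairing_cvg_uniform du C0 uC uca tg tg0 M0 gg0 e20.
have /cvg_realP/(_ _ e20)[N2 H2] := pairing_setwise_cvg tg0.
exists (maxn N1 N2) => n; rewrite geq_max => /andP[n1 n2].
have := H1 n n1 n; have := H2 n n2.
rewrite !ler_norml => /andP[? ?] /andP[? ?]; apply/andP; split; lra.
Qed.

End pairing_setwise.
End setwise.

(** * Compactness for setwise convergence *)

Section extraction.
Context {R : realType}.

(** Diagonal extraction, as Tychonoff's theorem for a countable product of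
    segments: a subsequence is read off a cluster point. *)
Lemma diagonal_extraction (a : nat -> nat -> R) (c : nat -> R) :
  (forall n i, `|a n i| <= c i) ->
  exists s : nat -> nat, (forall n, (n <= s n)%N) /\
    forall i, cvg (a (s n) i @[n --> \oo]).
Proof.
move=> ac.
have /= := @tychonoff nat (fun _ => R) (fun i => `[- c i, c i]%classic)
  (fun i => @segment_compact R _ _).
move=> /(_ (a n @[n --> \oo]) _)[].
  by exists 0%N => // n _ i /=; rewrite in_itv/= -ler_norml; exact: ac.
move=> l [_ cl].
(* The neighbourhoods of [l] for the product topology control finitely many
   coordinates; the [n]-th one used here controls coordinates up to [n] within
   [1 / (n + 1)]. *)
have step n : exists m, (n <= m)%N /\ forall i, (i <= n)%N ->
    `|a m i - l i| < n.+1%:R^-1.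
  have nb : nbhs l [set f : nat -> R | forall i, (i <= n)%N ->
      `|f i - l i| < n.+1%:R^-1].
    suff H k : nbhs l [set f : nat -> R | forall i, (i < k)%N ->
        `|f i - l i| < n.+1%:R^-1] by exact: (H n.+1).
    elim: k => [|k IH]; first by apply: filterE => f i; rewrite ltn0.
    have n0 : 0 < n.+1%:R^-1 :> R by rewrite invr_gt0 ltr0n.
    have := @proj_continuous nat (fun _ => R) k l _ (nbhsx_ballx (l k) _ n0).
    move=> H; apply: filterS2 IH H => f fk fkk i.
    rewrite ltnS leq_eqVlt => /orP[/eqP->|/fk//].
    by move: fkk; rewrite /ball/= distrC.
  have Fn : (a n @[n --> \oo]) [set f | exists2 m, (n <= m)%N & f = a m].
    by exists n => // m /= nm; exists m.
  by have [f [[m nm ->] H]] := cl _ _ Fn nb; exists m.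
have [s Hs] := choice step; exists s; split=> [n|i]; first by have [] := Hs n.
apply/cvg_ex; exists (l i); apply/cvg_realP => e e0.
exists (maxn i (Num.truncn e^-1)) => n; rewrite geq_max => /andP[iN en].
have [_ /(_ i iN)/ltW/le_trans->//] := Hs n.
rewrite -[leRHS]invrK lef_pV2 ?posrE ?invr_gt0 ?ltr0n//.
apply: ltW; apply: (lt_le_trans (truncnS_gt _)).
by rewrite ler_nat ltnS.
Qed.

End extraction.

Section rays.
Context {R : realType}.

(** Open rays with rational endpoints and the whole line: a countable pi-system
    that generates the Borel sets. The whole line is needed to know that total
    masses converge. *)
Definition ray (o : option rat) : set R :=
  if o is Some q then `]ratr q, +oo[%classic else setT.

Lemma ray_setI : setI_closed (range ray).
Proof.
move=> _ _ [[p|] _ <-] [[q|] _ <-]; last 3 first.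
- by exists (Some p) => //; rewrite setIT.
- by exists (Some q) => //; rewrite setTI.
- by exists None => //; rewrite setTI.
exists (Some (Num.max p q)) => //; apply/seteqP; split => x; rewrite /= !in_itv/= !andbT.
  by case: (leP p q) => pq; [move=> qx|move=> px]; split => //;
    [apply: le_lt_trans qx|apply: lt_trans px]; rewrite ?ler_rat ?ltr_rat.
by move=> [px qx]; case: (leP p q).
Qed.

Lemma rays_generate : @measurable _ (measurableTypeR R) = <<s range ray >>.
Proof.
have -> : @measurable _ (measurableTypeR R) = <<s @RGenOInfty.G R >>.
  exact: RGenOInfty.measurableE.
apply/seteqP; split.
  apply: smallest_sub; first exact: smallest_sigma_algebra.
  move=> _ [x ->].
  have -> : `]x, +oo[%classic =
      \bigcup_(q : rat) (if x < ratr q then ray (Some q) else set0).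
    apply/seteqP; split => y /=; rewrite in_itv/= andbT.
      move=> /rat_in_itvoo[q]; rewrite in_itv/= => /andP[xq qy].
      by exists q => //; rewrite xq /= in_itv/= qy.
    move=> [q _]; case: ifPn => //= xq; rewrite in_itv/= andbT.
    exact: lt_trans.
  apply: (@bigcupT_measurable_rat _ (g_sigma_algebraType (range ray))) => q.
  case: ifPn => _; last exact: measurable0.
  by apply: sub_sigma_algebra; exists (Some q).
apply: smallest_sub; first exact: smallest_sigma_algebra.
move=> _ [[q|] _ <-]; last exact: (@measurableT _ (g_sigma_algebraType (@RGenOInfty.G R))).
by apply: sub_sigma_algebra; exists (ratr q).
Qed.

End rays.

Section compactness.
Context d (T : measurableType d) (R : realType)
  (mu : {sigma_finite_measure set T -> \bar R}).

(** A diagonal subsequence converges setwise at all times: a countable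
    generating pi-system and countably many times suffice for the extraction,
    uniform countable additivity and equicontinuity give the rest. *)
Lemma setwise_compactness (J J' : countType) (G : J -> set T) (tau : J' -> R)
    (I : set R) (u : nat -> R -> T -> \bar R) (C : R -> R) :
  (exists j, G j = setT) -> setI_closed (range G) ->
  @measurable _ T = <<s range G >> ->
  (forall i, I (tau i)) -> (forall t, 0 <= C t) ->
  (forall t n, I t -> density (u n t) /\ (\int[mu]_x u n t x <= (C t)%:E)%E) ->
  (forall t, I t -> unif_countably_additive mu (u ^~ t)) ->
  (forall t, I t -> forall e, 0 < e -> exists i N, forall n, (N <= n)%N ->
    forall E, measurable E ->
      `|mass mu (u n t) E - mass mu (u n (tau i)) E| <= e) ->
  exists s : nat -> nat, (forall n, (n <= s n)%N) /\
  exists v : R -> T -> \bar R, forall t, I t ->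
    [/\ density (v t), (forall x, v t x \is a fin_num),
      (\int[mu]_x v t x <= (C t)%:E)%E &
      forall E, measurable E -> mass mu (u (s n) t) E @[n --> \oo] --> mass mu (v t) E].
Proof.
move=> GT GI Gm Itau C0 du uca equi.
have mG j : measurable (G j) by rewrite Gm; apply: sub_sigma_algebra; exists j.
(* All pairs of a time and a generating set are numbered, with value 0 at the
   numbers that encode no pair. *)
pose a n (k : nat) : R := if unpickle k is Some (i, j)
  then mass mu (u n (tau i)) (G j) else 0.
pose c (k : nat) : R := if unpickle k is Some (i, j)
  then (fun (i : J') (j : J) => C (tau i)) i j else 0.
have mass_bound t n E : I t -> measurable E -> `|mass mu (u n t) E| <= C t.
  move=> It mE; have [dt Ct] := du t n It.
  rewrite ger0_norm; last exact: (mass_ge0 mu dt).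
  rewrite -lee_fin -(massE dt Ct)//; apply: le_trans Ct.
  apply: ge0_subset_integral => //; [exact: dt.1|by move=> x _; exact: dt.2].
have [n k|s [sn cs]] := @diagonal_extraction _ a c.
  rewrite /a /c; case: unpickle => [[i j]|]; last by rewrite normr0.
  exact: mass_bound.
exists s; split => //.
suff H t : exists v, I t -> [/\ density v, (forall x, v x \is a fin_num),
      (\int[mu]_x v x <= (C t)%:E)%E &
      forall E, measurable E -> mass mu (u (s n) t) E @[n --> \oo] --> mass mu v E].
  by have [v Hv] := choice H; exists v => t; exact: Hv.
have [It|] := pselect (I t); last by exists (cst 0%E).
suff cG j : cvg (mass mu (u (s n) t) (G j) @[n --> \oo]).
  have dus n : density (u (s n) t) by have [] := du t (s n) It.
  have uCs n : (\int[mu]_x u (s n) t x <= (C t)%:E)%E by have [] := du t (s n) It.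
  have ucas : unif_countably_additive mu (fun n => u (s n) t).
    move=> E mE Ei E0 e e0; have [j Hj] := uca t It E mE Ei E0 e e0.
    by exists j => n; exact: Hj.
  have [v Hv] : exists v, [/\ density v, (forall x, v x \is a fin_num),
      (\int[mu]_x v x <= (C t)%:E)%E &
      forall E, measurable E -> mass mu (u (s n) t) E @[n --> \oo] --> mass mu v E].
    apply: setwise_limit_density => // E mE.
    have [jT GjT] := GT.
    apply: (cvg_all_measurable dus uCs ucas GI Gm) => //.
      by move=> _ [j _ <-]; split.
    by rewrite -GjT; split.
  by exists v.
apply: cvg_uniform_approx => e e0.
have [i [N HN]] := equi t It e e0.
exists (fun n => mass mu (u (s n) (tau i)) (G j)); split.
  have := cs (pickle (i, j)).
  by rewrite (_ : (fun n => _) = (fun n => mass mu (u (s n) (tau i)) (G j)))//;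
    apply/funext => n; rewrite /a pickleK.
by exists N => n Nn; apply: HN => //; exact: leq_trans (sn n).
Qed.
End compactness.

(** * Collision integrals *)

Section nonneg_integrals.
Context d (T : measurableType d) (R : realType) (mu : {measure set T -> \bar R}).
Implicit Types f g : T -> \bar R.

Lemma density_measurable f (D : set T) : density f -> measurable_fun D f.
Proof. by move=> df; exact: measurable_funS df.1. Qed.

Lemma densityM f g : density f -> density g -> density (fun x => f x * g x)%E.
Proof.
move=> df dg; split; first by apply: emeasurable_funM; [exact: df.1|exact: dg.1].
by move=> x; apply: mule_ge0; [exact: df.2|exact: dg.2].
Qed.

Lemma densityD f g : density f -> density g -> density (fun x => f x + g x)%E.
Proof.
move=> df dg; split; first by apply: emeasurable_funD; [exact: df.1|exact: dg.1].
by move=> x; apply: adde_ge0; [exact: df.2|exact: dg.2].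
Qed.

Lemma density_EFin (f : T -> R) : measurable_fun setT f -> (forall x, 0 <= f x) ->
  density (fun x => (f x)%:E).
Proof. by move=> mf f0; split; [exact/measurable_EFinP|move=> x; rewrite lee_fin]. Qed.

Lemma density_cst (c : R) : 0 <= c -> density (fun _ : T => c%:E).
Proof. by move=> c0; apply: density_EFin. Qed.

Lemma int_density_ge0 f : density f -> (0 <= \int[mu]_x f x)%E.
Proof. by move=> df; apply: integral_ge0 => x _; exact: df.2. Qed.

Lemma int_densityD f g : density f -> density g ->
  (\int[mu]_x (f x + g x) = \int[mu]_x f x + \int[mu]_x g x)%E.
Proof.
by move=> df dg; apply: ge0_integralD => //; move=> *;
  solve [exact: df.1|exact: df.2|exact: dg.1|exact: dg.2].
Qed.

Lemma int_densityZ (c : R) f : 0 <= c -> density f ->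
  (\int[mu]_x (c%:E * f x) = c%:E * \int[mu]_x f x)%E.
Proof.
by move=> c0 df; apply: ge0_integralZl_EFin => //; move=> *;
  solve [exact: df.1|exact: df.2].
Qed.

Lemma int_densityZe (c : \bar R) f : (0 <= c)%E -> density f ->
  (\int[mu]_x (c * f x) = c * \int[mu]_x f x)%E.
Proof.
by move=> c0 df; apply: ge0_integralZl => //; move=> *;
  solve [exact: df.1|exact: df.2].
Qed.

Lemma le_int_density f g : density f -> density g -> (forall x, (f x <= g x)%E) ->
  (\int[mu]_x f x <= \int[mu]_x g x)%E.
Proof.
move=> df dg fg; apply: ge0_le_integral => //;
  by move=> *; solve [exact: df.1|exact: df.2|exact: dg.1|exact: fg].
Qed.

End nonneg_integrals.

Section Fubini.
Context d1 d2 (T1 : measurableType d1) (T2 : measurableType d2) (R : realType)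
  (m1 : {sigma_finite_measure set T1 -> \bar R})
  (m2 : {sigma_finite_measure set T2 -> \bar R}).

Lemma density_int2 (f : T1 * T2 -> \bar R) : density f ->
  density (fun x => \int[m2]_y f (x, y))%E.
Proof.
move=> [mf f0]; split; first exact: (@measurable_fun_fubini_tonelli_F _ _ T1 T2 R m2 f).
by move=> x; apply: integral_ge0 => y _; exact: f0.
Qed.

Lemma density_int1 (f : T1 * T2 -> \bar R) : density f ->
  density (fun y => \int[m1]_x f (x, y))%E.
Proof.
move=> [mf f0]; split; first exact: (@measurable_fun_fubini_tonelli_G _ _ T1 T2 R m1 f).
by move=> x; apply: integral_ge0 => y _; exact: f0.
Qed.

Lemma density_fst (f : T1 -> \bar R) : density f -> density (fun u : T1 * T2 => f u.1).
Proof.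
move=> df; split; last by move=> u; exact: df.2.
apply: (measurableT_comp df.1); exact: measurable_fst.
Qed.

Lemma density_snd (f : T2 -> \bar R) : density f -> density (fun u : T1 * T2 => f u.2).
Proof.
move=> df; split; last by move=> u; exact: df.2.
apply: (measurableT_comp df.1); exact: measurable_snd.
Qed.

End Fubini.

Section fragmentation_step.
Context d (T : measurableType d) (R : realType)
  (mu : {sigma_finite_measure set T -> \bar R}).
Variables (frag : T -> T * T -> R) (K : T * T -> R).
Hypotheses (mfrag : measurable_fun setT (fun u : T * (T * T) => frag u.1 u.2))
  (frag0 : forall z u, 0 <= frag z u)
  (mK : measurable_fun setT K) (K0 : forall u, 0 <= K u).
Implicit Types (w : T -> \bar R) (phi : T -> R) (Theta : T * T -> \bar R).

(** In this section [w] is the number density of particle sizes, [K] the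
    collision kernel and [frag z (x, y)] the density of fragments of size [z]
    left by a particle of size [x] that hits one of size [y]. Everything is
    non-negative and extended real, so that Tonelli's theorem is available
    without integrability. *)
Definition moment_of phi w : \bar R := (\int[mu]_x ((phi x)%:E * w x))%E.

Definition collisions Theta w : \bar R :=
  (\int[mu]_x \int[mu]_y (Theta (x, y) * ((K (x, y))%:E * (w x * w y))))%E.

Definition fragments phi (u : T * T) : \bar R :=
  (\int[mu]_z ((phi z)%:E * (frag z u)%:E))%E.

Definition rate w x : \bar R := (\int[mu]_y ((K (x, y))%:E * w y))%E.

(** The gain of the equation carries a factor one half and counts the fragments
    of both particles. By symmetry of the kernel it equals this integral, which
    counts over ordered pairs the fragments of the first particle. *)
Definition gain w z : \bar R :=
  (\int[mu]_x \int[mu]_y ((frag z (x, y))%:E * ((K (x, y))%:E * (w x * w y))))%E.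

Definition nonneg_measurable phi :=
  measurable_fun setT phi /\ forall x, 0 <= phi x.

Let d_test phi : nonneg_measurable phi -> density (fun x => (phi x)%:E).
Proof. by move=> [mp p0]; exact: density_EFin. Qed.

Let dK : density (fun u => (K u)%:E). Proof. exact: density_EFin. Qed.

Let dfrag : density (fun u : T * (T * T) => (frag u.1 u.2)%:E).
Proof. by apply: density_EFin => // -[z u]; exact: frag0. Qed.

Lemma density_pair w : density w ->
  density (fun u : T * T => (K u)%:E * (w u.1 * w u.2))%E.
Proof.
move=> dw; have d1 : density (fun u : T * T => w u.1) by exact: density_fst.
have d2 : density (fun u : T * T => w u.2) by exact: density_snd.
exact: (densityM dK (densityM d1 d2)).
Qed.

Lemma density_fragments phi : nonneg_measurable phi -> density (fragments phi).
Proof.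
move=> dphi; apply: (@density_int1 _ _ T (T * T)%type R mu
  (fun u => (phi u.1)%:E * (frag u.1 u.2)%:E)%E).
have d1 : density (fun u : T * (T * T) => (phi u.1)%:E).
  exact: (@density_fst _ _ T (T * T)%type R _ (d_test dphi)).
exact: (densityM d1 dfrag).
Qed.

Lemma density_rate w : density w -> density (rate w).
Proof.
move=> dw; apply: (@density_int2 _ _ T T R mu (fun u => (K u)%:E * w u.2)%E).
have d2 : density (fun u : T * T => w u.2) by exact: density_snd.
exact: (densityM dK d2).
Qed.

Let dgain2 w : density w ->
  density (fun u : T * (T * T) => (frag u.1 u.2)%:E *
    ((K u.2)%:E * (w u.2.1 * w u.2.2)))%E.
Proof.
move=> dw.
have d2 : density (fun u : T * (T * T) => (K u.2)%:E * (w u.2.1 * w u.2.2))%E.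
  exact: (@density_snd _ _ T (T * T)%type R _ (density_pair dw)).
exact: (densityM dfrag d2).
Qed.


(** The triple products are associated in one way for Fubini's theorem in the
    first variable and in the other way for the last one. *)
Let reassoc (f : T * (T * T) -> \bar R) : density f ->
  density (fun v : (T * T) * T => f (v.1.1, (v.1.2, v.2))).
Proof.
move=> [mf f0]; split; last by move=> v; exact: f0.
apply: (measurableT_comp mf); apply: measurable_fun_pair => /=.
  apply: (measurableT_comp measurable_fst); exact: measurable_fst.
apply: measurable_fun_pair => /=; last exact: measurable_snd.
apply: (measurableT_comp measurable_snd); exact: measurable_fst.
Qed.

Let section (f : T * T -> \bar R) x : density f -> density (fun y => f (x, y)).
Proof.
move=> [mf f0]; split; last by move=> v; exact: f0.
by apply: (measurableT_comp mf); exact: pair1_measurable.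
Qed.

Let section3 (f : T * (T * T) -> \bar R) z : density f ->
  density (fun u => f (z, u)).
Proof.
move=> [mf f0]; split; last by move=> v; exact: f0.
by apply: (measurableT_comp mf); exact: pair1_measurable.
Qed.

Let section3' (f : T * (T * T) -> \bar R) u : density f ->
  density (fun z => f (z, u)).
Proof.
move=> [mf f0]; split; last by move=> v; exact: f0.
by apply: (measurableT_comp mf); exact: pair2_measurable.
Qed.

Let swap3 (f : T * (T * T) -> \bar R) x : density f ->
  density (fun u : T * T => f (u.1, (x, u.2))).
Proof.
move=> [mf f0]; split; last by move=> v; exact: f0.
apply: (measurableT_comp mf); apply: measurable_fun_pair => /=.
  exact: measurable_fst.
by apply: measurable_fun_pair => //; exact: measurable_snd.
Qed.

Let fubini3 (f : T * (T * T) -> \bar R) : density f ->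
  (\int[mu]_z \int[mu]_x \int[mu]_y f (z, (x, y)) =
   \int[mu]_x \int[mu]_y \int[mu]_z f (z, (x, y)))%E.
Proof.
move=> df; have d1 := density_int2 mu (reassoc df).
rewrite (@fubini_tonelli _ _ T T R mu mu
  (fun u : T * T => \int[mu]_y f (u.1, (u.2, y)))%E d1.1 d1.2).
apply: eq_integral => x _; have d2 := swap3 x df.
exact: (@fubini_tonelli _ _ T T R mu mu
  (fun u : T * T => f (u.1, (x, u.2)))%E d2.1 d2.2).
Qed.

Lemma density_gain w : density w -> density (gain w).
Proof.
move=> dw; have d1 := density_int2 mu (reassoc (dgain2 dw)).
exact: (density_int2 mu d1).
Qed.

Lemma density_collisions Theta w : density Theta -> density w ->
  density (fun u => Theta u * ((K u)%:E * (w u.1 * w u.2)))%E.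
Proof. by move=> dT dw; exact: (densityM dT (density_pair dw)). Qed.

Lemma collisions_ge0 Theta w : density Theta -> density w ->
  (0 <= collisions Theta w)%E.
Proof.
move=> dT dw; apply: int_density_ge0.
exact: (density_int2 mu (density_collisions dT dw)).
Qed.

Lemma moment_of_ge0 phi w : nonneg_measurable phi -> density w ->
  (0 <= moment_of phi w)%E.
Proof. by move=> dp dw; apply/int_density_ge0/densityM => //; exact: d_test. Qed.

Lemma le_collisions Theta Theta' w : density Theta -> density Theta' ->
  density w -> (forall x y, w x != 0%E -> w y != 0%E -> (Theta (x, y) <= Theta' (x, y))%E) ->
  (collisions Theta w <= collisions Theta' w)%E.
Proof.
move=> dT dT' dw le.
have d1 := density_collisions dT dw; have d2 := density_collisions dT' dw.
apply: le_int_density => [||x].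
- exact: (density_int2 mu d1).
- exact: (density_int2 mu d2).
apply: le_int_density => [||y].
- exact: (section x d1).
- exact: (section x d2).
have [wx|wx] := eqVneq (w x) 0%E; first by rewrite wx mul0e mule0 !mule0.
have [wy|wy] := eqVneq (w y) 0%E; first by rewrite wy mule0 !mule0.
by apply: lee_wpmul2r; [exact: (density_pair dw).2 (x, y)|exact: le].
Qed.

Lemma collisionsD Theta Theta' w : density Theta -> density Theta' ->
  density w -> collisions (fun u => Theta u + Theta' u)%E w =
  (collisions Theta w + collisions Theta' w)%E.
Proof.
move=> dT dT' dw.
have d1 := density_collisions dT dw; have d2 := density_collisions dT' dw.
rewrite /collisions -int_densityD; [|exact: (density_int2 mu d1)|exact: (density_int2 mu d2)].
apply: eq_integral => x _.
rewrite -int_densityD; [|exact: (section x d1)|exact: (section x d2)].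
apply: eq_integral => y _; rewrite ge0_muleDl//; [exact: dT.2|exact: dT'.2].
Qed.

Lemma collisionsZ (c : R) Theta w : 0 <= c -> density Theta ->
  density w -> collisions (fun u => c%:E * Theta u)%E w =
  (c%:E * collisions Theta w)%E.
Proof.
move=> c0 dT dw.
have d1 := density_collisions dT dw.
rewrite /collisions -int_densityZ//; last exact: (density_int2 mu d1).
apply: eq_integral => x _.
rewrite -int_densityZ//; last exact: (section x d1).
by apply: eq_integral => y _; rewrite -muleA.
Qed.

Lemma collisions_swap Theta w : (forall x y, K (x, y) = K (y, x)) ->
  density Theta -> density w ->
  collisions (fun u => Theta (u.2, u.1)) w = collisions Theta w.
Proof.
move=> Ks dT dw; have d1 := density_collisions dT dw.
rewrite /collisions (@fubini_tonelli _ _ T T R mu mu _ d1.1 d1.2).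
apply: eq_integral => x _; apply: eq_integral => y _ /=.
by rewrite Ks (muleC (w x)).
Qed.

(** A symbol that depends on the first particle alone only sees the rate at
    which that particle collides. *)
Lemma collisions_fst phi w : nonneg_measurable phi -> density w ->
  collisions (fun u => (phi u.1)%:E) w =
  (\int[mu]_x ((phi x)%:E * (rate w x * w x)))%E.
Proof.
move=> dp dw; apply: eq_integral => x _ /=.
have d2 : density (fun u : T * T => w u.2) by exact: density_snd.
rewrite int_densityZe; last 2 first.
- by rewrite lee_fin; exact: dp.2.
- exact: (section x (density_pair dw)).
congr (_ * _)%E; rewrite muleC -int_densityZe; last 2 first.
- exact: dw.2.
- exact: (section x (densityM dK d2)).
by apply: eq_integral => y _; rewrite muleCA.
Qed.

(** The duality between the gain term and [fragments]: Fubini's theorem moves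
    the integral over the size of the fragment inside. *)
Lemma moment_gain phi w : nonneg_measurable phi -> density w ->
  (\int[mu]_z ((phi z)%:E * gain w z) = collisions (fragments phi) w)%E.
Proof.
move=> dp dw.
have d1 : density (fun u : T * (T * T) => (phi u.1)%:E).
  exact: (@density_fst _ _ T (T * T)%type R _ (d_test dp)).
have d3 := densityM d1 (dgain2 dw).
transitivity (\int[mu]_z \int[mu]_x \int[mu]_y ((phi z)%:E *
    ((frag z (x, y))%:E * ((K (x, y))%:E * (w x * w y)))))%E.
  have d4 := density_int2 mu (reassoc (dgain2 dw)).
  have p0 z : (0 <= (phi z)%:E)%E by rewrite lee_fin; exact: dp.2.
  apply: eq_integral => z _; rewrite -int_densityZe//; last exact: (section z d4).
  apply: eq_integral => x _; rewrite -int_densityZe//.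
  exact: (section x (section3 z (dgain2 dw))).
rewrite (fubini3 d3); apply: eq_integral => x _; apply: eq_integral => y _ /=.
rewrite /fragments [RHS]muleC -int_densityZe; last 2 first.
- exact: (density_pair dw).2 (x, y).
- exact: (section3' (x, y) (densityM d1 dfrag)).
by apply: eq_integral => z _; rewrite [RHS]muleC -muleA.
Qed.

End fragmentation_step.

(** * One explicit Euler step *)

Section euler_step.
Context d (T : measurableType d) (R : realType)
  (mu : {sigma_finite_measure set T -> \bar R}).
Variables (frag : T -> T * T -> R) (K : T * T -> R) (N : R).
Hypotheses (mfrag : measurable_fun setT (fun u : T * (T * T) => frag u.1 u.2))
  (frag0 : forall z u, 0 <= frag z u)
  (mK : measurable_fun setT K) (K0 : forall u, 0 <= K u)
  (KN : forall u, K u <= N) (N0 : 0 <= N).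
Implicit Types (w : T -> \bar R) (phi : T -> R) (Theta : T * T -> \bar R).

(** Explicit Euler step; it is skipped when the time step is too large for the
    loss term to keep the density non-negative. *)
Definition euler (h : R) w (z : T) : \bar R :=
  if h * (N * fine (\int[mu]_x w x)%E) <= 1
  then (w z * (1 - h * fine (rate mu K w z))%:E + h%:E * gain mu frag K w z)%E
  else w z.

(** The weak form of one step of length [h]. The loss is on the left and the
    gain on the right: all terms are non-negative and the identity holds for
    every [phi], also when some of them are infinite. *)
Definition breaks (h : R) w w' := forall phi, nonneg_measurable phi ->
  (moment_of mu phi w' + h%:E * collisions mu K (fun u => (phi u.1)%:E) w =
   moment_of mu phi w + h%:E * collisions mu K (fragments mu frag phi) w)%E.

Section finite_number.
Variable w : T -> \bar R.
Hypotheses (dw : density w) (wfin : (\int[mu]_x w x < +oo)%E).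

Let int_fin : (\int[mu]_x w x)%E \is a fin_num.
Proof. by rewrite ge0_fin_numE//; exact: int_density_ge0. Qed.

Lemma rate_le x : (rate mu K w x <= (N * fine (\int[mu]_x w x)%E)%:E)%E.
Proof.
rewrite EFinM fineK// -int_densityZ//; apply: le_int_density => [||y].
- have d2 : density (fun u : T * T => w u.2) by exact: density_snd.
  have dK : density (fun u => (K u)%:E) by exact: density_EFin.
  have [mf f0] := densityM dK d2; split; last by move=> y; exact: f0 (x, y).
  by apply: (measurableT_comp mf); exact: pair1_measurable.
- by apply: (densityM _ dw); exact: density_cst.
- by apply: lee_wpmul2r; [exact: dw.2|rewrite lee_fin].
Qed.

Let rateE x : rate mu K w x = (fine (rate mu K w x))%:E.
Proof.
rewrite fineK// ge0_fin_numE; last exact: (density_rate mu mK K0 dw).2.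
exact: le_lt_trans (rate_le x) (ltry _).
Qed.

Let fine_rate_le x : 0 <= fine (rate mu K w x) <= N * fine (\int[mu]_x w x)%E.
Proof.
rewrite -!lee_fin -rateE rate_le andbT; exact: (density_rate mu mK K0 dw).2.
Qed.

Let loss_ge0 h x : 0 <= h -> h * (N * fine (\int[mu]_x w x)%E) <= 1 ->
  0 <= 1 - h * fine (rate mu K w x).
Proof.
move=> h0 hN; have /andP[_ r] := fine_rate_le x.
by rewrite subr_ge0; apply: le_trans hN; rewrite ler_wpM2l.
Qed.

Let density_remaining h : 0 <= h -> h * (N * fine (\int[mu]_x w x)%E) <= 1 ->
  density (fun z => w z * (1 - h * fine (rate mu K w z))%:E)%E.
Proof.
move=> h0 hN; apply: densityM dw _; apply: density_EFin => [|x]; last exact: loss_ge0.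
apply: measurable_funB => //; apply: measurable_funM => //.
have [mr _] := density_rate mu mK K0 dw.
by apply: (measurableT_comp _ mr); exact: fine_measurable.
Qed.

Lemma density_euler h : 0 <= h -> density (euler h w).
Proof.
move=> h0; have [hN|/negbTE hN] := boolP (h * (N * fine (\int[mu]_x w x)%E) <= 1).
  rewrite (_ : euler h w = fun z => (w z * (1 - h * fine (rate mu K w z))%:E +
    h%:E * gain mu frag K w z)%E); last by apply/funext => z; rewrite /euler hN.
  apply: densityD; first exact: density_remaining.
  apply: densityM; first exact: density_cst.
  exact: (density_gain mu mfrag frag0 mK K0 dw).
by rewrite (_ : euler h w = w)//; apply/funext => z; rewrite /euler hN.
Qed.

Lemma euler_support h (D : set T) : (forall z u, ~ D z -> frag z u = 0) ->
  (forall z, ~ D z -> w z = 0%E) -> forall z, ~ D z -> euler h w z = 0%E.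
Proof.
move=> fD wD z Dz; rewrite /euler wD//; case: ifPn => // _; rewrite mul0e add0e.
rewrite /gain integral0_eq ?mule0// => x _; rewrite integral0_eq// => y _.
by rewrite fD// mul0e.
Qed.

(** A skipped step is a step of length 0, so that all estimates for [breaks]
    cover it. *)
Lemma breaks_zero : breaks 0 w w.
Proof. by move=> phi dp; rewrite !mul0e. Qed.

(** The length [h'] is [h] or 0 according to whether the step was made; the
    last clause recovers [h' = h] when the number of particles is under
    control. *)
Lemma euler_breaks h : 0 <= h -> exists h', [/\ 0 <= h' <= h,
  (h * (N * fine (\int[mu]_x w x)%E) <= 1 -> h' = h) & breaks h' w (euler h w)].
Proof.
move=> h0; have [hN|hN] := boolP (h * (N * fine (\int[mu]_x w x)%E) <= 1); last first.
  exists 0; split; [by rewrite lexx|by []|].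
  rewrite (_ : euler h w = w); first exact: breaks_zero.
  by apply/funext => z; rewrite /euler (negbTE hN).
exists h; split; [by rewrite h0 lexx|by []|].
move=> phi dp.
have dphi : density (fun x => (phi x)%:E) by apply: density_EFin; case: dp.
have dg := density_gain mu mfrag frag0 mK K0 dw.
have drem := density_remaining h0 hN.
have dr := density_rate mu mK K0 dw.
have dh : density (fun _ : T => h%:E) by exact: density_cst.
have -> : moment_of mu phi (euler h w) =
    (\int[mu]_x ((phi x)%:E * (w x * (1 - h * fine (rate mu K w x))%:E))
     + h%:E * collisions mu K (fragments mu frag phi) w)%E.
  rewrite -(moment_gain mu mfrag frag0 mK K0 dp dw) -int_densityZ//; last exact: densityM.
  rewrite -int_densityD; last 2 first.
  - exact: (densityM dphi drem).
  - exact: (densityM dh (densityM dphi dg)).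
  apply: eq_integral => z _; rewrite /euler hN ge0_muleDr; last 2 first.
  - exact: drem.2.
  - exact: (densityM dh dg).2.
  by congr (_ + _)%E; rewrite muleCA.
rewrite addeAC; congr (_ + _)%E.
rewrite (collisions_fst mu mK K0 dp dw) -int_densityZ//; last first.
  exact: (densityM dphi (densityM dr dw)).
rewrite -int_densityD; last 2 first.
- exact: (densityM dphi drem).
- exact: (densityM dh (densityM dphi (densityM dr dw))).
apply: eq_integral => x _.
rewrite (muleCA h%:E) -ge0_muleDr; last 2 first.
- exact: drem.2.
- exact: (densityM dh (densityM dr dw)).2.
congr (_ * _)%E; rewrite (muleC (rate _ _ _ _)) muleCA rateE -EFinM.
rewrite -ge0_muleDr ?lee_fin.
- by rewrite -EFinD subrK mule1.
- exact: loss_ge0.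
- by rewrite mulr_ge0//; have /andP[] := fine_rate_le x.
Qed.

Lemma collisions_fst_le phi : nonneg_measurable phi ->
  (collisions mu K (fun u => (phi u.1)%:E) w <=
   (N * fine (\int[mu]_x w x)%E)%:E * moment_of mu phi w)%E.
Proof.
move=> dp.
have dphi : density (fun x => (phi x)%:E) by apply: density_EFin; case: dp.
have dr := density_rate mu mK K0 dw.
have NM0 : 0 <= N * fine (\int[mu]_x w x)%E.
  by rewrite mulr_ge0// fine_ge0//; exact: int_density_ge0.
rewrite (collisions_fst mu mK K0 dp dw) -int_densityZ//; last exact: densityM.
apply: le_int_density => [||x].
- exact: (densityM dphi (densityM dr dw)).
- by apply: (densityM _ (densityM dphi dw)); exact: density_cst.
- rewrite [leRHS]muleCA; apply: lee_wpmul2l; first exact: dphi.2.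
  by apply: lee_wpmul2r; [exact: dw.2|exact: rate_le].
Qed.

Let collisions_fst_fin phi : nonneg_measurable phi ->
  (moment_of mu phi w < +oo)%E ->
  collisions mu K (fun u => (phi u.1)%:E) w \is a fin_num.
Proof.
move=> dp fin.
have dphi : density (fun u : T * T => (phi u.1)%:E).
  apply: density_EFin => [|u]; last exact: dp.2.
  by apply: (measurableT_comp dp.1); exact: measurable_fst.
rewrite ge0_fin_numE; last exact: collisions_ge0.
apply: (le_lt_trans (collisions_fst_le dp)).
rewrite lte_mul_pinfty ?lee_fin//.
by rewrite mulr_ge0// fine_ge0//; exact: int_density_ge0.
Qed.

Variables (h : R) (w' : T -> \bar R).
Hypotheses (h0 : 0 <= h) (dw' : density w') (bw : breaks h w w').

Lemma breaks_growth phi : nonneg_measurable phi ->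
  (moment_of mu phi w' <= moment_of mu phi w +
   h%:E * collisions mu K (fragments mu frag phi) w)%E.
Proof.
move=> dp; rewrite -(bw dp) leeDl// mule_ge0//.
apply: collisions_ge0 => //; apply: density_EFin => [|u]; last exact: dp.2.
by apply: (measurableT_comp dp.1); exact: measurable_fst.
Qed.

Lemma breaks_decay phi : nonneg_measurable phi ->
  (moment_of mu phi w <= moment_of mu phi w' +
   h%:E * collisions mu K (fun u => (phi u.1)%:E) w)%E.
Proof.
move=> dp; rewrite (bw dp) leeDl// mule_ge0//.
by apply: collisions_ge0 => //; exact: density_fragments.
Qed.

(** If no collision increases [phi], then its moment is a Lyapunov functional.
    The collision term is finite when the moment is, because the kernel is
    bounded, and can be cancelled from both sides. *)
Lemma breaks_le phi : nonneg_measurable phi ->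
  (forall x y, w x != 0%E -> w y != 0%E -> (fragments mu frag phi (x, y) <= (phi x)%:E)%E) ->
  (moment_of mu phi w' <= moment_of mu phi w)%E.
Proof.
move=> dp le; have [->|fin] := eqVneq (moment_of mu phi w) +oo%E; first exact: leey.
have dphi : density (fun u : T * T => (phi u.1)%:E).
  apply: density_EFin => [|u]; last exact: dp.2.
  by apply: (measurableT_comp dp.1); exact: measurable_fst.
have cfin := collisions_fst_fin dp; rewrite ltey in cfin; have {}cfin := cfin fin.
have hc : (h%:E * collisions mu K (fun u => (phi u.1)%:E) w)%E \is a fin_num.
  by rewrite fin_numM.
rewrite -(leeD2rE _ _ hc) (bw dp); apply: leeD2l; apply: lee_wpmul2l; rewrite ?lee_fin//.
by apply: le_collisions => //; exact: density_fragments.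
Qed.

Lemma breaks_eq phi : nonneg_measurable phi -> (moment_of mu phi w < +oo)%E ->
  (forall x y, w x != 0%E -> w y != 0%E -> fragments mu frag phi (x, y) = (phi x)%:E) ->
  moment_of mu phi w' = moment_of mu phi w.
Proof.
move=> dp fin eq.
have dphi : density (fun u : T * T => (phi u.1)%:E).
  apply: density_EFin => [|u]; last exact: dp.2.
  by apply: (measurableT_comp dp.1); exact: measurable_fst.
have cfin := collisions_fst_fin dp fin.
have dfr : density (fragments mu frag phi) by exact: density_fragments.
apply/eqP; rewrite eq_le; apply/andP; split.
  by apply: breaks_le => // x y wx wy; rewrite eq.
have hc : (h%:E * collisions mu K (fun u => (phi u.1)%:E) w)%E \is a fin_num.
  by rewrite fin_numM.
rewrite -(leeD2rE _ _ hc) (bw dp); apply: leeD2l; apply: lee_wpmul2l; rewrite ?lee_fin//.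
by apply: le_collisions => // x y wx wy; rewrite eq.
Qed.

End finite_number.
End euler_step.

(** * Fragmentation laws and small sets *)

Section power_functions.
Context {R : realType}.
Implicit Types a x y z : R.

Lemma powR_continuous a x : 0 < x -> {for x, continuous (fun z : R => z `^ a)}.
Proof.
move=> x0; apply: differentiable_continuous; apply/derivable1_diffP.
by apply: derivable_powR; rewrite in_itv/= x0.
Qed.

Lemma integral_powR_seg a e x : 0 < a -> 0 < e -> e < x ->
  (\int[leb]_(z in `[e, x]) (z `^ (a - 1))%:E =
   (x `^ a / a)%:E - (e `^ a / a)%:E)%E.
Proof.
move=> a0 e0 ex; have x0 := lt_trans e0 ex.
have cF y : 0 < y -> {for y, continuous (fun z : R => z `^ a / a)}.
  by move=> y0; apply: cvgM; [exact: powR_continuous|exact: cvg_cst].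
apply: (@continuous_FTC2 R (fun z => z `^ (a - 1)) (fun z => z `^ a / a)) => //.
- apply: continuous_in_subspaceT => z; rewrite inE/= in_itv/= => /andP[ez _].
  by apply: powR_continuous; exact: lt_le_trans ez.
- split.
  + move=> z; rewrite in_itv/= => /andP[ez _].
    apply: derivableM => //; apply: derivable_powR.
    by rewrite in_itv/= (lt_trans e0 ez).
  + exact/cvg_at_right_filter/cF.
  + exact/cvg_at_left_filter/cF.
- move=> z; rewrite in_itv/= => /andP[ez _]; have z0 := lt_trans e0 ez.
  rewrite derive1E deriveM//; last by apply: derivable_powR; rewrite in_itv/= z0.
  have dp := is_derive1_powR a z0; rewrite derive_val (@derive_val _ _ _ _ _ _ _ dp).
  rewrite scaler0 add0r.
  by rewrite /GRing.scale/= mulrA mulVf ?mul1r ?gt_eqF.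
Qed.

Lemma integral_powR_le a x : 0 < a -> 0 < x ->
  (\int[leb]_(z in `]0%R, x[) (z `^ (a - 1))%:E <= (x `^ a / a)%:E)%E.
Proof.
move=> a0 x0.
pose F (n : nat) : set R := `[x / n.+2%:R, x]%classic.
have nF n : 0 < x / n.+2%:R < x.
  rewrite divr_gt0 ?ltr0n//= ltr_pdivrMr ?ltr0n// ltr_pMr// ltr1n//.
have mF n : measurable (F n) by exact: measurable_itv.
have ndF : nondecreasing_seq F.
  move=> m n mn; apply/subsetPset => z; rewrite /F /= !in_itv/= => /andP[mz ->].
  rewrite andbT; apply: le_trans mz; rewrite ler_pM2l// lef_pV2 ?posrE ?ltr0n//.
  by rewrite ler_nat.
have mp (D : set R) : measurable_fun D (fun z : R => (z `^ (a - 1))%:E).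
  by apply/measurable_EFinP; apply: measurable_funTS; exact: measurable_powR.
have -> : (\int[leb]_(z in `]0%R, x[) (z `^ (a - 1))%:E =
    \int[leb]_(z in \bigcup_n (F n `&` `]0%R, x[%classic)) (z `^ (a - 1))%:E)%E.
  congr (integral _ _ _); apply/seteqP; split => z.
    rewrite /= in_itv/= => /andP[z0 zx]; exists (Num.truncn (x / z)) => //.
    split; last by rewrite /= in_itv/= z0.
    rewrite /F /= in_itv/= (ltW zx) andbT ler_pdivrMr ?ltr0n// mulrC -ler_pdivrMr//.
    apply: ltW; apply: lt_trans (truncnS_gt _) _; by rewrite ltr_nat.
  by move=> [n _ []].
apply: (@le_trans _ _ (\int[leb]_(z in \bigcup_n F n) (z `^ (a - 1))%:E)%E).
  apply: ge0_subset_integral.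
  - apply: bigcupT_measurable => n; apply: measurableI; [exact: mF|exact: measurable_itv].
  - by apply: bigcupT_measurable => n; exact: mF.
  - exact: mp.
  - by move=> z _; rewrite lee_fin powR_ge0.
  - by apply: subset_bigcup => n _ z [].
have cv : (\int[leb]_(z in F i) (z `^ (a - 1))%:E)%E @[i --> \oo] -->
    (\int[leb]_(z in \bigcup_i F i) (z `^ (a - 1))%:E)%E.
  apply: ge0_nondecreasing_set_cvg_integral; [exact: ndF|exact: mF|by move=> n; exact: mp|].
  by move=> n z _; rewrite lee_fin powR_ge0.
rewrite -(cvg_lim _ cv)//; apply: lime_le; first by apply/cvg_ex; eexists; exact: cv.
apply: nearW => n; have /andP[n0 nx] := nF n.
rewrite integral_powR_seg// -EFinB lee_fin gerBl divr_ge0// ?powR_ge0//.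
exact: ltW.
Qed.

Lemma powR_mul x r s : 0 < x -> x `^ r * x `^ s = x `^ (r + s).
Proof. by move=> x0; rewrite powRD// (gt_eqF x0) implybT. Qed.

Lemma powR_le1 a x : 0 <= a -> 0 <= x <= 1 -> x `^ a <= 1.
Proof.
move=> a0 /andP[x0 x1]; have -> : 1 = 1 `^ a :> R by rewrite powR1.
by apply: ge0_ler_powR; rewrite ?nnegrE.
Qed.

Lemma powR_ge1 a x : 0 <= a -> 1 <= x -> 1 <= x `^ a.
Proof.
move=> a0 x1; have -> : 1 = 1 `^ a :> R by rewrite powR1.
by apply: ge0_ler_powR; rewrite ?nnegrE// (le_trans _ x1).
Qed.

Lemma powR_le1D a x : 0 <= a <= 1 -> 0 < x -> x `^ a <= 1 + x.
Proof.
move=> /andP[a0 a1] x0; have [x1|x1] := lerP 1 x.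
  by apply: (le_trans (ler1_powR x1 a1)); rewrite lerDr.
apply: (@le_trans _ _ 1); last by rewrite lerDl ltW.
by apply: powR_le1; rewrite // !ltW.
Qed.

End power_functions.

Section fragmentation_law.
Context {R : realType}.
Implicit Types (x y z r : R).

Definition lebR : {sigma_finite_measure set (measurableTypeR R) -> \bar R} :=
  [the {sigma_finite_measure set (measurableTypeR R) -> \bar R} of
   @lebesgue_measure R].

(** [frag z (x, y)] is the number density of the fragments of size [z] that
    the particle of size [x] leaves when it collides with one of size [y]. *)
Record fragmentation_law (frag : R -> R * R -> R) (beta0 p B : R) : Prop := {
  frag_measurable : @measurable_fun _ _
    (measurableTypeR R * (measurableTypeR R * measurableTypeR R))%type R setT
    (fun u => frag u.1 u.2);
  frag_ge0 : forall z u, 0 <= frag z u;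
  frag_support : forall z u, ~~ (0 < z < u.1) -> frag z u = 0;
  frag_mass : forall x y, 0 < x -> 0 < y ->
    (\int[leb]_z (z%:E * (frag z (x, y))%:E) = x%:E)%E;
  frag_number : forall x y, 0 < x -> 0 < y ->
    (\int[leb]_z (frag z (x, y))%:E + \int[leb]_z (frag z (y, x))%:E <= beta0%:E)%E;
  frag_power : forall x y, 0 < x -> 0 < y ->
    (\int[leb]_z (frag z (x, y) `^ p)%:E <= (B / 2 * x `^ (1 - p))%:E)%E }.

Variables (frag : R -> R * R -> R) (beta0 p B : R).
Hypotheses (law : fragmentation_law frag beta0 p B) (p1 : 1 < p)
  (beta00 : 0 <= beta0) (B0 : 0 <= B).

(* The exponent [a] leaves room at both ends: [theta = a (p - 1)] is positive,
   and [a + theta = 1 / 2 < 1] makes [z `^ (- (a + theta))] integrable near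
   0. *)
Let a : R := (2 * p)^-1.
Let theta : R := a * (p - 1).

Let p0 : 0 < p. Proof. exact: lt_trans p1. Qed.
Let a0 : 0 < a. Proof. by rewrite invr_gt0 mulr_gt0. Qed.
Let pn0 : p != 0. Proof. by rewrite gt_eqF. Qed.
Let ap : a * p = 2^-1.
Proof. by rewrite /a invfM -mulrA mulVf// mulr1. Qed.
Let theta0 : 0 < theta. Proof. by rewrite mulr_gt0// subr_gt0. Qed.
Let theta1 : theta + a = 2^-1. Proof. by rewrite -ap /theta; ring. Qed.

(** If [g] exceeds [t `^ (- a)] then [g = g `^ (1 - p) * g `^ p] and the first
    factor is at most [t `^ theta]. *)
Let young t g : 0 < t -> 0 <= g -> g <= t `^ (- a) + t `^ theta * g `^ p.
Proof.
move=> t0 g0; have [gt|tg] := lerP g (t `^ (- a)).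
  by apply: (le_trans gt); rewrite lerDl mulr_ge0// powR_ge0.
apply: (@le_trans _ _ (t `^ theta * g `^ p)); last by rewrite lerDr powR_ge0.
have gp : 0 < g by apply: le_lt_trans tg; exact: powR_ge0.
rewrite -(mulr_powRB1 g0 p0) mulrCA ler_peMr//.
apply: (@le_trans _ _ (t `^ theta * (t `^ (- a)) `^ (p - 1))).
  rewrite -powRrM powR_mul//.
  by rewrite (_ : theta + - a * (p - 1) = 0) ?powRr0// /theta; ring.
rewrite ler_pM2l ?powR_gt0//; apply: ge0_ler_powR; rewrite ?nnegrE ?powR_ge0//.
  by rewrite subr_ge0 ltW.
exact: ltW.
Qed.

(** The previous inequality for [x * f], where [x] is the size of the parent:
    condition (iv) is invariant under this scaling. *)
Let young_scaled x t f : 0 < x -> 0 < t -> 0 <= f ->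
  f <= t `^ (- a) / x + t `^ theta * (x `^ (p - 1) * f `^ p).
Proof.
move=> x0 t0 f0; have := young t0 (mulr_ge0 (ltW x0) f0).
rewrite (powRM p (ltW x0) f0) -(mulr_powRB1 (ltW x0) p0) => H.
rewrite -(ler_pM2l x0); apply: (le_trans H); rewrite mulrDr.
rewrite (mulrC x (_ / x)) divfK ?gt_eqF//.
by rewrite (_ : x * (t `^ theta * _) = t `^ theta * (x * x `^ (p - 1) * f `^ p))//; ring.
Qed.

(** The unknown that closes the estimate on small sets. A particle of size
    below [r] may send all its fragments into a set of measure [r], a larger
    one at most a number of order [(r / x) `^ theta] of them. *)
Definition small_weight r x : R := Num.min 1 ((r * x `^ (-1)) `^ theta).

Lemma small_weight_ge0 r x : 0 <= small_weight r x.
Proof. by rewrite le_min ler01 powR_ge0. Qed.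

Lemma small_weight_le1 r x : small_weight r x <= 1.
Proof. by rewrite ge_min lexx. Qed.

Lemma measurable_small_weight r : measurable_fun setT (small_weight r).
Proof.
apply: measurable_minr => //.
apply: (measurableT_comp (measurable_powR theta)).
by apply: measurable_funM => //; exact: measurable_powR.
Qed.

Let weightE r x : 0 < x -> small_weight r x = Num.min 1 ((r / x) `^ theta).
Proof. by move=> x0; rewrite /small_weight powR_inv1// ltW. Qed.

Let mfrag u : @measurable_fun _ _ (measurableTypeR R) R setT (frag ^~ u).
Proof.
exact: (measurableT_comp (frag_measurable law)
  (@pair2_measurable _ _ (measurableTypeR R) (measurableTypeR R * measurableTypeR R)%type u)).
Qed.

Let dfrag u : @density _ (measurableTypeR R) R (fun z => (frag z u)%:E).
Proof. by apply: density_EFin => // z; exact: frag_ge0 law z u. Qed.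

Let dpow u : @density _ (measurableTypeR R) R (fun z => (frag z u `^ p)%:E).
Proof.
apply: density_EFin => [|z]; last exact: powR_ge0.
by apply: (measurableT_comp (measurable_powR p)); exact: mfrag.
Qed.

Let number_le x y : 0 < x -> 0 < y -> (\int[lebR]_z (frag z (x, y))%:E <= beta0%:E)%E.
Proof.
move=> x0 y0; apply: le_trans (frag_number law x0 y0).
by rewrite leeDl//; exact: (int_density_ge0 lebR (dfrag _)).
Qed.

Lemma fragments_le_number (M : R) (phi : R -> R) x y : 0 <= M ->
  @nonneg_measurable _ (measurableTypeR R) R phi -> (forall z, phi z <= M) ->
  0 < x -> 0 < y -> (fragments lebR frag phi (x, y) <= (M * beta0)%:E)%E.
Proof.
move=> M0 [mphi phi0] phiM x0 y0.
have dphi := @density_EFin _ (measurableTypeR R) R phi mphi phi0.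
have dM := @density_cst _ (measurableTypeR R) R M M0.
apply: (@le_trans _ _ (\int[lebR]_z (M%:E * (frag z (x, y))%:E))%E).
  apply: le_int_density => [||z]; [exact: densityM|exact: densityM|].
  by rewrite -!EFinM lee_fin ler_wpM2r// (frag_ge0 law).
rewrite int_densityZ// EFinM; apply: lee_wpmul2l; rewrite ?lee_fin//.
exact: number_le.
Qed.

(** Below size [r] the weight is 1 and the bound on the number of fragments
    suffices. Above, [young_scaled] with [t = r / x] splits the fragments into
    a part of density at most [t `^ (- a) / x], which puts at most
    [t `^ (1 - a) <= t `^ theta] into [E], and a part controlled by (iv). *)
Lemma fragments_small_set (E : set R) r x y : measurable E -> 0 < r ->
  (leb E <= r%:E)%E -> 0 < x -> 0 < y ->
  (fragments lebR frag \1_E (x, y) <=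
   ((beta0 + 2 + B / 2) * small_weight r x)%:E)%E.
Proof.
move=> mE r0 Er x0 y0.
have nE : @nonneg_measurable _ (measurableTypeR R) R \1_E.
  by split; [exact: measurable_indic|move=> z; rewrite indicE].
have E1 z : \1_E z <= 1 :> R by rewrite indicE; case: (_ \in _).
have [rx|xr] := lerP r x; last first.
  apply: (le_trans (fragments_le_number ler01 nE E1 x0 y0)).
  rewrite lee_fin mul1r weightE// min_l ?mulr1; last first.
    by apply: powR_ge1; rewrite ?ltW// ltr_pdivlMr// mul1r.
  by rewrite -addrA lerDl addr_ge0// divr_ge0.
pose t := r / x; have t0 : 0 < t by rewrite divr_gt0.
have t1 : t <= 1 by rewrite ler_pdivrMr// mul1r.
have tth : t `^ theta <= 1 by apply: powR_le1; [exact: ltW|rewrite t1 ltW].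
rewrite weightE// min_r//.
have c1 : 0 <= t `^ (- a) / x by rewrite divr_ge0 ?powR_ge0// ltW.
have c2 : 0 <= t `^ theta * x `^ (p - 1) by rewrite mulr_ge0// powR_ge0.
have dE : @density _ (measurableTypeR R) R (fun z => (\1_E z)%:E).
  by case: nE => *; exact: density_EFin.
have d1 := densityM (@density_cst _ (measurableTypeR R) R _ c1) dE.
have d2 := densityM (@density_cst _ (measurableTypeR R) R _ c2) (dpow (x, y)).
apply: (@le_trans _ _ (\int[lebR]_z ((t `^ (- a) / x)%:E * (\1_E z)%:E +
    (t `^ theta * x `^ (p - 1))%:E * (frag z (x, y) `^ p)%:E))%E).
  apply: le_int_density => [||z]; [exact: densityM|exact: densityD|].
  rewrite -!EFinM -EFinD lee_fin indicE; have f0 := frag_ge0 law z (x, y).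
  case: (_ \in _); rewrite /= ?mul1r ?mulr1 ?mul0r ?mulr0 ?add0r.
    by rewrite -mulrA; exact: young_scaled.
  by rewrite mulr_ge0// powR_ge0.
rewrite int_densityD// int_densityZ// int_densityZ//.
have -> : (\int[lebR]_z (\1_E z)%:E = leb E)%E by rewrite integral_indic// setIT.
apply: (@le_trans _ _ ((t `^ (- a) / x * r)%:E +
   (t `^ theta * x `^ (p - 1) * (B / 2 * x `^ (1 - p)))%:E)%E).
  apply: leeD; rewrite [leRHS]EFinM; apply: lee_wpmul2l; rewrite ?lee_fin//.
  exact: frag_power law x y x0 y0.
rewrite -EFinD lee_fin.
have -> : t `^ theta * x `^ (p - 1) * (B / 2 * x `^ (1 - p)) = B / 2 * t `^ theta.
  have xx : x `^ (p - 1) * x `^ (1 - p) = 1.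
    by rewrite powR_mul// addrA subrK subrr powRr0.
  by transitivity (B / 2 * t `^ theta * (x `^ (p - 1) * x `^ (1 - p))); [ring|rewrite xx mulr1].
have -> : t `^ (- a) / x * r = t `^ (1 - a).
  by rewrite (addrC 1) -powR_mul// powRr1 ?ltW// /t; ring.
have : t `^ (1 - a) <= t `^ theta.
  apply: ger_powR; first by rewrite t0.
  by have := theta1; lra.
rewrite -/t; have s0 := powR_ge0 t theta; have := mulr_ge0 beta00 s0; lra.
Qed.

(** The weight is homogeneous in [r / x] before truncation, and truncation is
    harmless because [(z / x) `^ (- theta) >= 1]. *)
Let weight_shift r x z : 0 < r -> 0 < z -> z < x ->
  small_weight r z <= small_weight r x * (z / x) `^ (- theta).
Proof.
move=> r0 z0 zx; have x0 := lt_trans z0 zx.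
pose t := z / x; have t0 : 0 < t by rewrite divr_gt0.
have t1 : 1 <= t `^ (- theta).
  rewrite powRN invf_ge1 ?powR_gt0//; apply: powR_le1; first exact: ltW.
  by rewrite (ltW t0)/= ler_pdivrMr// mul1r ltW.
have rz : (r / z) `^ theta = (r / x) `^ theta * t `^ (- theta).
  have -> : r / z = (r / x) * t^-1 by rewrite /t invf_div mulrA divfK// gt_eqF.
  rewrite powRM ?divr_ge0 ?invr_ge0 ?(ltW t0) ?(ltW r0) ?(ltW x0)//; congr (_ * _).
  by rewrite -powR_inv1 ?(ltW t0)// -powRrM mulN1r.
rewrite !weightE// rz ge_min; case: (lerP 1 ((r / x) `^ theta)) => _.
  by rewrite mul1r t1.
by rewrite lexx orbT.
Qed.

Let weight_pointwise r x z f : 0 < r -> 0 < z -> z < x -> 0 <= f ->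
  small_weight r z * f <= small_weight r x *
    (x `^ (a + theta) / x * z `^ (- (a + theta)) + x `^ (p - 1) * f `^ p).
Proof.
move=> r0 z0 zx f0; have := weight_shift r0 z0 zx; have := small_weight_ge0 r x.
move: (small_weight r z) (small_weight r x) => qz qx qx0 qzx.
have x0 := lt_trans z0 zx; pose t := z / x; have t0 : 0 < t by rewrite divr_gt0.
apply: (@le_trans _ _ (qx * (t `^ (- theta) * f))).
  by rewrite mulrA; apply: ler_wpM2r.
apply: ler_wpM2l => //.
have ty := young_scaled x0 t0 f0.
have tt : t `^ (- theta) * t `^ theta = 1 by rewrite powR_mul// addNr powRr0.
have tta : t `^ (- theta) * t `^ (- a) = x `^ (a + theta) * z `^ (- (a + theta)).
  rewrite powR_mul// -opprD (addrC theta) /t powRM ?invr_ge0 ?ltW//.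
  by rewrite mulrC -powR_inv1 ?ltW// -powRrM mulN1r opprK.
have := ler_wpM2l (powR_ge0 t (- theta)) ty; rewrite mulrDr => /le_trans; apply.
by rewrite !mulrA tta tt mul1r; rewrite (mulrAC _ _ x^-1).
Qed.

(** The weight of a small fragment exceeds that of its parent by the factor
    [(z / x) `^ (- theta)]. With [young_scaled] at [t = z / x] this factor is
    absorbed: what is left is [(z / x) `^ (- (a + theta))], integrable near 0,
    and the [p]-th power of the fragment density. *)
Lemma fragments_small_weight r x y : 0 < r -> 0 < x -> 0 < y ->
  (fragments lebR frag (small_weight r) (x, y) <=
   ((beta0 + 2 + B / 2) * small_weight r x)%:E)%E.
Proof.
move=> r0 x0 y0.
have wp := fun z f => @weight_pointwise r x z f r0.
have dq : @density _ (measurableTypeR R) R (fun z => (small_weight r z)%:E).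
  by apply: density_EFin => [|z]; [exact: measurable_small_weight|exact: small_weight_ge0].
move: (small_weight_ge0 r x) wp dq; rewrite /fragments.
move: (small_weight r) => q q0 wp dq.
have x120 : 0 <= x `^ (a + theta) / x by rewrite divr_ge0 ?powR_ge0 ?ltW.
have [s sE] : exists s : R -> R, forall z, s z =
    (z `^ (2^-1 - 1) : R) * \1_(`]0, x[%classic) z by eexists => z; reflexivity.
have s0 z : 0 <= s z by rewrite sE mulr_ge0 ?powR_ge0// indicE.
have ds : @density _ (measurableTypeR R) R (fun z => (s z)%:E).
  apply: density_EFin => [|//]; rewrite (_ : s = fun z =>
    (z `^ (2^-1 - 1) : R) * \1_(`]0, x[%classic) z); last exact/funext.
  by apply: measurable_funM; [exact: measurable_powR|exact: measurable_indic].
have d1 := densityM (@density_cst _ (measurableTypeR R) R _ x120) ds.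
have d2 := densityM (@density_cst _ (measurableTypeR R) R _ (powR_ge0 x (p - 1))) (dpow (x, y)).
have d3 := densityM (@density_cst _ (measurableTypeR R) R _ q0) (densityD d1 d2).
apply: (@le_trans _ _ (\int[lebR]_z ((q x)%:E *
   ((x `^ (a + theta) / x)%:E * (s z)%:E + (x `^ (p - 1))%:E * (frag z (x, y) `^ p)%:E)))%E).
  apply: le_int_density => [||z]; [exact: (densityM dq (dfrag (x, y)))|exact: d3|].
  have f0 := frag_ge0 law z (x, y).
  change ((q z * frag z (x, y))%:E <= (q x * (x `^ (a + theta) / x * s z +
      x `^ (p - 1) * frag z (x, y) `^ p))%:E)%E.
  rewrite lee_fin.
  have [/andP[z0 zx]|zN] := boolP (0 < z < x); last first.
    have -> : frag z (x, y) = 0 by exact: (frag_support law).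
    rewrite mulr0; apply: mulr_ge0; first exact: q0.
    apply: addr_ge0; apply: mulr_ge0; rewrite ?powR_ge0//.
  have -> : s z = z `^ (- (a + theta)).
    rewrite sE indicE mem_set ?mulr1; last by rewrite /= in_itv/= z0.
    by congr (_ `^ _); rewrite (addrC a) theta1; lra.
  exact: wp.
rewrite int_densityZ//; last exact: densityD.
rewrite int_densityD// int_densityZ// int_densityZ//; last exact: powR_ge0.
rewrite (mulrC _ (q x)) [leRHS]EFinM; apply: lee_wpmul2l; first by rewrite lee_fin.
have sint : (\int[lebR]_z (s z)%:E <= (x `^ 2^-1 / 2^-1)%:E)%E.
  apply: le_trans (integral_powR_le _ x0); last by [].
  rewrite [leRHS]integral_mkcond; apply: le_int_density => //.
    split; last by move=> z; rewrite patchE; case: ifP => // _; rewrite lee_fin powR_ge0.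
    apply/(measurable_restrictT _ _).1 => //; apply/measurable_EFinP.
    by apply: measurable_funTS; exact: measurable_powR.
  by move=> z; rewrite sE indicE patchE; case: ifP => _; rewrite ?mulr1 ?mulr0.
apply: (@le_trans _ _ ((x `^ (a + theta) / x)%:E * (x `^ 2^-1 / 2^-1)%:E +
   (x `^ (p - 1))%:E * (B / 2 * x `^ (1 - p))%:E)%E).
  apply: leeD; apply: lee_wpmul2l; rewrite ?lee_fin ?powR_ge0//.
  exact: frag_power law x y x0 y0.
rewrite -!EFinM -EFinD lee_fin.
have -> : x `^ (p - 1) * (B / 2 * x `^ (1 - p)) = B / 2.
  rewrite mulrCA powR_mul// addrA subrK subrr powRr0 mulr1//.
have -> : x `^ (a + theta) / x * (x `^ 2^-1 / 2^-1) = 2.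
  rewrite (addrC a) theta1 invrK (_ : _ / x * (_ * 2) = x `^ 2^-1 * x `^ 2^-1 / x * 2); last by ring.
  rewrite powR_mul// (_ : 2^-1 + 2^-1 = 1 :> R); last by lra.
  by rewrite powRr1 ?ltW// divff ?mul1r// gt_eqF.
by move: beta00; lra.
Qed.

Lemma fragments_mass (phi : R -> R) x y : (forall z, 0 < z -> phi z = z) ->
  0 < x -> 0 < y -> fragments lebR frag phi (x, y) = (phi x)%:E.
Proof.
move=> phiE x0 y0; rewrite phiE// -(frag_mass law x0 y0).
apply: eq_integral => z _; have [z0|z0] := ltrP 0 z; first by rewrite phiE.
have -> : frag z (x, y) = 0 by apply: (frag_support law); rewrite ltNge z0.
by rewrite !mule0.
Qed.

(** Fragments are smaller than their parent and have the same total mass, so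
    [phi z <= (phi x / x) * z] can be summed over them. *)
Lemma fragments_le (phi : R -> R) x y :
  @nonneg_measurable _ (measurableTypeR R) R phi ->
  (forall z, 0 < z -> z < x -> phi z * x <= z * phi x) -> 0 < x -> 0 < y ->
  (fragments lebR frag phi (x, y) <= (phi x)%:E)%E.
Proof.
move=> [mphi phi0] phiE x0 y0.
have mx0 : @measurable_fun _ _ (measurableTypeR R) R setT (fun z : R => Num.max z 0).
  by apply: measurable_maxr.
have dmax : @density _ (measurableTypeR R) R (fun z => (Num.max z 0)%:E).
  by apply: density_EFin => // z; rewrite le_max lexx orbT.
have mass : (\int[lebR]_z ((Num.max z 0)%:E * (frag z (x, y))%:E) = x%:E)%E.
  have := @fragments_mass (fun z => Num.max z 0) x y _ x0 y0.
  rewrite /fragments max_l ?(ltW x0)//; apply => z z0.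
  by rewrite max_l// ltW.
have c0 : 0 <= phi x / x by rewrite divr_ge0// ltW.
have -> : (phi x)%:E = ((phi x / x)%:E * x%:E)%E by rewrite -EFinM divfK// gt_eqF.
rewrite -[in leRHS]mass -int_densityZ//; last exact: densityM.
have dphi := @density_EFin _ (measurableTypeR R) R phi mphi phi0.
have dc := @density_cst _ (measurableTypeR R) R _ c0.
apply: le_int_density => [||z]; [exact: densityM|exact: (densityM dc (densityM dmax (dfrag _)))|].
rewrite -!EFinM lee_fin; have [/andP[z0 zx]|zN] := boolP (0 < z < x); last first.
  have -> : frag z (x, y) = 0 by exact: (frag_support law).
  by rewrite !mulr0.
rewrite max_l ?(ltW z0)// mulrA; apply: ler_wpM2r; first exact: (frag_ge0 law).
by rewrite mulrAC ler_pdivlMr// (mulrC _ z); exact: phiE.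
Qed.

End fragmentation_law.

(** * Estimates for one step *)

Section one_step.
Context {R : realType}.
Notation mR := (measurableTypeR R).
Implicit Types (w : R -> \bar R) (phi : R -> R).

Notation mom := (moment_of (@lebR R)).
Notation nonneg := (@nonneg_measurable _ mR R).

(** The size [x], made non-negative on the whole line so that its moment is an
    integral of non-negative functions; densities vanish off the half line. *)
Definition posp (x : R) : R := Num.max x 0.

(** The weight in which everything is bounded: the kernel is at most
    [2 * weight x * weight y], and the moment of [weight] is number plus
    mass. *)
Definition weight (x : R) : R := 1 + posp x.

Lemma posp_ge0 x : 0 <= posp x. Proof. by rewrite le_max lexx orbT. Qed.
Lemma pospE x : 0 < x -> posp x = x. Proof. by move=> x0; rewrite /posp max_l// ltW. Qed.
Lemma weight_ge1 x : 1 <= weight x. Proof. by rewrite lerDl posp_ge0. Qed.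
Lemma weight_ge0 x : 0 <= weight x. Proof. exact: le_trans (weight_ge1 x). Qed.

Lemma nonneg_posp : nonneg posp.
Proof. by split; [exact: measurable_maxr|exact: posp_ge0]. Qed.

Lemma nonneg_weight : nonneg weight.
Proof.
split; last exact: weight_ge0.
by apply: measurable_funD => //; exact: nonneg_posp.1.
Qed.

Lemma nonneg_cst (c : R) : 0 <= c -> nonneg (fun=> c). Proof. by []. Qed.

Lemma nonneg_indic (E : set R) : measurable E -> nonneg \1_E.
Proof. by move=> mE; split; [exact: measurable_indic|move=> x; rewrite indicE]. Qed.

Lemma nonneg_funM phi psi : nonneg phi -> nonneg psi -> nonneg (fun x => phi x * psi x).
Proof.
move=> [mf f0] [mg g0]; split; first exact: measurable_funM.
by move=> x; exact: mulr_ge0.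
Qed.

Lemma nonneg_funD phi psi : nonneg phi -> nonneg psi -> nonneg (fun x => phi x + psi x).
Proof.
move=> [mf f0] [mg g0]; split; first exact: measurable_funD.
by move=> x; exact: addr_ge0.
Qed.

Lemma nonneg_powR (a : R) : nonneg (fun x => x `^ a).
Proof. by split; [exact: measurable_powR|move=> x; exact: powR_ge0]. Qed.

Lemma nonneg_small_weight (p r : R) : nonneg (small_weight p r).
Proof. by split; [exact: measurable_small_weight|exact: small_weight_ge0]. Qed.

Lemma nonneg_density phi : nonneg phi -> @density _ mR R (fun x => (phi x)%:E).
Proof. by move=> [mf f0]; exact: density_EFin. Qed.

Lemma density_cste (c : \bar R) : (0 <= c)%E -> @density _ mR R (fun=> c).
Proof. by move=> c0; split => // x; exact: measurable_cst. Qed.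

Lemma density_mom phi w : nonneg phi -> @density _ mR R w ->
  @density _ mR R (fun x => (phi x)%:E * w x)%E.
Proof. by move=> np dw; apply: densityM => //; exact: nonneg_density. Qed.

Lemma mom_ge0 phi w : nonneg phi -> @density _ mR R w -> (0 <= mom phi w)%E.
Proof. by move=> np dw; exact: moment_of_ge0. Qed.

(** The test function of the small-set estimate: the set itself and the weight
    that feeds it. *)
Definition set_weight (p : R) (E : set R) (r x : R) : R :=
  \1_E x + small_weight p r x.

Section mom_theory.
Variable w : R -> \bar R.
Hypotheses (dw : @density _ mR R w) (w0 : forall x, ~ 0 < x -> w x = 0%E).

Lemma le_mom phi psi : nonneg phi -> nonneg psi ->
  (forall x, 0 < x -> phi x <= psi x) -> (mom phi w <= mom psi w)%E.
Proof.
move=> np nq le; apply: le_int_density => [||x]; try exact: density_mom.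
have [x0|/w0->] := pselect (0 < x); last by rewrite !mule0.
by apply: lee_wpmul2r; [exact: dw.2|rewrite lee_fin le].
Qed.

Lemma eq_mom phi psi : (forall x, 0 < x -> phi x = psi x) -> mom phi w = mom psi w.
Proof.
move=> eq; apply: eq_integral => x _.
by have [x0|/w0->] := pselect (0 < x); rewrite ?mule0// eq.
Qed.

Lemma momD phi psi : nonneg phi -> nonneg psi ->
  mom (fun x => phi x + psi x) w = (mom phi w + mom psi w)%E.
Proof.
move=> np nq; rewrite /moment_of -int_densityD; try exact: density_mom.
apply: eq_integral => x _; rewrite EFinD ge0_muleDl// lee_fin; [exact: np.2|exact: nq.2].
Qed.

Lemma momZ (c : R) phi : 0 <= c -> nonneg phi ->
  mom (fun x => c * phi x) w = (c%:E * mom phi w)%E.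
Proof.
move=> c0 np; rewrite /moment_of -int_densityZ//; last exact: density_mom.
by apply: eq_integral => x _; rewrite EFinM muleA.
Qed.

Lemma mom1 : mom (fun=> 1) w = (\int[lebR]_x w x)%E.
Proof. by apply: eq_integral => x _; rewrite mul1e. Qed.

Lemma mass_mom (E : set R) : measurable E ->
  (\int[lebR]_(x in E) w x = mom \1_E w)%E.
Proof.
move=> mE; rewrite integral_mkcond; apply: eq_integral => x _.
rewrite patchE indicE; case: ifPn => _; by rewrite ?mul1e ?mul0e.
Qed.

End mom_theory.

Variables (frag : R -> R * R -> R) (beta0 p B : R) (K : R * R -> R).
Hypotheses (law : fragmentation_law frag beta0 p B) (p1 : 1 < p)
  (beta00 : 0 <= beta0) (B0 : 0 <= B)
  (mK : @measurable_fun _ _ (mR * mR)%type R setT K) (K0 : forall u, 0 <= K u)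
  (K2 : forall x y, 0 < x -> 0 < y -> K (x, y) <= 2 * (weight x * weight y))
  (Ks : forall x y, K (x, y) = K (y, x)).

Notation coll := (collisions (@lebR R) K).
Notation frags := (fragments (@lebR R) frag).

Let theta : R := (2 * p)^-1 * (p - 1).
Let C : R := beta0 + 2 + B / 2.

Let C0 : 0 <= C. Proof. by rewrite !addr_ge0// divr_ge0. Qed.

Let mfrag := frag_measurable law.
Let frag0 := frag_ge0 law.

Let p0 : 0 < p. Proof. exact: lt_trans p1. Qed.

Let theta01 : 0 < theta <= 1.
Proof.
rewrite mulr_gt0 ?invr_gt0 ?mulr_gt0 ?subr_gt0//=.
by rewrite /theta mulrC ler_pdivrMr ?mulr_gt0//; move: p1; lra.
Qed.

Lemma dens_fst phi : nonneg phi ->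
  @density _ (mR * mR)%type R (fun u => (phi u.1)%:E).
Proof. by move=> np; exact: (@density_fst _ _ mR mR R _ (nonneg_density np)). Qed.

Lemma dens_frags phi : nonneg phi -> @density _ (mR * mR)%type R (frags phi).
Proof. by move=> np; exact: (density_fragments lebR mfrag frag0 np). Qed.

Variables (w : R -> \bar R) (V : R).
Hypotheses (dw : @density _ mR R w) (w0 : forall x, ~ 0 < x -> w x = 0%E)
  (wV : (mom weight w <= V%:E)%E).

Let w_pos x : w x != 0%E -> 0 < x.
Proof.
by move=> wx; have [//|/w0 wx0] := pselect (0 < x); rewrite wx0 eqxx in wx.
Qed.

Let V0 : 0 <= V.
Proof. by rewrite -lee_fin (le_trans _ wV)// mom_ge0//; exact: nonneg_weight. Qed.

Let le_coll (Theta Theta' : R * R -> \bar R) :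
  @density _ (mR * mR)%type R Theta -> @density _ (mR * mR)%type R Theta' ->
  (forall x y, 0 < x -> 0 < y -> (Theta (x, y) <= Theta' (x, y))%E) ->
  (coll Theta w <= coll Theta' w)%E.
Proof.
move=> dT dT' le; apply: (le_collisions lebR mK K0 dT dT' dw) => x y wx wy.
by apply: le; exact: w_pos.
Qed.

(** By [K <= 2 weight weight], a particle of size [x] collides at a rate at
    most [2 * V * weight x]. *)
Lemma coll_fst_le phi : nonneg phi ->
  (coll (fun u => (phi u.1)%:E) w <=
   (2 * V)%:E * mom (fun x => (phi x * weight x)%R) w)%E.
Proof.
move=> np; rewrite (collisions_fst lebR mK K0 np dw).
have dr := density_rate lebR mK K0 dw.
have nw := nonneg_weight.
have V20 : 0 <= 2 * V by rewrite mulr_ge0.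
rewrite -momZ//; last exact: nonneg_funM.
apply: le_int_density => [||x].
- exact: (densityM (nonneg_density np) (densityM dr dw)).
- by apply: density_mom => //; apply: (nonneg_funM (nonneg_cst V20)); exact: nonneg_funM.
have [x0|/w0->] := pselect (0 < x); last by rewrite !mule0.
rewrite (_ : 2 * V * (phi x * weight x) = phi x * (2 * V * weight x)); last by ring.
rewrite EFinM -muleA; apply: lee_wpmul2l; first by rewrite lee_fin np.2.
apply: lee_wpmul2r; first exact: dw.2.
have c0 : 0 <= 2 * weight x by rewrite mulr_ge0// weight_ge0.
apply: (@le_trans _ _ ((2 * weight x)%:E * mom weight w)%E); last first.
  rewrite (_ : 2 * V * weight x = 2 * weight x * V); last by ring.
  by rewrite [leRHS]EFinM; apply: lee_wpmul2l.
rewrite -momZ//; apply: le_int_density => [||y].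
- have d2 : @density _ (mR * mR)%type R (fun u => w u.2) by exact: (@density_snd _ _ mR mR R _ dw).
  have dK : @density _ (mR * mR)%type R (fun u => (K u)%:E) by exact: density_EFin.
  have [mf f0] := densityM dK d2; split; last by move=> y; exact: f0 (x, y).
  exact: (measurableT_comp mf (@pair1_measurable _ _ mR mR x)).
- by apply: density_mom => //; exact: (nonneg_funM (nonneg_cst c0)).
have [y0|/w0->] := pselect (0 < y); last by rewrite !mule0.
by apply: lee_wpmul2r; [exact: dw.2|rewrite lee_fin -mulrA K2].
Qed.

Lemma coll_cst_le (c : R) : 0 <= c -> (coll (fun=> c%:E) w <= (c * (2 * V * V))%:E)%E.
Proof.
move=> c0; apply: (le_trans (coll_fst_le (nonneg_cst c0))).
rewrite momZ//; last exact: nonneg_weight.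
apply: (@le_trans _ _ ((2 * V)%:E * (c%:E * V%:E))%E).
  by apply: lee_wpmul2l; rewrite ?lee_fin ?mulr_ge0//; apply: lee_wpmul2l; rewrite ?lee_fin.
by rewrite -!EFinM lee_fin; lra.
Qed.

Variables (h : R) (w' : R -> \bar R).
Hypotheses (h0 : 0 <= h) (dw' : @density _ mR R w')
  (bw : breaks lebR frag K h w w').

Lemma step_lipschitz phi : nonneg phi -> (forall x, phi x <= 1) ->
  (mom phi w' <= mom phi w + (h * (beta0 * (2 * V * V)))%:E)%E /\
  (mom phi w <= mom phi w' + (h * (2 * V * V))%:E)%E.
Proof.
move=> np phi1; split.
  apply: (le_trans (breaks_growth mK K0 dw h0 bw np)); apply: leeD2l.
  rewrite [leRHS]EFinM; apply: lee_wpmul2l; rewrite ?lee_fin//.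
  apply: le_trans (coll_cst_le beta00); apply: le_coll; first exact: dens_frags.
    exact: density_cst.
  move=> x y x0 y0; have := fragments_le_number law ler01 np phi1 x0 y0.
  by rewrite mul1r.
apply: (le_trans (breaks_decay mfrag frag0 mK K0 dw h0 bw np)); apply: leeD2l.
rewrite [leRHS]EFinM; apply: lee_wpmul2l; rewrite ?lee_fin//.
have c1 := coll_cst_le ler01; rewrite mul1r in c1; apply: le_trans c1.
apply: le_coll; [exact: dens_fst|exact: density_cst|].
by move=> x y _ _; rewrite lee_fin phi1.
Qed.

Let nq r : nonneg (small_weight p r). Proof. exact: nonneg_small_weight. Qed.

(** Collisions cost a factor [weight x = 1 + x]; for the small-size weight the
    unbounded part [x] is paid for by its decay, up to [r `^ theta * V]. *)
Let small_weight_mom r : 0 < r ->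
  (mom (fun x => (small_weight p r x * weight x)%R) w <=
   mom (small_weight p r) w + (r `^ theta * V)%:E)%E.
Proof.
move=> r0; have rt0 := powR_ge0 r theta.
apply: (@le_trans _ _ (mom (small_weight p r) w + (r `^ theta)%:E * mom weight w)%E); last first.
  by apply: leeD2l; rewrite EFinM; apply: lee_wpmul2l.
have nw := nonneg_weight.
rewrite -momZ// -momD//; last exact: (nonneg_funM (nonneg_cst rt0)).
apply: le_mom => //.
- exact: nonneg_funM.
- by apply: nonneg_funD => //; exact: (nonneg_funM (nonneg_cst rt0)).
move=> x x0; have /andP[t0 t1] := theta01.
have q1 : small_weight p r x <= r `^ theta * x `^ (- theta).
  rewrite /small_weight ge_min; apply/orP; right.
  by rewrite (powRM _ (ltW r0) (powR_ge0 _ _)) -powRrM mulN1r.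
rewrite /weight (pospE x0) [leLHS]mulrDr mulr1 lerD2l.
apply: (@le_trans _ _ (r `^ theta * x `^ (- theta) * x)); first by rewrite ler_wpM2r// ltW.
rewrite -mulrA; apply: ler_wpM2l => //; rewrite -[X in _ * X](powRr1 (ltW x0)) powR_mul//.
by apply: powR_le1D => //; apply/andP; split; lra.
Qed.

(** One step of Gronwall's inequality. The fragments are measured by
    [q <= phi], collisions cost a factor [weight], and the constant [D] absorbs
    what the weighted moment of [q] has in excess of its moment. *)
Let step_weight phi (q : R -> R) D : nonneg phi -> nonneg q ->
  (forall x, 0 < x -> q x <= phi x) ->
  0 <= D -> (mom (fun x => (q x * weight x)%R) w <= mom q w + D%:E)%E ->
  (forall x y, 0 < x -> 0 < y -> (frags phi (x, y) <= (2 * C * q x)%:E)%E) ->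
  (mom phi w' + D%:E <= (1 + h * (4 * C * V))%:E * (mom phi w + D%:E))%E.
Proof.
move=> np nq0 qphi D0 qD frags_le.
have L0 : 0 <= 4 * C * V by rewrite !mulr_ge0.
have m0 := mom_ge0 np dw.
have nCq : nonneg (fun x => 2 * C * q x).
  by apply: (nonneg_funM (nonneg_cst _)) => //; rewrite mulr_ge0.
have growth := breaks_growth mK K0 dw h0 bw np.
have collq : (coll (frags phi) w <= (4 * C * V)%:E * (mom phi w + D%:E))%E.
  apply: (@le_trans _ _ (coll (fun u => (2 * C * q u.1)%R%:E) w)).
    by apply: le_coll; [exact: dens_frags|exact: (dens_fst nCq)|exact: frags_le].
  apply: (le_trans (coll_fst_le nCq)).
  have -> : mom (fun x => 2 * C * q x * weight x) w =
      ((2 * C)%:E * mom (fun x => (q x * weight x)%R) w)%E.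
    rewrite -momZ ?mulr_ge0//; last by apply: nonneg_funM => //; exact: nonneg_weight.
    by apply: eq_mom => [//|x _ /=]; rewrite mulrA.
  rewrite muleA -EFinM (_ : 2 * V * (2 * C) = 4 * C * V); last by ring.
  apply: lee_wpmul2l; first by rewrite lee_fin.
  by apply: (le_trans qD); apply: leeD2r; exact: le_mom.
rewrite EFinD ge0_muleDl ?lee_fin ?mulr_ge0// mul1e [leRHS]addeAC; apply: leeD2r.
apply: (le_trans growth); apply: leeD2l; rewrite EFinM -muleA.
by apply: lee_wpmul2l; rewrite ?lee_fin.
Qed.

(** New particles in [E] are fragments, hence dominated by the small-size
    weight of their parents, and so is the newly created small-size weight. *)
Lemma step_small_set (E : set R) r : measurable E -> 0 < r -> (leb E <= r%:E)%E ->
  (mom (set_weight p E r) w' + (r `^ theta * V)%:E <=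
   (1 + h * (4 * C * V))%:E * (mom (set_weight p E r) w + (r `^ theta * V)%:E))%E.
Proof.
move=> mE r0 Er; have nE := nonneg_indic mE.
have fs x y := @fragments_small_set _ _ _ _ _ law p1 beta00 B0 E r x y mE r0 Er.
have fw x y := @fragments_small_weight _ _ _ _ _ law p1 beta00 r x y r0.
have := small_weight_mom r0; have := nq r; rewrite /set_weight.
move: (small_weight p r) fs fw => q fs fw nq' qD.
have D0 : 0 <= r `^ theta * V by rewrite mulr_ge0// powR_ge0.
apply: (@step_weight (fun x => \1_E x + q x) q _ _ _ _ D0 qD) => //.
- exact: nonneg_funD.
- by move=> x _; rewrite lerDr indicE.
move=> x y x0 y0.
have dfr : @density _ mR R (fun z => (frag z (x, y))%:E).
  apply: density_EFin => [|z]; last exact: frag0.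
  exact: (measurableT_comp mfrag (@pair2_measurable _ _ mR (mR * mR)%type (x, y))).
have -> : frags (fun x => \1_E x + q x) (x, y) = (frags \1_E (x, y) + frags q (x, y))%E.
  rewrite /fragments -int_densityD; last 2 first.
  - by apply: densityM => //; exact: nonneg_density.
  - by apply: densityM => //; exact: nonneg_density.
  by apply: eq_integral => z _; rewrite EFinD ge0_muleDl ?lee_fin//; exact: nq'.2.
rewrite (_ : 2 * C * q x = C * q x + C * q x); last by ring.
by rewrite EFinD; apply: leeD; [exact: fs|exact: fw].
Qed.

(** By symmetry of the kernel, each unordered collision replaces two particles
    by at most [beta0]: over ordered pairs the balance is [(beta0 - 2) / 2],
    and the kernel bound gives twice [M_a * M_b]. *)
Lemma step_number (a b : R) :
  (forall x y, 0 < x -> 0 < y -> K (x, y) <= x `^ a * y `^ b + x `^ b * y `^ a) ->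
  2 <= beta0 ->
  (mom (fun=> 1%R) w' <= mom (fun=> 1%R) w + (h * (beta0 - 2))%:E *
    (mom (fun x => (x `^ a)%R) w * mom (fun x => (x `^ b)%R) w))%E.
Proof.
move=> Kab b2.
have n1 : nonneg (fun=> 1%R) by exact: nonneg_cst.
have na := nonneg_powR a; have nb := nonneg_powR b.
have d1 := dens_fst n1; have df := dens_frags n1.
have dfs : @density _ (mR * mR)%type R (fun u => frags (fun=> 1%R) (u.2, u.1)).
  split; last by move=> u; exact: df.2.
  by apply: (measurableT_comp df.1); exact: (@measurable_swap _ _ mR mR).
have J1 := coll_cst_le ler01; rewrite mul1r in J1.
have J0 : (0 <= coll (fun=> 1%R%:E) w)%E by exact: collisions_ge0.
have F0 : (0 <= coll (frags (fun=> 1%R)) w)%E by exact: collisions_ge0.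
have Jfin : coll (fun=> 1%R%:E) w \is a fin_num.
  by rewrite (ge0_fin_numE J0); exact: le_lt_trans J1 (ltry _).
have FJ : (coll (frags (fun=> 1%R)) w + coll (frags (fun=> 1%R)) w <=
    beta0%:E * coll (fun=> 1%R%:E) w)%E.
  rewrite -[X in (_ + X)%E](collisions_swap lebR mK K0 Ks df dw).
  rewrite -(collisionsD lebR mK K0 df dfs dw) -(collisionsZ lebR mK K0 beta00 d1 dw).
  apply: le_coll.
  - exact: densityD.
  - by apply: densityM => //; exact: density_cst.
  move=> x y x0 y0 /=; rewrite mule1.
  have := frag_number law x0 y0; rewrite /fragments.
  have e u : (\int[lebR]_z (1%:E * (frag z u)%:E) = \int[lebR]_z (frag z u)%:E)%E.
    by apply: eq_integral => z _; rewrite mul1e.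
  by rewrite !e.
have Ffin : coll (frags (fun=> 1%R)) w \is a fin_num.
  rewrite ge0_fin_numE//; apply: (le_lt_trans (leeDl _ F0)); apply: (le_lt_trans FJ).
  by rewrite -(fineK Jfin) -EFinM ltry.
have zero_case (u v r' Ma Mb : \bar R) :
    (1 * (r' * 0) <= u * 0 * Mb + v * 0 * Ma)%E.
  by rewrite !mule0 !mul0e adde0.
have Jab : (coll (fun=> 1%R%:E) w <= 2%:E * (mom (fun x => (x `^ a)%R) w * mom (fun x => (x `^ b)%R) w))%E.
  rewrite (collisions_fst lebR mK K0 n1 dw).
  have dr := density_rate lebR mK K0 dw.
  have ma := mom_ge0 na dw; have mb := mom_ge0 nb dw.
  have dab := densityM (density_mom na dw) (density_cste mb).
  have dba := densityM (density_mom nb dw) (density_cste ma).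
  apply: (@le_trans _ _ (\int[lebR]_x ((x `^ a)%:E * w x * mom (fun x => (x `^ b)%R) w +
      (x `^ b)%:E * w x * mom (fun x => (x `^ a)%R) w))%E).
    apply: le_int_density => [||x].
    - exact: (densityM (nonneg_density n1) (densityM dr dw)).
    - exact: (densityD dab dba).
    have [x0|/w0->] := pselect (0 < x); last first.
      exact: zero_case.
    rewrite mul1e !(muleAC _ (w x)) -ge0_muleDl; last 2 first.
    - by apply: mule_ge0; [rewrite lee_fin; exact: powR_ge0|exact: mb].
    - by apply: mule_ge0; [rewrite lee_fin; exact: powR_ge0|exact: ma].
    apply: lee_wpmul2r; first exact: dw.2.
    rewrite -!momZ ?powR_ge0// -momD//; last 2 first.
    - by apply: (nonneg_funM (nonneg_cst _)) => //; exact: powR_ge0.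
    - by apply: (nonneg_funM (nonneg_cst _)) => //; exact: powR_ge0.
    apply: le_int_density => [||y].
    - have d2 : @density _ (mR * mR)%type R (fun u => w u.2) by exact: (@density_snd _ _ mR mR R _ dw).
      have dK : @density _ (mR * mR)%type R (fun u => (K u)%:E) by exact: density_EFin.
      have [mf f0] := densityM dK d2; split; last by move=> y; exact: f0 (x, y).
      exact: (measurableT_comp mf (@pair1_measurable _ _ mR mR x)).
    - apply: density_mom => //; apply: nonneg_funD;
        by apply: (nonneg_funM (nonneg_cst _)) => //; exact: powR_ge0.
    have [y0|/w0->] := pselect (0 < y); last by rewrite !mule0.
    by apply: lee_wpmul2r; [exact: dw.2|rewrite lee_fin Kab].
  rewrite (int_densityD lebR dab dba).
  have pull (c : R) (X : \bar R) : (0 <= X)%E ->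
      (\int[lebR]_x ((x `^ c)%:E * w x * X) = mom (fun x => (x `^ c)%R) w * X)%E.
    move=> X0; under eq_integral do rewrite muleC.
    by rewrite (int_densityZe lebR X0 (density_mom (nonneg_powR c) dw)); exact: muleC.
  have fin (X Y : \bar R) : (X * Y + Y * X <= 2%:E * (X * Y))%E.
    by rewrite (muleC Y) -mule2n mule_natl.
  apply: le_trans (fin _ _); apply: leeD.
    by move: (pull a _ mb) => ->.
  by move: (pull b _ ma) => ->.
have := bw n1; rewrite /=.
have m0fin : mom (fun=> 1%R) w \is a fin_num.
  rewrite ge0_fin_numE ?mom_ge0//; apply: le_lt_trans (ltry V); apply: le_trans wV.
  by apply: le_mom => // [|x _]; [exact: nonneg_weight|exact: weight_ge1].
move=> eq; move: Jab FJ; rewrite -(fineK Jfin) -(fineK Ffin) -!EFinD -!EFinM lee_fin => Jab FJ.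
move: eq; rewrite -(fineK Jfin) -(fineK Ffin) -(fineK m0fin) -!EFinM -EFinD => eq.
have m0'fin : mom (fun=> 1%R) w' \is a fin_num.
  rewrite ge0_fin_numE ?mom_ge0//; apply: (@le_lt_trans _ _ (mom (fun=> 1%R) w' +
    (h * fine (coll (fun=> 1%R%:E) w))%:E)%E); last by rewrite eq ltry.
  by rewrite leeDl// lee_fin mulr_ge0// fine_ge0.
move: eq; rewrite -(fineK m0'fin) -EFinD => -[eq].
apply: (@le_trans _ _ (fine (mom (fun=> 1%R) w) + h * (beta0 - 2) / 2 * fine (coll (fun=> 1%R%:E) w))%:E).
  by rewrite lee_fin; move: h0 FJ eq; nra.
rewrite EFinD; apply: leeD2l.
have hb : 0 <= h * (beta0 - 2) / 2 by rewrite divr_ge0// mulr_ge0// subr_ge0.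
rewrite EFinM; apply: (le_trans (lee_wpmul2l _ Jab)); first by rewrite lee_fin.
by rewrite muleA -EFinM divfK.
Qed.

End one_step.

(** * Growth of the number of particles *)

Section real_inequalities.
Context {R : realType}.
Implicit Types a c h m r t : R.

(** The concave function [t `^ a] lies below its tangent at 1, by Young's
    inequality. *)
Lemma powR_tangent a t : 0 <= a <= 1 -> 0 < t -> t `^ a <= 1 + a * (t - 1).
Proof.
move=> /andP[]; rewrite le_eqVlt => /predU1P[<- _ t0|a0].
  by rewrite powRr0 mul0r addr0.
rewrite le_eqVlt => /predU1P[-> t0|a1 t0].
  by rewrite powRr1 ?(ltW t0)// mul1r addrC subrK.
have a1' : 0 < 1 - a by rewrite subr_gt0.
have := @conjugate_powR R (t `^ a) 1 a^-1 (1 - a)^-1 (powR_ge0 _ _) ler01.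
rewrite !invr_gt0 a0 a1' !invrK => /(_ isT isT).
rewrite addrC subrK => /(_ erefl); rewrite mulr1 powR1 mul1r -powRrM.
by rewrite mulfV ?gt_eqF// powRr1 ?(ltW t0)// => /le_trans; apply; lra.
Qed.

Lemma powR_tangent_at a r t : 0 <= a <= 1 -> 0 < r -> 0 < t ->
  t `^ a <= (1 - a) * r `^ a + a * r `^ a / r * t.
Proof.
move=> a01 r0 t0; have tr : 0 < t / r by rewrite divr_gt0.
have := powR_tangent a01 tr; have ra := powR_gt0 a r0.
rewrite -(ler_pM2l ra) -powRM ?(ltW r0) ?(ltW tr)//.
rewrite (mulrC r) divfK ?gt_eqF// => /le_trans; apply.
by rewrite le_eqVlt; apply/orP; left; apply/eqP; field; rewrite gt_eqF.
Qed.

(** The convex function [t `^ (- a)] lies above its tangent at [m]; after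
    division by [m `^ (- a)] this follows from Bernoulli's inequality for
    [(1 + s) `^ a]. *)
Lemma powR_decrement a m s : 0 < a <= 1 -> 0 < m -> 0 <= s ->
  m `^ (- a) - a * (m `^ (- a) * s) <= (m * (1 + s)) `^ (- a).
Proof.
move=> /andP[a0 a1] m0 s0; have s1 : 0 < 1 + s by rewrite ltr_wpDr.
rewrite (powRM _ (ltW m0) (ltW s1)).
have -> : m `^ (- a) - a * (m `^ (- a) * s) = m `^ (- a) * (1 - a * s) by ring.
apply: ler_wpM2l; first exact: powR_ge0.
have := @powR_tangent a (1 + s) _ s1; rewrite (ltW a0) a1 => /(_ isT).
rewrite (_ : 1 + a * (1 + s - 1) = 1 + a * s); last by ring.
move=> H; have p0 := powR_gt0 a s1; rewrite powRN.
have as0 : 0 <= a * s by rewrite mulr_ge0// ltW.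
rewrite -(ler_pM2r p0) mulVf ?gt_eqF//.
have [as1|as1] := lerP (a * s) 1; last first.
  have : (1 - a * s) * (1 + s) `^ a <= 0.
    by rewrite pmulr_lle0// subr_le0 ltW.
  by lra.
apply: (@le_trans _ _ ((1 - a * s) * (1 + a * s))).
  by apply: ler_wpM2l => //; rewrite subr_ge0.
by have := mulr_ge0 as0 as0; lra.
Qed.

Lemma gronwall_expR (u : nat -> R) (h c : R) : 0 <= h -> 0 <= c -> 0 <= u 0%N ->
  forall k, (forall j, (j < k)%N -> u j.+1 <= (1 + h * c) * u j) ->
  u k <= expR (c * (h * k%:R)) * u 0%N.
Proof.
move=> h0 c0 u0; elim=> [_|k IH H]; first by rewrite !mulr0 expR0 mul1r.
have {}IH := IH (fun j jk => H j (leqW jk)).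
apply: (le_trans (H k (leqnn _))).
have hc : 0 <= 1 + h * c by rewrite addr_ge0// mulr_ge0.
apply: (@le_trans _ _ ((1 + h * c) * (expR (c * (h * k%:R)) * u 0%N))).
  exact: ler_wpM2l.
rewrite mulrA; apply: ler_wpM2r => //.
have -> : c * (h * k.+1%:R) = h * c + c * (h * k%:R) by rewrite -natr1; ring.
rewrite expRD; apply: ler_wpM2r; [exact: expR_ge0|exact: expR_ge1Dx].
Qed.

(** For exponents [e <= 1], [m `^ e <= 1 + m] and Gronwall's inequality applies
    to [m + 1]. *)
Lemma number_growth_global (m : nat -> R) (h c e : R) :
  0 <= h -> 0 <= c -> 0 <= e <= 1 -> (forall k, 0 < m k) ->
  (forall k, m k.+1 <= m k + h * (c * m k `^ e)) ->
  forall k, m k <= expR (c * (h * k%:R)) * (m 0%N + 1).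
Proof.
move=> h0 c0 e01 m0 rec k.
have := @gronwall_expR (fun k => m k + 1) h c h0 c0 _ k.
have -> : 0 <= m 0%N + 1 by rewrite addr_ge0// ltW.
move=> /(_ isT) H; apply: le_trans (H _); first by rewrite lerDl.
move=> j _; have := rec j; have := powR_le1D e01 (m0 j).
have hc : 0 <= h * c by rewrite mulr_ge0.
move=> /(ler_wpM2l hc); rewrite mulrA; lra.
Qed.

(** Number growth for superlinear exponents [1 + mu]: the Euler scheme stays
    below the solution of the differential equation, which blows up in finite
    time; the power [- mu] of the number decreases at most linearly. *)
Lemma number_growth_local (m : nat -> R) (h c mu : R) :
  0 <= h -> 0 <= c -> 0 < mu <= 1 -> (forall k, 0 < m k) ->
  (forall k, m k.+1 <= m k + h * (c * m k `^ (1 + mu))) ->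
  forall k, m 0%N `^ (- mu) - mu * c * (h * k%:R) <= m k `^ (- mu).
Proof.
move=> h0 c0 /andP[mu0 mu1] m0 rec; elim=> [|k IH]; first by rewrite !mulr0 subr0.
pose s := h * c * m k `^ mu.
have s0 : 0 <= s by rewrite !mulr_ge0// powR_ge0.
have ms : m k.+1 <= m k * (1 + s).
  have := rec k; rewrite /s powRD ?gt_eqF ?implybT//; last by rewrite ltr_wpDr// ltW.
  by rewrite powRr1 ?(ltW (m0 k))//; lra.
have mono : (m k * (1 + s)) `^ (- mu) <= m k.+1 `^ (- mu).
  have s1 : 0 < m k * (1 + s) by rewrite mulr_gt0// ltr_wpDr.
  rewrite !powRN lef_pV2 ?posrE ?powR_gt0//.
  by apply: ge0_ler_powR; rewrite ?nnegrE ?(ltW mu0) ?(ltW (m0 _)) ?(ltW s1).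
apply: le_trans mono.
have := @powR_decrement mu (m k) s _ (m0 k) s0; rewrite mu0 mu1 => /(_ isT).
apply: le_trans.
have -> : m k `^ (- mu) * s = h * c.
  have -> : m k `^ (- mu) * s = h * c * (m k `^ (- mu) * m k `^ mu) by rewrite /s; ring.
  by rewrite powR_mul// addNr powRr0 mulr1.
by move: IH; rewrite -natr1; lra.
Qed.

End real_inequalities.

Section collision_kernel.
Context {R : realType}.
Notation mR := (measurableTypeR R).
Notation mom := (moment_of (@lebR R)).
Variables (alpha beta : R).
Hypotheses (alpha0 : 0 <= alpha) (alpha_beta : alpha <= beta) (beta1 : beta <= 1).

Definition kernel2 (u : R * R) : R := power_kernel alpha beta u.1 u.2.

Let beta_ge0 : 0 <= beta. Proof. exact: le_trans alpha_beta. Qed.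
Let alpha1 : alpha <= 1. Proof. exact: le_trans beta1. Qed.

Lemma kernel2_ge0 u : 0 <= kernel2 u.
Proof. by rewrite addr_ge0// mulr_ge0// powR_ge0. Qed.

Lemma kernel2_sym x y : kernel2 (x, y) = kernel2 (y, x).
Proof. by rewrite /kernel2 /power_kernel /=; ring. Qed.

Lemma measurable_kernel2 : @measurable_fun _ _ (mR * mR)%type R setT kernel2.
Proof.
have m1 (a : R) : @measurable_fun _ _ (mR * mR)%type R setT (fun u => u.1 `^ a).
  exact: (measurableT_comp (measurable_powR a) (@measurable_fst _ _ mR mR)).
have m2 (a : R) : @measurable_fun _ _ (mR * mR)%type R setT (fun u => u.2 `^ a).
  exact: (measurableT_comp (measurable_powR a) (@measurable_snd _ _ mR mR)).
by apply: measurable_funD; apply: measurable_funM.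
Qed.

Lemma kernel2_le x y : 0 < x -> 0 < y -> kernel2 (x, y) <= 2 * (weight x * weight y).
Proof.
move=> x0 y0; rewrite /kernel2 /power_kernel /weight !pospE//=.
have xa := @powR_le1D R alpha x _ x0; have xb := @powR_le1D R beta x _ x0.
have ya := @powR_le1D R alpha y _ y0; have yb := @powR_le1D R beta y _ y0.
rewrite alpha0 alpha1 in xa ya; rewrite beta_ge0 beta1 in xb yb.
have h1 := ler_pM (powR_ge0 x alpha) (powR_ge0 y beta) (xa isT) (yb isT).
have h2 := ler_pM (powR_ge0 x beta) (powR_ge0 y alpha) (xb isT) (ya isT).
by lra.
Qed.

(** Interpolation between number and mass, which is Hoelder's inequality:
    [x `^ a] is below its tangent at the mean size [r / m], and the tangent
    integrates to the bound exactly. *)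
Lemma mom_interpolation (w : R -> \bar R) (a m r : R) :
  @density _ mR R w -> (forall x, ~ 0 < x -> w x = 0%E) -> 0 <= a <= 1 ->
  0 < m -> 0 < r -> mom (fun=> 1) w = m%:E -> mom posp w = r%:E ->
  (mom (fun x => (x `^ a)%R) w <= (m `^ (1 - a) * r `^ a)%:E)%E.
Proof.
move=> dw w0 /andP[a0 a1] m0 r0 mm mr.
have s0 : 0 < r / m by rewrite divr_gt0.
have sa := powR_ge0 (r / m) a.
have c1 : 0 <= (1 - a) * (r / m) `^ a by rewrite mulr_ge0// subr_ge0.
have c2 : 0 <= a * (r / m) `^ a / (r / m) by rewrite divr_ge0 ?(ltW s0)// mulr_ge0.
have n1 : nonneg_measurable (fun _ : mR => (1 - a) * (r / m) `^ a * 1).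
  by apply: nonneg_cst; rewrite mulr1.
have n2 := nonneg_funM (nonneg_cst c2) (@nonneg_posp R).
apply: (@le_trans _ _ (mom (fun x => (1 - a) * (r / m) `^ a * 1 +
   a * (r / m) `^ a / (r / m) * posp x)%R w)).
  apply: le_mom => //; [exact: nonneg_powR|exact: nonneg_funD|].
  move=> x x0; rewrite mulr1 pospE//; apply: powR_tangent_at => //.
  by rewrite a0.
rewrite (momD dw n1 n2) (momZ dw c1 (nonneg_cst ler01)) (momZ dw c2 (@nonneg_posp R)).
rewrite mm mr -!EFinM -EFinD lee_fin.
have -> : (1 - a) * (r / m) `^ a * m + a * (r / m) `^ a / (r / m) * r = (r / m) `^ a * m.
  by field; rewrite !gt_eqF.
rewrite powRM ?(ltW r0) ?invr_ge0 ?(ltW m0)// -powR_inv1 ?(ltW m0)// -powRrM mulN1r.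
rewrite -mulrA -[X in _ * X <= _](_ : m `^ (1 - a) = _); last first.
  by rewrite addrC -powR_mul// powRr1// ltW.
by rewrite mulrC.
Qed.

End collision_kernel.

Section euler_sequence.
Context {R : realType}.
Notation mR := (measurableTypeR R).
Notation mom := (moment_of (@lebR R)).
Variables (frag : R -> R * R -> R) (beta0 p B alpha beta : R).
Hypotheses (law : fragmentation_law frag beta0 p B) (p1 : 1 < p)
  (beta02 : 2 <= beta0) (B0 : 0 <= B)
  (alpha0 : 0 <= alpha) (alpha_beta : alpha <= beta) (beta1 : beta <= 1).
Variables (f0 : R -> \bar R) (rho : R).
Hypothesis rho0 : 0 < rho.

Let beta00 : 0 <= beta0. Proof. exact: le_trans beta02. Qed.

Definition truncated_kernel (n : nat) (u : R * R) : R :=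
  Num.min (kernel2 alpha beta u) n.+1%:R.

(** With kernel bound [n + 1], a step is made as long as the number of
    particles is at most [n + 1]; number bounds uniform in [n] therefore
    exclude skipped steps for large [n]. *)
Definition time_step (n : nat) : R := (n.+1%:R ^+ 2)^-1.

Definition euler_seq (n k : nat) : R -> \bar R :=
  iter k (euler lebR frag (truncated_kernel n) n.+1%:R (time_step n)) f0.

Lemma truncated_kernel_ge0 n u : 0 <= truncated_kernel n u.
Proof. by rewrite le_min kernel2_ge0 ler0n. Qed.

Lemma truncated_kernel_le n u : truncated_kernel n u <= n.+1%:R.
Proof. by rewrite ge_min lexx orbT. Qed.

Lemma truncated_kernel_le_kernel n u : truncated_kernel n u <= kernel2 alpha beta u.
Proof. by rewrite ge_min lexx. Qed.

Lemma truncated_kernel_sym n x y : truncated_kernel n (x, y) = truncated_kernel n (y, x).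
Proof. by rewrite /truncated_kernel kernel2_sym. Qed.

Lemma measurable_truncated_kernel n :
  @measurable_fun _ _ (mR * mR)%type R setT (truncated_kernel n).
Proof. by apply: measurable_minr => //; exact: measurable_kernel2. Qed.

Lemma truncated_kernel_weight n x y : 0 < x -> 0 < y ->
  truncated_kernel n (x, y) <= 2 * (weight x * weight y).
Proof.
move=> x0 y0; apply: le_trans (truncated_kernel_le_kernel _ _) _.
exact: kernel2_le.
Qed.

Lemma time_step_gt0 n : 0 < time_step n.
Proof. by rewrite invr_gt0 exprn_gt0. Qed.

(** What the scheme preserves: the mass is a constant [rho], while the number
    of particles is only known to stay finite. *)
Record admissible (w : R -> \bar R) : Prop := {
  adm_density : @density _ mR R w;
  adm_support : forall x, ~ 0 < x -> w x = 0%E;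
  adm_number : (mom (fun=> 1%R) w < +oo)%E;
  adm_mass : mom posp w = rho%:E }.

Section step.
Variables (n : nat) (w : R -> \bar R).
Hypothesis aw : admissible w.

Let K := truncated_kernel n.
Let w' := euler lebR frag K n.+1%:R (time_step n) w.
Let dw := adm_density aw.
Let w0 := adm_support aw.
Let mK := measurable_truncated_kernel n.
Let K0 := truncated_kernel_ge0 n.
Let KN := truncated_kernel_le n.
Let N0 : 0 <= n.+1%:R :> R. Proof. by []. Qed.
Let h0 := ltW (time_step_gt0 n).

Lemma adm_int : (\int[lebR]_x w x = mom (fun=> 1%R) w)%E.
Proof. by apply: eq_integral => x _; rewrite mul1e. Qed.

Let wfin : (\int[lebR]_x w x < +oo)%E.
Proof. by rewrite adm_int; exact: adm_number aw. Qed.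

Lemma adm_weight : (mom weight w <= (fine (mom (fun=> 1%R) w) + rho)%:E)%E.
Proof.
rewrite (momD dw (nonneg_cst ler01) (@nonneg_posp R)) (adm_mass aw) EFinD.
rewrite fineK// ge0_fin_numE; first exact: adm_number aw.
exact: (mom_ge0 (nonneg_cst ler01) dw).
Qed.

Lemma density_step : @density _ mR R w'.
Proof.
exact: (density_euler (frag_measurable law) (frag_ge0 law) mK K0 KN N0 dw wfin h0).
Qed.

Lemma step_breaks : exists h', [/\ 0 <= h' <= time_step n,
  (time_step n * (n.+1%:R * fine (mom (fun=> 1%R) w)) <= 1 -> h' = time_step n) &
  breaks lebR frag K h' w w'].
Proof.
have := euler_breaks (frag_measurable law) (frag_ge0 law) mK K0 KN N0 dw wfin h0.
by rewrite adm_int.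
Qed.

Lemma step_le_mom phi : @nonneg_measurable _ mR R phi ->
  (forall z x, 0 < z -> z < x -> phi z * x <= z * phi x) ->
  (mom phi w' <= mom phi w)%E.
Proof.
move=> np phiE; have [h' [/andP[h'0 _] _ bw]] := step_breaks.
apply: (breaks_le (frag_measurable law) (frag_ge0 law) mK K0 KN N0 dw wfin h'0 bw np).
move=> x y wx wy; apply: (fragments_le law np) => //; first by move=> *; exact: phiE.
- by have [//|/w0 wx0] := pselect (0 < x); rewrite wx0 eqxx in wx.
- by have [//|/w0 wy0] := pselect (0 < y); rewrite wy0 eqxx in wy.
Qed.

Lemma step_admissible : admissible w'.
Proof.
have [h' [/andP[h'0 _] _ bw]] := step_breaks.
split.
- exact: density_step.
- have fD z u : ~ [set z : R | 0 < z] z -> frag z u = 0.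
    by move=> z0; apply: (frag_support law); apply/negP => /andP[].
  by move=> x x0; have := euler_support lebR K n.+1%:R (time_step n) fD w0 x0.
- have V := adm_weight; have V0 : 0 <= fine (mom (fun=> 1%R) w) + rho.
    by rewrite addr_ge0 ?(ltW rho0)// fine_ge0// mom_ge0.
  have [H _] := step_lipschitz law beta00 mK K0 (@truncated_kernel_weight n) dw w0 V h'0 bw (nonneg_cst ler01) (fun=> lexx _).
  apply: (le_lt_trans H); rewrite -(@fineK _ (mom (fun=> 1%R) w)) -?EFinD ?ltry//.
  rewrite ge0_fin_numE; first exact: adm_number aw.
  exact: (mom_ge0 (nonneg_cst ler01) dw).
- rewrite -(adm_mass aw).
  apply: (breaks_eq (frag_measurable law) (frag_ge0 law) mK K0 KN N0 dw wfin h'0 bw).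
  + exact: nonneg_posp.
  + by rewrite (adm_mass aw) ltry.
  move=> x y wx wy; apply: (fragments_mass law); first exact: pospE.
  + by have [//|/w0 wx0] := pselect (0 < x); rewrite wx0 eqxx in wx.
  + by have [//|/w0 wy0] := pselect (0 < y); rewrite wy0 eqxx in wy.
Qed.

(** A density with positive mass cannot vanish almost everywhere. Positivity of
    the number is what allows negative powers of it. *)
Lemma adm_number_gt0 : 0 < fine (mom (fun=> 1%R) w).
Proof.
apply: fine_gt0; rewrite (adm_number aw) andbT lt0e; apply/andP; split; last first.
  exact: (mom_ge0 (nonneg_cst ler01) dw).
apply/eqP => m0.
have wae : ae_eq lebR setT w (cst 0%E).
  apply/(ae_eq_integral_abs lebR measurableT dw.1).
  rewrite -m0 -adm_int; apply: eq_integral => x _.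
  by rewrite gee0_abs//; exact: dw.2.
have : mom posp w = 0%E.
  have dp := density_mom (@nonneg_posp R) dw.
  have /(ae_eq_integral_abs lebR measurableT dp.1) z0 :
      ae_eq lebR setT (fun x => (posp x)%:E * w x)%E (cst 0%E).
    by apply: filterS wae => x wx _; rewrite wx// mule0.
  rewrite -[RHS]z0; apply: eq_integral => x _.
  by rewrite gee0_abs//; exact: dp.2.
by rewrite (adm_mass aw) => -[] /eqP; rewrite gt_eqF.
Qed.

Lemma step_number_real :
  fine (mom (fun=> 1%R) w') <= fine (mom (fun=> 1%R) w) + time_step n *
    ((beta0 - 2) * rho `^ (alpha + beta) *
     fine (mom (fun=> 1%R) w) `^ (2 - (alpha + beta))).
Proof.
have [h' [/andP[h'0 h'1] _ bw]] := step_breaks.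
have aw' := step_admissible.
have m0 := adm_number_gt0.
have n1 := nonneg_cst (@ler01 R).
have mfin : mom (fun=> 1%R) w \is a fin_num.
  by rewrite (ge0_fin_numE (mom_ge0 n1 dw)); exact: adm_number aw.
have m'fin : mom (fun=> 1%R) w' \is a fin_num.
  by rewrite (ge0_fin_numE (mom_ge0 n1 (adm_density aw'))); exact: adm_number aw'.
have Kab x y : 0 < x -> 0 < y -> K (x, y) <= x `^ alpha * y `^ beta + x `^ beta * y `^ alpha.
  by move=> _ _; exact: truncated_kernel_le_kernel.
have H := step_number law beta00 mK K0 (@truncated_kernel_weight n)
  (truncated_kernel_sym n) dw w0 adm_weight h'0 (adm_density aw') bw Kab beta02.
have bge0 : 0 <= beta by exact: le_trans alpha_beta.
have ale1 : alpha <= 1 by exact: le_trans beta1.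
have mE := esym (fineK mfin).
have Ma := @mom_interpolation R w alpha _ rho dw w0 _ m0 rho0 mE (adm_mass aw).
have Mb := @mom_interpolation R w beta _ rho dw w0 _ m0 rho0 mE (adm_mass aw).
rewrite alpha0 ale1 in Ma; rewrite bge0 beta1 in Mb.
have {}Ma := Ma isT; have {}Mb := Mb isT.
have na := mom_ge0 (nonneg_powR alpha) dw; have nb := mom_ge0 (nonneg_powR beta) dw.
have XY : fine (mom (fun=> 1%R) w) `^ (1 - alpha) * rho `^ alpha *
    (fine (mom (fun=> 1%R) w) `^ (1 - beta) * rho `^ beta) =
    rho `^ (alpha + beta) * fine (mom (fun=> 1%R) w) `^ (2 - (alpha + beta)).
  rewrite mulrACA mulrC !powR_mul//; congr (_ * _ `^ _); ring.
have AA := lee_pmul na nb Ma Mb; rewrite -EFinM XY in AA.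
have hb : (0 <= (h' * (beta0 - 2))%:E)%E by rewrite lee_fin mulr_ge0// subr_ge0.
have := le_trans H (leeD2l _ (lee_wpmul2l hb AA)).
rewrite {1}mE -[mom _ w'](fineK m'fin) -EFinM -EFinD lee_fin => /le_trans; apply.
rewrite lerD2l -!mulrA; apply: ler_wpM2r => //.
by rewrite mulr_ge0 ?subr_ge0// mulr_ge0 ?powR_ge0.
Qed.

End step.

Hypotheses (adm0 : admissible f0).

Lemma euler_seqS n k : euler_seq n k.+1 =
  euler lebR frag (truncated_kernel n) n.+1%:R (time_step n) (euler_seq n k).
Proof. by []. Qed.

Lemma euler_admissible n k : admissible (euler_seq n k).
Proof.
elim: k => [|k IH]; first exact: adm0.
by rewrite euler_seqS; exact: step_admissible.
Qed.

Lemma euler_le_mom n k phi : @nonneg_measurable _ mR R phi ->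
  (forall z x, 0 < z -> z < x -> phi z * x <= z * phi x) ->
  (mom phi (euler_seq n k) <= mom phi f0)%E.
Proof.
move=> np phiE; elim: k => [|k IH]; first by [].
apply: le_trans IH; rewrite euler_seqS.
apply: step_le_mom => //; exact: euler_admissible.
Qed.

Definition number (n k : nat) : R := fine (mom (fun=> 1%R) (euler_seq n k)).

Lemma number_gt0 n k : 0 < number n k.
Proof. exact: adm_number_gt0 (euler_admissible n k). Qed.

Let lambda := alpha + beta.
Let c := (beta0 - 2) * rho `^ lambda.
Let m0 := fine (mom (fun=> 1%R) f0).

Let c0 : 0 <= c. Proof. by rewrite mulr_ge0 ?subr_ge0 ?powR_ge0. Qed.

Lemma number_rec n k : number n k.+1 <= number n k +
  time_step n * (c * number n k `^ (2 - lambda)).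
Proof. exact: step_number_real (euler_admissible n k). Qed.

Lemma number_bound_global n k t : 1 <= lambda <= 2 -> time_step n * k%:R <= t ->
  number n k <= expR (c * t) * (m0 + 1).
Proof.
move=> /andP[l1 l2] kt.
have e01 : 0 <= 2 - lambda <= 1 by apply/andP; split; lra.
have := number_growth_global (ltW (time_step_gt0 n)) c0 e01 (number_gt0 n) (number_rec n) k.
move=> /le_trans; apply; apply: ler_wpM2r.
  by rewrite addr_ge0// ltW// (number_gt0 n 0).
by rewrite ler_expR; apply: ler_wpM2l.
Qed.

(** The bound [number_growth_local] inverted: it is useful as long as its
    left-hand side is positive, that is before the blow-up time. *)
Lemma number_bound_local n k t : lambda < 1 ->
  let mu := 1 - lambda in 0 < m0 `^ (- mu) - mu * c * t ->
  time_step n * k%:R <= t ->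
  number n k <= (m0 `^ (- mu) - mu * c * t) `^ (- mu^-1).
Proof.
move=> l1 mu t0 kt.
have l0 : 0 <= lambda by rewrite addr_ge0// (le_trans alpha0).
have mu0 : 0 < mu by rewrite subr_gt0.
have mu01 : 0 < mu <= 1 by rewrite mu0 gerBl.
have rec k' : number n k'.+1 <= number n k' + time_step n * (c * number n k' `^ (1 + mu)).
  by have := number_rec n k'; rewrite (_ : 2 - lambda = 1 + mu)// /mu; ring.
have := number_growth_local (ltW (time_step_gt0 n)) c0 mu01 (number_gt0 n) rec k.
rewrite -[number n 0]/m0 => H.
have mk0 := number_gt0 n k.
have {}H : m0 `^ (- mu) - mu * c * t <= number n k `^ (- mu).
  apply: le_trans H; rewrite lerD2l lerN2; apply: ler_wpM2l => //.
  by rewrite mulr_ge0// ltW.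
have nk : number n k = (number n k `^ (- mu)) `^ (- mu^-1).
  by rewrite -powRrM mulrNN mulfV ?gt_eqF// powRr1// ltW.
rewrite nk !(powRN _ mu^-1) lef_pV2 ?posrE ?powR_gt0//.
apply: ge0_ler_powR; rewrite ?nnegrE ?powR_ge0 ?(ltW t0)//.
by rewrite invr_ge0 ltW.
Qed.

End euler_sequence.

(** * Estimates along Euler paths *)

Section dominated_moments.
Context {R : realType}.
Notation mR := (measurableTypeR R).
Notation mom := (moment_of (@lebR R)).
Notation nonneg := (@nonneg_measurable _ mR R).

Lemma mom_fin (w : R -> \bar R) (phi psi : R -> R) : @density _ mR R w ->
  nonneg phi -> nonneg psi -> (forall x, phi x <= psi x) ->
  (mom psi w < +oo)%E -> mom phi w \is a fin_num.
Proof.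
move=> dw nphi npsi le fin; rewrite (ge0_fin_numE (mom_ge0 nphi dw)).
apply: le_lt_trans fin.
apply: (@le_int_density _ mR R lebR _ _ (density_mom nphi dw) (density_mom npsi dw)).
by move=> x; apply: lee_wpmul2r; [exact: dw.2|rewrite lee_fin].
Qed.

Lemma mom_dominated (w : R -> \bar R) (psi : R -> R) (phi : nat -> R -> R) (phi0 : R -> R) :
  @density _ mR R w -> nonneg psi -> (mom psi w < +oo)%E ->
  (forall j, nonneg (phi j)) -> nonneg phi0 ->
  (forall j x, phi j x <= psi x) ->
  (forall x, phi j x @[j --> \oo] --> phi0 x) ->
  fine (mom (phi j) w) @[j --> \oo] --> fine (mom phi0 w).
Proof.
move=> dw npsi fin nphi nphi0 le cv.
have dpsi := density_mom npsi dw.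
have le0 x : phi0 x <= psi x.
  rewrite -(cvg_lim (@Rhausdorff R) (cv x)).
  by apply: limr_le; [apply/cvg_ex; exists (phi0 x); exact: cv|apply: nearW => j].
have ipsi : (lebR : {measure set mR -> \bar R}).-integrable setT (fun x => (psi x)%:E * w x)%E.
  apply/integrableP; split; first exact: dpsi.1.
  apply: le_lt_trans fin; rewrite le_eqVlt; apply/orP; left; apply/eqP.
  by apply: eq_integral => x _; rewrite gee0_abs//; exact: dpsi.2.
have aefin := integrable_ae measurableT ipsi.
have dj j := density_mom (nphi j) dw.
have d0 := density_mom nphi0 dw.
have [] := @dominated_convergence _ mR R lebR setT measurableT
  (fun j x => ((phi j x)%:E * w x)%E) (fun x => ((phi0 x)%:E * w x)%E)
  (fun x => ((psi x)%:E * w x)%E) (fun j => (dj j).1) d0.1 _ ipsi _.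
- apply: filterS aefin => x /(_ Logic.I) fx _ /=.
  have [wfin|] := boolP (w x \is a fin_num).
    rewrite -(fineK wfin); under eq_fun do rewrite -EFinM.
    rewrite -EFinM; apply: cvg_EFin; first exact: nearW.
    by apply: cvgMl; exact: cv.
  have w0 := dw.2 x.
  have winf (W : \bar R) : (0 <= W)%E -> W \isn't a fin_num -> W = +oo%E by case: W.
  move=> /(winf _ w0) wx; move: fx; rewrite wx => fx.
  have p0 : psi x = 0.
    apply/eqP; apply/negP => /negP px; move: fx.
    have px0 : 0 < psi x by rewrite lt_neqAle eq_sym px npsi.2.
    by rewrite gt0_muley.
  have pj j : (phi j x)%:E = 0%E by congr EFin; apply/eqP; rewrite eq_le (nphi j).2 andbT -p0.
  have p00 : phi0 x = 0 by apply/eqP; rewrite eq_le nphi0.2 andbT -p0.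
  rewrite p00; under eq_fun do rewrite pj.
  under eq_fun do rewrite mul0e.
  by rewrite mul0e; exact: cvg_cst.
- apply: aeW => x j _ /=; rewrite gee0_abs; last exact: (dj j).2.
  by apply: lee_wpmul2r; [exact: dw.2|rewrite lee_fin].
move=> _ _ H; apply: fine_cvg.
rewrite fineK; last exact: (mom_fin dw nphi0 npsi le0 fin).
exact: H.
Qed.

Lemma mom_small (w : R -> \bar R) (psi : R -> R) (phi : nat -> R -> R) (e : R) :
  @density _ mR R w -> nonneg psi -> (mom psi w < +oo)%E ->
  (forall j, nonneg (phi j)) ->
  (forall j x, phi j x <= psi x) ->
  (forall x, phi j x @[j --> \oo] --> (0 : R)) -> 0 < e ->
  exists J, forall j, (J <= j)%N -> (mom (phi j) w <= e%:E)%E.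
Proof.
move=> dw npsi fin nphi le cv e0.
have n0 : nonneg (fun _ : R => 0 : R) by apply: nonneg_cst.
have := mom_dominated dw npsi fin nphi n0 le cv.
have -> : mom (fun=> 0) w = 0%E.
  rewrite /moment_of (eq_integral (cst 0%E)) ?integral0// => x _.
  by rewrite mul0e.
move=> /cvg_realP/(_ _ e0)[J HJ]; exists J => j /HJ; rewrite subr0.
rewrite ger0_norm; last by rewrite fine_ge0// (mom_ge0 (nphi j) dw).
by rewrite -lee_fin fineK//; exact: (mom_fin dw (nphi j) npsi (le j) fin).
Qed.

Lemma indic_decreasing_cvg (E : nat -> set R) x :
  (forall i j, (i <= j)%N -> E j `<=` E i) -> \bigcap_j E j = set0 ->
  \1_(E j) x @[j --> \oo] --> (0 : R).
Proof.
move=> dec cap; have [j Ej] : exists j, ~ E j x.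
  by apply/existsNP => H; have : (\bigcap_j E j) x by []; rewrite cap.
apply/cvg_realP => e e0; exists j => i ji.
by rewrite indicE memNset ?subrr ?normr0 ?ltW// => /(dec _ _ ji).
Qed.

Definition tail_weight (M x : R) : R := posp x * \1_`]M, +oo[ x.

Lemma nonneg_tail_weight M : nonneg (tail_weight M).
Proof. by apply: nonneg_funM; [exact: nonneg_posp|exact: nonneg_indic]. Qed.

Lemma nonneg_tail_powR m M : nonneg (fun x => x `^ m * \1_`]M, +oo[ x).
Proof. by apply: nonneg_funM; [exact: nonneg_powR|exact: nonneg_indic]. Qed.

Lemma tail_indic_cvg (x : R) : \1_`](j%:R : R), +oo[ x @[j --> \oo] --> (0 : R).
Proof.
apply: indic_decreasing_cvg => [i j ij y|].
  by rewrite /= !in_itv /= !andbT; apply: le_lt_trans; rewrite ler_nat.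
apply/seteqP; split=> // y /(_ (Num.truncn `|y|).+1 Logic.I); rewrite /= in_itv /= andbT.
by move=> /lt_le_trans /(_ (ler_norm _)); rewrite ltNge ltW// truncnS_gt.
Qed.

(** Dominated convergence for the truncations at integer heights. *)
Lemma small_tail (w : R -> \bar R) (phi : R -> R) e : @density _ mR R w -> nonneg phi ->
  (mom phi w < +oo)%E -> 0 < e ->
  exists2 M : R, 1 <= M & (mom (fun x => phi x * \1_`]M, +oo[ x)%R w <= e%:E)%E.
Proof.
move=> dw nphi fin e0.
have nj (j : nat) : nonneg (fun x => phi x * \1_`](j%:R : R), +oo[ x).
  by apply: nonneg_funM => //; exact: nonneg_indic.
have lej (j : nat) x : phi x * \1_`](j%:R : R), +oo[ x <= phi x.
  by rewrite ler_piMr ?nphi.2// indicE; case: (_ \in _).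
have cv x : phi x * \1_`](j%:R : R), +oo[ x @[j --> \oo] --> (0 : R).
  by rewrite -[X in _ --> X](mulr0 (phi x)); apply: cvgMr; exact: tail_indic_cvg.
have [J HJ] := mom_small dw nphi fin nj lej cv e0.
by exists J.+1%:R; [rewrite ler1n|exact: HJ].
Qed.

End dominated_moments.

Section small_weights.
Context {R : realType}.
Notation mR := (measurableTypeR R).
Notation mom := (moment_of (@lebR R)).

Lemma small_weight_cvg0 (p x : R) : 1 < p -> 
  small_weight p (j.+1%:R^-1 : R) x @[j --> \oo] --> (0 : R).
Proof.
move=> p1; set theta := (2 * p)^-1 * (p - 1).
have th0 : 0 < theta.
  by rewrite mulr_gt0 ?subr_gt0// invr_gt0 mulr_gt0// (lt_trans _ p1).
set y := x `^ (-1); have y0 : 0 <= y by exact: powR_ge0.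
apply/cvg_realP => e e0.
pose d : R := e `^ theta^-1; have d0 : 0 < d by exact: powR_gt0.
exists (Num.truncn (y / d)) => j jy; rewrite subr0 ger0_norm ?small_weight_ge0//.
rewrite /small_weight ge_min; apply/orP; right.
rewrite -/theta -/y.
have -> : e = d `^ theta by rewrite /d -powRrM mulVf ?gt_eqF// powRr1// ltW.
apply: ge0_ler_powR; rewrite ?nnegrE ?(ltW th0) ?(ltW d0)// ?mulr_ge0//.
rewrite mulrC ler_pdivrMr// -ler_pdivrMl// mulrC.
by rewrite (le_trans (ltW (truncnS_gt _)))// ler_nat.
Qed.

Lemma powR_small (theta c e : R) : 0 < theta -> 0 <= c -> 0 < e ->
  exists J, forall j, (J <= j)%N -> (j.+1%:R^-1 : R) `^ theta * c <= e.
Proof.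
move=> th0 c0 e0; pose d : R := (e / (c + 1)) `^ theta^-1.
have e1 : 0 < e / (c + 1) by rewrite divr_gt0// ltr_wpDl.
have d0 : 0 < d by exact: powR_gt0.
exists (Num.truncn d^-1) => j jd.
have : (j.+1%:R^-1 : R) `^ theta <= e / (c + 1).
  have -> : e / (c + 1) = d `^ theta by rewrite /d -powRrM mulVf ?gt_eqF// powRr1// ltW.
  apply: ge0_ler_powR; rewrite ?nnegrE ?(ltW th0) ?(ltW d0)// ?invr_ge0//.
  rewrite invf_ple ?posrE//.
  by rewrite (le_trans (ltW (truncnS_gt _)))// ler_nat.
move=> /(ler_wpM2r c0) /le_trans; apply.
rewrite mulrAC ler_pdivrMr ?ltr_wpDl//; apply: ler_wpM2l; [exact: ltW|lra].
Qed.

End small_weights.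

Section euler_paths.
Context {R : realType}.
Notation mR := (measurableTypeR R).
Notation mom := (moment_of (@lebR R)).
Notation nonneg := (@nonneg_measurable _ mR R).
Variables (frag : R -> R * R -> R) (beta0 p B alpha beta : R).
Hypotheses (law : fragmentation_law frag beta0 p B) (p1 : 1 < p)
  (beta02 : 2 <= beta0) (B0 : 0 <= B)
  (alpha0 : 0 <= alpha) (alpha_beta : alpha <= beta) (beta1 : beta <= 1).
Variables (f0 : R -> \bar R) (rho : R).
Hypotheses (rho0 : 0 < rho) (adm0 : admissible rho f0).

Let beta00 : 0 <= beta0. Proof. exact: le_trans beta02. Qed.

Local Notation path := (euler_seq frag alpha beta f0).
Local Notation K := (truncated_kernel alpha beta).
Local Notation hstep := (@time_step R).

Let adm n k : admissible rho (path n k).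
Proof. exact: (euler_admissible law beta02 alpha0 alpha_beta beta1 rho0 adm0). Qed.

Let dpath n k : @density _ mR R (path n k). Proof. exact: adm_density (adm n k). Qed.

Let hpos n : 0 <= hstep n. Proof. apply: ltW; exact: time_step_gt0. Qed.

Variables (t Y : R).
Hypothesis numberY : forall n k, hstep n * k%:R <= t ->
  number frag alpha beta f0 n k <= Y.

Let V := Y + rho.

Lemma path_weight n k : hstep n * k%:R <= t -> (mom weight (path n k) <= V%:E)%E.
Proof.
move=> /numberY Yk; apply: le_trans (adm_weight (adm n k)) _.
by rewrite lee_fin lerD2r.
Qed.

Let earlier n k j : hstep n * k%:R <= t -> (j <= k)%N -> hstep n * j%:R <= t.
Proof. by move=> + jk; apply: le_trans; apply: ler_wpM2l => //; rewrite ler_nat. Qed.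

Let pathfin n k phi : nonneg phi -> (forall x, phi x <= weight x) ->
  mom phi (path n k) \is a fin_num.
Proof.
move=> np le; apply: (mom_fin (dpath n k) np (@nonneg_weight R) le).
by apply: le_lt_trans (adm_weight (adm n k)) _; exact: ltry.
Qed.

Let breaks_path n k := step_breaks alpha beta law n (adm n k).

Let V0 : 0 <= t -> 0 <= V.
Proof.
move=> t0; have h0 : hstep 0 * 0%:R <= t by rewrite mulr0.
rewrite -lee_fin; apply: le_trans (path_weight h0).
exact: (mom_ge0 (@nonneg_weight R) (dpath 0 0)).
Qed.

Let mK n := measurable_truncated_kernel alpha beta n.

Definition lipschitz_const : R := (beta0 + 1) * (2 * V * V).

(** Each step changes a bounded moment by at most the step length times the
    number of collisions and of fragments. *)
Lemma path_lipschitz n k i phi : hstep n * (k + i)%:R <= t -> 0 <= t -> nonneg phi ->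
  (forall x, phi x <= 1) ->
  `|pairing lebR (path n (k + i)) phi - pairing lebR (path n k) phi| <=
    lipschitz_const * (hstep n * i%:R).
Proof.
move=> kit t0 np p1'.
have pw x : phi x <= weight x by exact: le_trans (p1' x) (weight_ge1 x).
elim: i kit => [|i IH] kit; first by rewrite addn0 subrr normr0 !mulr0.
have kit' : hstep n * (k + i)%:R <= t by apply: earlier kit _; rewrite addnS.
have {}IH := IH kit'.
have [h' [/andP[h'0 h'1] _ bw]] := breaks_path n (k + i).
have [A1 A2] := step_lipschitz law beta00 (mK n) (@truncated_kernel_ge0 R alpha beta n)
  (@truncated_kernel_weight R alpha beta alpha0 alpha_beta beta1 n)
  (dpath n (k + i)) (adm_support (adm n (k + i))) (path_weight kit') h'0 bw np p1'.
rewrite -euler_seqS -addnS in A1 A2.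
have F1 := pathfin n (k + i) np pw; have F2 := pathfin n (k + i.+1) np pw.
rewrite -(fineK F1) -(fineK F2) -!EFinD !lee_fin in A1 A2.
set a := pairing lebR (path n (k + i)) phi in IH.
set a' := pairing lebR (path n (k + i.+1)) phi.
have {}A1 : a' <= a + h' * (beta0 * (2 * V * V)) by exact: A1.
have {}A2 : a <= a' + h' * (2 * V * V) by exact: A2.
have VV : 0 <= 2 * V * V by rewrite !mulr_ge0 ?V0.
have b1 : h' * (beta0 * (2 * V * V)) <= hstep n * lipschitz_const.
  apply: ler_pM => //; first exact: mulr_ge0.
  by apply: ler_wpM2r => //; rewrite lerDl.
have b2 : h' * (2 * V * V) <= hstep n * lipschitz_const.
  by apply: ler_pM => //; apply: ler_peMl => //; rewrite lerDr.
have -> : lipschitz_const * (hstep n * i.+1%:R) =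
    lipschitz_const * (hstep n * i%:R) + hstep n * lipschitz_const.
  by rewrite -natr1; ring.
move: IH; rewrite !ler_norml => /andP[? ?]; apply/andP; split; lra.
Qed.

Let theta : R := (2 * p)^-1 * (p - 1).
Let small_const : R := 4 * (beta0 + 2 + B / 2) * V.

(** Gronwall's inequality for [set_weight]: the number of particles in a small
    set is bounded by the initial number in that set, which tends to 0 with the
    set, and by quantities that tend to 0 with [r]. *)
Lemma path_small_set n k (E : set R) r : hstep n * k%:R <= t -> 0 <= t ->
  measurable E -> 0 < r -> (leb E <= r%:E)%E ->
  (mom \1_E (path n k) <= (expR (small_const * t) *
     (fine (mom \1_E f0) + fine (mom (small_weight p r) f0) + r `^ theta * V))%:E)%E.
Proof.
move=> kt t0 mE r0 Er.
have nE := nonneg_indic mE.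
have nS := nonneg_small_weight p r.
have nT : nonneg (set_weight p E r) by exact: nonneg_funD.
have dT := nonneg_density nT.
have v0 := V0 t0.
have indic1 x : \1_E x <= 1 :> R by rewrite indicE; case: (_ \in _).
have w2 x : set_weight p E r x <= 2 * weight x.
  have := indic1 x; have := small_weight_le1 p r x; have := weight_ge1 x.
  by rewrite /set_weight; lra.
have n2w : nonneg (fun x => 2 * weight x).
  by apply: nonneg_funM; [exact: nonneg_cst|exact: nonneg_weight].
have fT m : mom (set_weight p E r) (path n m) \is a fin_num.
  apply: (mom_fin (dpath n m) nT n2w w2).
  rewrite (momZ (dpath n m) (ler0n R 2) (@nonneg_weight R)).
  apply: le_lt_trans (lee_wpmul2l _ (adm_weight (adm n m))) _.
    by rewrite lee_fin.
  by rewrite -EFinM ltry.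
have sc0 : 0 <= small_const.
  by rewrite !mulr_ge0// !addr_ge0// divr_ge0.
pose u m := fine (mom (set_weight p E r) (path n m)) + r `^ theta * V.
have u0 : 0 <= u 0%N.
  rewrite addr_ge0 ?mulr_ge0 ?powR_ge0//.
  by rewrite fine_ge0// (mom_ge0 nT (dpath n 0)).
have := @gronwall_expR R u _ _ (hpos n) sc0 u0 k.
have step j : (j < k)%N -> u j.+1 <= (1 + hstep n * small_const) * u j.
  move=> jk; have jt := earlier kt (ltnW jk).
  have [h' [/andP[h'0 h'1] _ bw]] := breaks_path n j.
  have A := step_small_set law p1 beta00 B0 (mK n)
    (@truncated_kernel_ge0 R alpha beta n)
    (@truncated_kernel_weight R alpha beta alpha0 alpha_beta beta1 n)
    (dpath n j) (adm_support (adm n j)) (path_weight jt) h'0 bw mE r0 Er.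
  rewrite -euler_seqS -(fineK (fT j)) -(fineK (fT j.+1)) -!EFinD -EFinM lee_fin in A.
  apply: (le_trans A); apply: ler_wpM2r.
    rewrite addr_ge0 ?mulr_ge0 ?powR_ge0//.
    by rewrite fine_ge0// (mom_ge0 nT (dpath n j)).
  by rewrite lerD2l; apply: ler_wpM2r.
move=> /(_ step) A.
apply: (@le_trans _ _ (u k)%:E).
  rewrite EFinD (fineK (fT k)).
  apply: (@le_trans _ _ (mom (set_weight p E r) (path n k))).
    apply: (le_mom (dpath n k) (adm_support (adm n k)) nE nT) => x _.
    by rewrite lerDl small_weight_ge0.
  by rewrite leeDl// lee_fin mulr_ge0// powR_ge0.
rewrite lee_fin; apply: (le_trans A).
have uE : u 0%N = fine (mom \1_E f0) + fine (mom (small_weight p r) f0) + r `^ theta * V.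
  congr (_ + _); rewrite /= (momD (dpath n 0) nE nS) fineD//.
    apply: (pathfin n 0 nE) => x; exact: le_trans (indic1 x) (weight_ge1 x).
  apply: (pathfin n 0 nS) => x; exact: le_trans (small_weight_le1 _ _ x) (weight_ge1 x).
rewrite uE in u0 *; apply: ler_wpM2r => //.
by rewrite ler_expR; apply: ler_wpM2l.
Qed.

End euler_paths.

(** * Compactness of the approximations *)

Section approximation.
Context {R : realType}.
Notation mR := (measurableTypeR R).
Notation mom := (moment_of (@lebR R)).
Notation nonneg := (@nonneg_measurable _ mR R).
Variables (frag : R -> R * R -> R) (beta0 p B alpha beta : R).
Hypotheses (law : fragmentation_law frag beta0 p B) (p1 : 1 < p)
  (beta02 : 2 <= beta0) (B0 : 0 <= B)
  (alpha0 : 0 <= alpha) (alpha_beta : alpha <= beta) (beta1 : beta <= 1).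
Variables (f0 : R -> \bar R) (rho : R).
Hypotheses (rho0 : 0 < rho) (adm0 : admissible rho f0).
Variables (T : \bar R) (Y : R -> R).
Hypothesis T0 : (0 < T)%E.
Local Notation path := (euler_seq frag alpha beta f0).
Local Notation hstep := (@time_step R).
Local Notation I := (time_interval T).
Hypothesis numberY : forall t, I t -> forall n k, hstep n * k%:R <= t ->
  number frag alpha beta f0 n k <= Y t.

Definition steps (n : nat) (t : R) : nat := Num.truncn (t / hstep n).
Definition approx (n : nat) (t : R) : R -> \bar R := path n (steps n t).
(** The densities [(1 + x) f_n(t, x)]: setwise convergence of these is
    convergence in [X_0] and [X_1] at once, and the kernel is bounded relative
    to their product. *)
Definition wapprox (n : nat) (t : R) (x : R) : \bar R := ((weight x)%:E * approx n t x)%E.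

Let V t := Y t + rho.
Let I0 t : I t -> 0 <= t. Proof. by case. Qed.

Lemma steps_le n t : 0 <= t -> hstep n * (steps n t)%:R <= t.
Proof.
move=> t0; have h0 := time_step_gt0 n : 0 < hstep n.
rewrite -ler_pdivlMl// mulrC truncn_le// divr_ge0//; exact: ltW.
Qed.

Lemma steps_gt n t : t < hstep n * (steps n t).+1%:R.
Proof.
have h0 := time_step_gt0 n : 0 < hstep n.
by rewrite -ltr_pdivrMl// mulrC truncnS_gt.
Qed.

Lemma steps_mono n s t : s <= t -> (steps n s <= steps n t)%N.
Proof.
move=> st; have h0 := time_step_gt0 n : 0 < hstep n.
by apply: le_truncn; apply: ler_wpM2r => //; rewrite invr_ge0 ltW.
Qed.

Lemma time_step_le (n : nat) : hstep n <= n.+1%:R^-1.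
Proof.
rewrite lef_pV2 ?posrE ?exprn_gt0//.
by rewrite expr2 ler_peMl// ler1n.
Qed.

Lemma approx_adm n t : admissible rho (approx n t).
Proof. exact: (euler_admissible law beta02 alpha0 alpha_beta beta1 rho0 adm0). Qed.

Let da n t : @density _ mR R (approx n t). Proof. exact: adm_density (approx_adm n t). Qed.
Let sa n t x : ~ 0 < x -> approx n t x = 0%E. Proof. exact: adm_support (approx_adm n t) x. Qed.

Lemma density_wapprox n t : @density _ mR R (wapprox n t).
Proof. exact: (density_mom (@nonneg_weight R) (da n t)). Qed.

Lemma wapprox_bound n t : I t -> (\int[lebR]_x wapprox n t x <= (V t)%:E)%E.
Proof.
move=> It; have h := steps_le n (I0 It).
exact: (@path_weight _ _ _ _ _ _ _ law beta02 alpha0 alpha_beta beta1 _ _ rho0 adm0 _ _ (numberY It) n _ h).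
Qed.

Lemma bound_ge0 t : I t -> 0 <= V t.
Proof.
move=> It; rewrite -lee_fin; apply: le_trans (wapprox_bound 0 It).
exact: (int_density_ge0 lebR (density_wapprox 0 t)).
Qed.

(** The function [tail_weight M] is superlinear, so its moment decreases along
    the scheme: the initial datum fixes [M] for all times. *)
Lemma approx_tail e : 0 < e -> exists2 M : R, 1 <= M &
  forall n t, (mom (tail_weight M) (approx n t) <= e%:E)%E.
Proof.
move=> e0; have pfin : (mom posp f0 < +oo)%E by rewrite (adm_mass adm0) ltry.
have [M M1 HM] := small_tail (adm_density adm0) (@nonneg_posp R) pfin e0.
exists M => // n t; apply: le_trans HM.
apply: (euler_le_mom law beta02 alpha0 alpha_beta beta1 rho0 adm0 n _ (nonneg_tail_weight M)).
move=> z x z0 zx; rewrite /tail_weight !indicE !pospE//; last exact: lt_trans zx.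
have [zM|zM] := boolP (z \in _).
  have -> : x \in `]M, +oo[%classic.
    by move: zM; rewrite !inE /= !in_itv /= !andbT => /lt_trans; apply.
  by rewrite !mulr1.
by rewrite mulr0 mul0r mulr_ge0 ?(ltW z0)// mulr_ge0// ltW// (lt_trans z0).
Qed.

Lemma weight_tail (M x : R) : 1 <= M -> 0 < x -> M < x -> weight x <= 2 * tail_weight M x.
Proof.
move=> M1 x0 xM; rewrite /tail_weight indicE mem_set /= ?in_itv /= ?xM// mulr1.
by rewrite /weight !pospE//; lra.
Qed.

Let sb_cvg0 e : 0 < e -> exists J, forall j, (J <= j)%N ->
  (mom (small_weight p (j.+1%:R^-1)) f0 <= e%:E)%E.
Proof.
move=> e0; apply: (mom_small (adm_density adm0) (nonneg_cst ler01) (adm_number adm0)) => //.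
- by move=> j; exact: nonneg_small_weight.
- by move=> j x; exact: small_weight_le1.
- by move=> x; exact: small_weight_cvg0.
Qed.

(** Sizes above [M] contribute little by [approx_tail]. The parts of the sets
    below [M] decrease to the empty set inside a bounded interval, so their
    Lebesgue measure and their initial mass tend to 0 and [path_small_set]
    applies. *)
Lemma approx_uca t : I t -> unif_countably_additive lebR (fun n => wapprox n t).
Proof.
move=> It E mE decE capE e e0.
have e4 : 0 < e / 4 by rewrite divr_gt0.
have [M M1 HM] := approx_tail e4.
have M0 : 0 < 1 + M by lra.
pose A j := E j `&` `]0, M]%classic.
have mA j : measurable (A j) by exact: measurableI.
have decA i j : (i <= j)%N -> A j `<=` A i.
  by move=> ij x [? ?]; split=> //; exact: decE ij _ _.
have capA : \bigcap_j A j = set0.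
  by apply/seteqP; split=> // x Ax; rewrite -capE => j _; have [] := Ax j Logic.I.
pose L := expR (4 * (beta0 + 2 + B / 2) * V t * t).
have L0 : 0 < L by exact: expR_gt0.
pose e' := e / (6 * (1 + M) * L).
have e'0 : 0 < e' by rewrite divr_gt0// !mulr_gt0.
have th0 : 0 < (2 * p)^-1 * (p - 1).
  by rewrite mulr_gt0 ?subr_gt0// invr_gt0 mulr_gt0// (lt_trans _ p1).
have [J1 HJ1] := sb_cvg0 e'0.
have [J2 HJ2] := powR_small th0 (bound_ge0 It) e'0.
pose i := maxn J1 J2; pose r : R := i.+1%:R^-1.
have r0 : 0 < r by rewrite invr_gt0.
have indic1 (D : set R) x : \1_D x <= 1 :> R by rewrite indicE; case: (_ \in _).
have nA j := nonneg_indic (mA j).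
have cA x : \1_(A j) x @[j --> \oo] --> (0 : R) by exact: indic_decreasing_cvg.
have [J3 HJ3] := mom_small (adm_density adm0) (nonneg_cst ler01) (adm_number adm0)
  nA (fun j => indic1 (A j)) cA e'0.
have dI := nonneg_density (@nonneg_indic R `]0, M]%classic (measurable_itv _)).
have finI : (mom (fun=> 1%R) (fun x => (\1_`]0%R, M] x)%:E) < +oo)%E.
  rewrite mom1 integral_indic// setIT.
  have finM : (@lebesgue_measure R `]0%R, M]%classic < +oo)%E.
    by rewrite lebesgue_measure_itv /= lte_fin; case: ifP => _; rewrite -?EFinD ltry.
  exact: finM.
have [J4 HJ4] := mom_small dI (nonneg_cst ler01) finI nA (fun j => indic1 (A j)) cA r0.
pose j := maxn J3 J4; exists j => n.
have lA : (leb (A j) <= r%:E)%E.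
  apply: le_trans (HJ4 j (leq_maxr _ _)); rewrite le_eqVlt; apply/orP; left; apply/eqP.
  transitivity (\int[lebR]_x (\1_(A j) x)%:E)%E; first by rewrite integral_indic// setIT.
  apply: eq_integral => x _; rewrite -EFinM !indicE; congr EFin.
  have [/set_mem[_ xM]|_] := boolP (x \in A j); last by rewrite mul0r.
  by rewrite mem_set// mulr1.
have h := steps_le n (I0 It).
have S := @path_small_set _ _ _ _ _ _ _ law p1 beta02 B0 alpha0 alpha_beta beta1 _ _
  rho0 adm0 _ _ (numberY It) n (steps n t) (A j) r h (I0 It) (mA j) r0 lA.
have {}S : (mom \1_(A j) (approx n t) <= (L * (e' + e' + e'))%:E)%E.
  apply: (le_trans S); rewrite lee_fin; apply: ler_wpM2l; first exact: ltW.
  have F phi (w : R -> \bar R) : (mom phi w <= e'%:E)%E -> fine (mom phi w) <= e'.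
    move=> H; case: (mom phi w) H => [s| |] //= _; exact: ltW.
  apply: lerD; last exact: (HJ2 i (leq_maxr _ _)).
  apply: lerD; apply: F; first exact: HJ3 j (leq_maxl _ _).
  exact: HJ1 i (leq_maxl _ _).
rewrite (@mass_mom _ (wapprox n t) _ (mE j)).
have n1 : nonneg (fun x => (1 + M) * \1_(A j) x) by apply: nonneg_funM; [apply: nonneg_cst; exact: ltW|].
have n2 : nonneg (fun x => 2 * tail_weight M x).
  by apply: nonneg_funM; [exact: nonneg_cst|exact: nonneg_tail_weight].
have nEw : nonneg (fun x => \1_(E j) x * weight x).
  by apply: nonneg_funM; [exact: (nonneg_indic (mE j))|exact: nonneg_weight].
have -> : mom \1_(E j) (wapprox n t) = mom (fun x => \1_(E j) x * weight x)%R (approx n t).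
  by apply: eq_integral => x _; rewrite EFinM muleA.
apply: (@le_trans _ _ (mom (fun x => (1 + M) * \1_(A j) x + 2 * tail_weight M x)%R (approx n t))).
  apply: (le_mom (da n t) (@sa n t) nEw (nonneg_funD n1 n2)) => x x0.
  rewrite !indicE; have [xE|xE] := boolP (x \in E j); last first.
    rewrite mul0r addr_ge0// ?mulr_ge0 ?(ltW M0)//.
    exact: posp_ge0.
  rewrite mul1r; have [xM|xM] := lerP x M; last first.
    apply: le_trans (weight_tail M1 x0 xM) _; rewrite lerDr mulr_ge0 ?(ltW M0)//.
  rewrite mem_set; last by split; [exact: set_mem|rewrite /= in_itv /= x0].
  rewrite mulr1 -[X in X <= _]addr0; apply: lerD; first by rewrite /weight pospE// lerD2l.
  by rewrite mulr_ge0//; exact: (nonneg_tail_weight M).2.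
rewrite (momD (da n t) n1 n2) (momZ (da n t) (ltW M0) (nA j)).
rewrite (momZ (da n t) (ler0n R 2) (nonneg_tail_weight M)).
have T1 : (0 <= (1 + M)%:E)%E by rewrite lee_fin ltW.
have T2 : (0 <= 2%:E :> \bar R)%E by rewrite lee_fin.
apply: (le_trans (leeD (lee_wpmul2l T1 S) (lee_wpmul2l T2 (HM n t)))).
rewrite -!EFinM -EFinD lee_fin /e' le_eqVlt; apply/orP; left; apply/eqP.
by field; rewrite !gt_eqF.
Qed.

(** Sizes above [M] contribute little; below [M] the weight is bounded and
    [path_lipschitz] applies. The grid spacing is absorbed by taking [n]
    large. *)
Lemma approx_time t e : I t -> 0 < e -> exists2 d, 0 < d &
  exists N, forall n, (N <= n)%N -> forall s, 0 <= s <= t -> t - s <= d ->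
  forall E, measurable E ->
    `|mass lebR (wapprox n t) E - mass lebR (wapprox n s) E| <= e.
Proof.
move=> It e0; have t0 := I0 It.
have e8 : 0 < e / 8 by rewrite divr_gt0.
have [M M1 HM] := approx_tail e8.
have M0 : 0 < 1 + M by lra.
pose L := lipschitz_const beta0 rho (Y t).
have L0 : 0 <= L.
  have v0 := bound_ge0 It.
  by rewrite /L /lipschitz_const !mulr_ge0// addr_ge0// (le_trans _ beta02).
pose d := e / (4 * (1 + M) * (L + 1)).
have d0 : 0 < d by rewrite divr_gt0// !mulr_gt0// ltr_wpDl.
exists d => //; exists (Num.truncn d^-1) => n nd s /andP[s0 st] tsd E mE.
have hd : hstep n <= d.
  apply: le_trans (time_step_le n) _; rewrite invf_ple ?posrE//.
  by rewrite (le_trans (ltW (truncnS_gt _)))// ler_nat.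
(* The weight below [M] is divided by [1 + M] to get a test function bounded by
   1; [psi] is what remains above [M]. *)
pose phi x := (1 + M)^-1 * (\1_(E `&` `]0, M]) x * weight x).
pose psi x := \1_E x * (weight x * \1_`]M, +oo[ x).
have mEM : measurable (E `&` `]0, M]) by exact: measurableI.
have nphi : nonneg phi.
  apply: nonneg_funM; first by apply: nonneg_cst; rewrite invr_ge0 ltW.
  by apply: nonneg_funM; [exact: (nonneg_indic mEM)|exact: nonneg_weight].
have npsi : nonneg psi.
  apply: nonneg_funM; first exact: (nonneg_indic mE).
  by apply: nonneg_funM; [exact: nonneg_weight|exact: nonneg_indic].
have ind01 (D : set R) (x : R) : 0 <= (\1_D x : R) <= 1 by rewrite indicE; case: (_ \in _); rewrite ?lexx ler01.
have phi1 x : phi x <= 1.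
  rewrite /phi ler_pdivrMl// mulr1 indicE.
  have [/set_mem[_]|_] := boolP (x \in _); last by rewrite mul0r ltW.
  by rewrite /= in_itv /= => /andP[x0 xM]; rewrite mul1r /weight pospE// lerD2l.
have M0' := ltW M0.
have mE' r : mass lebR (wapprox n r) E = (1 + M) * pairing lebR (approx n r) phi +
    fine (mom psi (approx n r)).
  rewrite /mass (@mass_mom _ (wapprox n r) _ mE).
  have n3 : nonneg (fun x => (1 + M) * phi x) by apply: nonneg_funM; [exact: nonneg_cst|].
  have -> : mom \1_E (wapprox n r) = mom (fun x => (1 + M) * phi x + psi x)%R (approx n r).
    rewrite -(@eq_mom _ (approx n r) (@sa n r) (fun x => \1_E x * weight x)).
      by apply: eq_integral => x _; rewrite EFinM muleA.
    move=> x x0; rewrite /phi mulVKf ?gt_eqF// /psi !indicE in_setI.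
    rewrite !mem_setE !in_itv /= x0 andbT ltNge.
    by case: (x \in E); case: (x <= M) => /=; rewrite ?mul1r ?mul0r ?mulr1 ?mulr0 ?addr0 ?add0r.
  rewrite (momD (da n r) n3 npsi) (momZ (da n r) M0' nphi).
  have fw : (mom weight (approx n r) < +oo)%E.
    by apply: le_lt_trans (adm_weight (approx_adm n r)) _; exact: ltry.
  have pw x : phi x <= weight x by exact: le_trans (phi1 x) (weight_ge1 x).
  have qw x : psi x <= weight x.
    rewrite /psi mulrCA; apply: ler_piMr; first exact: weight_ge0.
    have /andP[a0 a1] := ind01 E x; have /andP[b0 b1] := ind01 `]M, +oo[%classic x.
    exact: mulr_ile1.
  have F1 := mom_fin (da n r) nphi (@nonneg_weight R) pw fw.
  have F2 := mom_fin (da n r) npsi (@nonneg_weight R) qw fw.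
  by rewrite fineD ?fin_numM// fineM.
have psib r : 0 <= fine (mom psi (approx n r)) <= e / 4.
  rewrite fine_ge0 ?(mom_ge0 npsi (da n r))//=.
  have n2 : nonneg (fun x => 2 * tail_weight M x).
    by apply: nonneg_funM; [exact: nonneg_cst|exact: nonneg_tail_weight].
  have H : (mom psi (approx n r) <= 2%:E * mom (tail_weight M) (approx n r))%E.
    rewrite -(momZ (da n r) (ler0n R 2) (nonneg_tail_weight M)).
    apply: (le_mom (da n r) (@sa n r) npsi n2) => x x0.
    rewrite /psi [\1_`]M, +oo[ x]indicE; have [/set_mem|_] := boolP (x \in `]M, +oo[%classic); last first.
      rewrite !mulr0 mulr_ge0//; exact: (nonneg_tail_weight M).2.
    rewrite /= in_itv /= andbT mulr1 => xM; apply: le_trans (weight_tail M1 x0 xM).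
    by apply: ler_piMl; [exact: weight_ge0|have /andP[] := ind01 E x].
  have T2 : (0 <= 2%:E :> \bar R)%E by rewrite lee_fin.
  have := le_trans H (lee_wpmul2l T2 (HM n r)); rewrite -EFinM.
  case: (mom psi (approx n r)) => [a| |] //=; rewrite ?lee_fin.
    by move=> /le_trans; apply; lra.
  by move=> _; rewrite divr_ge0// ltW.
rewrite !mE'.
have := psib t; have := psib s.
set b := fine (mom psi (approx n t)); set b' := fine (mom psi (approx n s)).
have := @path_lipschitz _ _ _ _ _ _ _ law beta02 alpha0 alpha_beta beta1 _ _ rho0 adm0
  _ _ (numberY It) n (steps n s) (steps n t - steps n s) phi.
rewrite subnKC ?steps_mono// => /(_ (steps_le n t0) t0 nphi phi1).
rewrite -/(approx n t) -/(approx n s) -/L.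
set a := pairing lebR (approx n t) phi; set a' := pairing lebR (approx n s) phi.
have hst : hstep n * (steps n t - steps n s)%:R <= 2 * d.
  rewrite natrB ?steps_mono// mulrBr.
  have := steps_le n t0; have := steps_gt n s; rewrite -natr1 mulrDr mulr1.
  by move: hd tsd; lra.
move=> H; have {H} : `|a - a'| <= L * (2 * d) by apply: le_trans H _; apply: ler_wpM2l.
move=> H; have {H} : (1 + M) * `|a - a'| <= e / 2.
  apply: (le_trans (ler_wpM2l M0' H)).
  have -> : e / 2 = (1 + M) * ((L + 1) * (2 * d)).
    by rewrite /d; field; rewrite !gt_eqF// ltr_wpDl.
  apply: ler_wpM2l => //; apply: ler_wpM2r; last by rewrite lerDl.
  by rewrite mulr_ge0// ltW.
move=> H /andP[? ?] /andP[? ?].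
have -> : (1 + M) * a + b - ((1 + M) * a' + b') = (1 + M) * (a - a') + (b - b') by ring.
apply: le_trans (ler_normD _ _) _; rewrite normrM (ger0_norm M0').
have : `|b - b'| <= e / 4 by rewrite ler_norml; apply/andP; split; lra.
lra.
Qed.

(** Rational numbers outside of the time interval are sent to 0, so that the
    index type is all of the rationals. *)
Definition rational_time (q : rat) : R := if pselect (I (ratr q)) is left _ then ratr q else 0.

Let I00 : I 0. Proof. by split. Qed.

Lemma rational_timeP q : I (rational_time q).
Proof. by rewrite /rational_time; case: pselect. Qed.

Lemma rational_time_dense t d : I t -> 0 < d -> exists q,
  0 <= rational_time q <= t /\ t - rational_time q <= d.
Proof.
move=> [t0 tT] d0; have [t0'|t0'] := ltrP 0 t; last first.
  have -> : t = 0 by apply/eqP; rewrite eq_le t0 t0'.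
  exists 0; rewrite /rational_time; case: pselect => [_|_]; rewrite ?rmorph0 lexx subrr;
  by split=> //; exact: ltW.
have : Num.max 0 (t - d) < t by rewrite gt_max t0' /= ltrBlDr ltrDl.
move=> /rat_in_itvoo[q]; rewrite in_itv /= gt_max => /andP[/andP[q0 qd] qt].
have Iq : I (ratr q) by split; [exact: ltW|apply: lt_trans tT; rewrite lte_fin].
exists q; rewrite /rational_time; case: pselect => [_|//].
by rewrite (ltW q0) (ltW qt); split=> //; lra.
Qed.

Theorem approx_compactness : exists s : nat -> nat, (forall n, (n <= s n)%N) /\
  exists v : R -> R -> \bar R, forall t, I t ->
    [/\ @density _ mR R (v t), (forall x, v t x \is a fin_num),
      (\int[lebR]_x v t x <= (V t)%:E)%E &
      forall E, measurable E ->
        mass lebR (wapprox (s n) t) E @[n --> \oo] --> mass lebR (v t) E].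
Proof.
pose C t := Num.max 0 (V t).
have CV t : I t -> C t = V t by move=> /bound_ge0 v0; rewrite /C max_r.
have [|||||||t It e e0|s [s1 [v Hv]]] := @setwise_compactness _ mR R lebR _ _ (@ray R) rational_time I wapprox C.
- by exists None.
- exact: ray_setI.
- exact: rays_generate.
- exact: rational_timeP.
- by move=> t; rewrite /C le_max lexx.
- move=> t n It; rewrite (CV _ It); split; [exact: density_wapprox|exact: wapprox_bound].
- exact: approx_uca.
- have [d d0 [N HN]] := approx_time It e0.
  have [q [q1 q2]] := rational_time_dense It d0.
  by exists q, N => n nN E mE; exact: HN.
exists s; split=> //; exists v => t It; rewrite -(CV _ It); exact: Hv.
Qed.

End approximation.

(** * A jointly measurable limit *)

Section joint_measurability.
Context {R : realType}.
Notation mR := (measurableTypeR R).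

Lemma ae_mono (P Q : R -> Prop) : (forall x, P x -> Q x) ->
  {ae (@lebesgue_measure R), forall x, P x} -> {ae (@lebesgue_measure R), forall x, Q x}.
Proof.
move=> PQ; move=> [N [mN N0 PN]]; exists N; split=> //.
by move=> x nQ; apply: PN => Px; apply: nQ; exact: PQ.
Qed.

Lemma ae_mono2 (P Q S : R -> Prop) : (forall x, P x -> Q x -> S x) ->
  {ae (@lebesgue_measure R), forall x, P x} -> {ae (@lebesgue_measure R), forall x, Q x} ->
  {ae (@lebesgue_measure R), forall x, S x}.
Proof.
move=> PQ [N [mN N0 PN]] [M [mM M0 PM]]; exists (N `|` M); split.
- exact: measurableU.
- exact: (@null_set_setU _ mR R lebR N M mN mM N0 M0).
move=> x nQ; have [Px|] := pselect (P x); last by left; exact: PN.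
by right; apply: PM => Qx; apply: nQ; exact: PQ.
Qed.

Definition radius (k : nat) : R := k.+1%:R^-1.

Lemma nicely_shrinking_ball (x : R) : nicely_shrinking x (fun k => ball x (radius k)).
Proof.
have r0 k : 0 < radius k by rewrite invr_gt0.
split=> [k|]; first exact: measurable_ball.
exists (1, fun k => PosNum (r0 k)); split => //=; last 2 first.
- by move=> n y.
- by move=> n; rewrite mul1e.
by apply/cvg_realP => e e0; exists (Num.truncn e^-1) => n en; rewrite subr0 ger0_norm ?(ltW (r0 n))//
  /radius invf_ple ?posrE// (le_trans (ltW (truncnS_gt _)))// ler_nat.
Qed.

Lemma measurable_near (r : R) :
  measurable [set q : (mR * mR) * mR | `|q.1.2 - q.2| < r].
Proof.
have mf : @measurable_fun _ _ ((mR * mR) * mR)%type R setT (fun q => `|q.1.2 - q.2|).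
  apply: measurableT_comp => //; apply: measurable_funB; last exact: measurable_snd.
  apply: (measurableT_comp (@measurable_snd _ _ mR mR)); exact: measurable_fst.
have := mf measurableT `]-oo, r[%classic (measurable_itv _); rewrite setTI.
by congr measurable; apply/seteqP; split=> q /=; rewrite in_itv.
Qed.

(** The limit in [n] of the averages over balls of radius [radius k]. Upper
    limits are taken here and below because they are measurable without any
    knowledge of convergence. *)
Definition ball_average (W : nat -> R -> R -> \bar R) (k : nat) (u : R * R) : \bar R :=
  ((radius k *+ 2)^-1%:E *
   limn_esup (fun n => \int[lebR]_y ((\1_(ball u.2 (radius k)) y)%:E * W n u.1 y)))%E.

(** The density obtained at each time is determined up to null sets only, with
    no measurability in time. Lebesgue differentiation of the limit masses
    selects values that are measurable in both variables. *)
Definition representative (W : nat -> R -> R -> \bar R) (u : R * R) : R :=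
  `|fine (limn_esup (fun k => ball_average W k u))|.

Lemma measurable_representative (W : nat -> R -> R -> \bar R) :
  (forall n, @density _ (mR * mR)%type R (fun u => W n u.1 u.2)) ->
  @measurable_fun _ _ (mR * mR)%type R setT (representative W).
Proof.
move=> dW; apply: measurableT_comp => //; apply: measurableT_comp; first exact: fine_measurable.
apply: measurable_fun_limn_esup => k; apply: measurable_funeM.
apply: measurable_fun_limn_esup => n.
have d1 : @density _ ((mR * mR) * mR)%type R (fun q =>
   ((\1_[set q : (mR * mR) * mR | `|q.1.2 - q.2| < radius k] q)%:E * W n q.1.1 q.2)%E).
  apply: densityM.
    apply: density_EFin => [|q]; last by rewrite indicE.
    by apply: measurable_indic; exact: measurable_near.
  have [mW W0] := dW n; split=> [|q]; last exact: W0 (q.1.1, q.2).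
  have mp : @measurable_fun _ _ ((mR * mR) * mR)%type (mR * mR)%type setT (fun q => (q.1.1, q.2)).
    apply: measurable_fun_pair => /=; last exact: measurable_snd.
    apply: (measurableT_comp (@measurable_fst _ _ mR mR)); exact: measurable_fst.
  exact: (measurableT_comp mW mp).
exact: (density_int2 lebR d1).1.
Qed.

(** At Lebesgue points of [v] the averages of [v] converge to its value, and by
    setwise convergence the averages over a ball of [v] are the limits of those
    of [W n t]. *)
Lemma representativeP (W : nat -> R -> R -> \bar R) (t : R) (v : R -> \bar R) (C : R) :
  (forall n, @density _ mR R (W n t)) -> (forall n, (\int[lebR]_x W n t x <= C%:E)%E) ->
  @density _ mR R v -> (forall x, v x \is a fin_num) ->
  (\int[lebR]_x v x <= C%:E)%E ->
  (forall E, measurable E -> mass lebR (W n t) E @[n --> \oo] --> mass lebR v E) ->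
  {ae lebR, forall x, (representative W (t, x))%:E = v x}.
Proof.
move=> dW WC dv vfin vC cv.
pose fv x := fine (v x).
have fvE x : (fv x)%:E = v x by rewrite fineK.
have iv : leb.-integrable setT (EFin \o fv).
  apply/integrableP; split.
    by rewrite (_ : EFin \o fv = v); [exact: dv.1|apply/funext => x; exact: fvE].
  apply: le_lt_trans (ltry C); apply: le_trans vC.
  rewrite le_eqVlt; apply/orP; left; apply/eqP; apply: eq_integral => x _.
  by rewrite [(EFin \o fv) x]fvE gee0_abs//; exact: dv.2.
have locv := open_integrable_locally openT iv.
have Lae : {ae lebR, forall x, lebesgue_pt fv x} by exact: (lebesgue_differentiation locv).
apply: ae_mono Lae => x Lx.
have := nice_lebesgue_differentiation nicely_shrinking_ball locv Lx.
have r0 k : 0 < radius k by rewrite invr_gt0.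
have -> : (fun k => (leb (ball x (radius k)))^-1 *
    \int[leb]_(y in ball x (radius k)) (fv y)%:E)%E = (fun k => ball_average W k (t, x)).
  apply/funext => k; rewrite lebesgue_measure_ball ?ltW//= /ball_average inver.
  rewrite mulrn_eq0 /= gt_eqF//; congr (_ * _)%E; symmetry.
  set b := ball x (radius k); have mb : measurable b by exact: measurable_ball.
  have -> : (\int[leb]_(y in b) (fv y)%:E = (mass lebR v b)%:E)%E.
    rewrite -(massE dv vC mb); apply: eq_integral => y _; exact: fvE.
  have -> : (fun n => \int[lebR]_y ((\1_b y)%:E * W n t y))%E = (fun n => (mass lebR (W n t) b)%:E).
    by apply/funext => n; rewrite -(massE (dW n) (WC n) mb) (@mass_mom _ (W n t) _ mb).
  apply: (cvg_limn_einf_sup _).2; apply: cvg_EFin; first exact: nearW.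
  exact: cv.
move=> /cvg_limn_einf_sup[_ H]; rewrite /representative /= H fvE -fvE /=.
by rewrite ger0_norm// fine_ge0//; exact: dv.2.
Qed.

End joint_measurability.

Section limit.
Context {R : realType}.
Notation mR := (measurableTypeR R).
Notation mom := (moment_of (@lebR R)).
Notation nonneg := (@nonneg_measurable _ mR R).
Variables (frag : R -> R * R -> R) (beta0 p B alpha beta : R).
Hypotheses (law : fragmentation_law frag beta0 p B) (p1 : 1 < p)
  (beta02 : 2 <= beta0) (B0 : 0 <= B)
  (alpha0 : 0 <= alpha) (alpha_beta : alpha <= beta) (beta1 : beta <= 1).
Variables (f0 : R -> \bar R) (rho : R).
Hypotheses (rho0 : 0 < rho) (adm0 : admissible rho f0).
Variables (T : \bar R) (Y : R -> R).
Hypothesis T0 : (0 < T)%E.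
Local Notation path := (euler_seq frag alpha beta f0).
Local Notation hstep := (@time_step R).
Local Notation I := (time_interval T).
Hypothesis numberY : forall t, I t -> forall n k, hstep n * k%:R <= t ->
  number frag alpha beta f0 n k <= Y t.
Local Notation approx := (approx frag alpha beta f0).
Local Notation wapprox := (wapprox frag alpha beta f0).

Let adm n k : admissible rho (path n k).
Proof. exact: (euler_admissible law beta02 alpha0 alpha_beta beta1 rho0 adm0). Qed.

Lemma steps_ge n k t : (k <= steps n t)%N = ((k == 0)%N || (hstep n * k%:R <= t)).
Proof.
have h0 := time_step_gt0 n : 0 < hstep n.
case: k => [|k] //=; apply/idP/idP => [H|H].
  have t0 : 0 <= t.
    have /(leq_ltn_trans (leq0n _)) := H; rewrite /steps truncn_gt0.
    by rewrite ler_pdivlMr// mul1r => /(lt_le_trans h0)/ltW.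
  apply: le_trans (steps_le n t0); apply: ler_wpM2l; first exact: ltW.
  by rewrite ler_nat.
rewrite -ltnS -(ltr_nat R) -(ltr_pM2l h0).
exact: le_lt_trans H (steps_gt _ _).
Qed.

Lemma measurable_steps n k : @measurable _ mR [set t | steps n t = k].
Proof.
have mge j : @measurable _ mR [set t | (j <= steps n t)%N].
  case: j => [|j]; first by rewrite (_ : [set t | _] = setT)//; apply/seteqP; split.
  rewrite (_ : [set t | _] = `[hstep n * j.+1%:R, +oo[%classic)//.
  by apply/seteqP; split=> t /=; rewrite steps_ge in_itv /= andbT.
rewrite (_ : [set t | _] = [set t | (k <= steps n t)%N] `\` [set t | (k.+1 <= steps n t)%N]).
  exact: measurableD.
apply/seteqP; split => t /=; first by move=> ->; rewrite leqnn ltnn.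
by move=> [kt /negP]; rewrite -leqNgt => tk; apply/eqP; rewrite eqn_leq tk.
Qed.

(** The approximations are step functions of time. *)
Lemma density_wapprox_joint n : @density _ (mR * mR)%type R (fun u => wapprox n u.1 u.2).
Proof.
apply: densityM.
  by apply: (@density_snd _ _ mR mR R (fun x => (weight x)%:E)); exact: (nonneg_density (@nonneg_weight R)).
split=> [|u]; last exact: (adm_density (adm n _)).2.
move=> _ U mU; rewrite setTI.
rewrite (_ : _ @^-1` U = \bigcup_k ([set t : mR | steps n t = k] `*` (path n k @^-1` U))).
  apply: bigcup_measurable => k _; apply: measurableX; first exact: measurable_steps.
  by rewrite -[X in measurable X]setTI; exact: (adm_density (adm n k)).1.
apply/seteqP; split => [u Hu|u [k _ [/= uk]]]; first by exists (steps n u.1).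
by rewrite -uk.
Qed.

Theorem limit_exists : exists s : nat -> nat, (forall n, (n <= s n)%N) /\
  exists f : R -> R -> R,
  [/\ @measurable_fun _ _ (mR * mR)%type R setT (fun u => f u.1 u.2),
      forall t x, 0 <= f t x,
      forall t x, ~ 0 < x -> f t x = 0 &
      forall t, I t -> (\int[lebR]_x (weight x * f t x)%:E <= (Y t + rho)%:E)%E /\
        forall E, measurable E -> mass lebR (wapprox (s n) t) E @[n --> \oo] -->
          mass lebR (fun x => (weight x * f t x)%:E) E].
Proof.
have [s [s1 [v Hv]]] := approx_compactness law p1 beta02 B0 alpha0 alpha_beta beta1 rho0 adm0 T0 numberY.
exists s; split=> //.
pose W n := wapprox (s n).
pose f t x := \1_`]0, +oo[ x * (representative W (t, x) / weight x).
have dW n := density_wapprox_joint (s n).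
have mrep := @measurable_representative R W dW.
have mpos : @measurable_fun _ _ mR R setT (\1_`]0, +oo[ : R -> R) by exact: measurable_indic.
have mwinv : @measurable_fun _ _ mR R setT (fun x => (weight x)^-1).
  rewrite (_ : (fun x => _) = (fun x => weight x `^ (-1))); last first.
    by apply/funext => x; rewrite powR_inv1// weight_ge0.
  exact: (measurableT_comp (measurable_powR (-1)) (@nonneg_weight R).1).
have posE (x : R) : \1_`]0, +oo[ x = ((0 < x)%R%:R : R).
  by rewrite indicE mem_setE in_itv /= andbT.
have fge0 t x : 0 <= f t x.
  by rewrite /f posE mulr_ge0 ?ler0n// divr_ge0 ?weight_ge0 ?normr_ge0.
exists f; split.
- apply: measurable_funM; first exact: (measurableT_comp mpos (@measurable_snd _ _ mR mR)).
  apply: measurable_funM; last exact: (measurableT_comp mwinv (@measurable_snd _ _ mR mR)).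
  rewrite (_ : (fun u => _) = representative W)//; by apply/funext => -[].
- exact: fge0.
- by move=> t x /negP/negPf x0; rewrite /f posE x0 mul0r.
move=> t It; have [dv vfin vC cv] := Hv t It.
have dWt n := density_wapprox law beta02 alpha0 alpha_beta beta1 rho0 adm0 (s n) t.
have WC n := wapprox_bound law beta02 alpha0 alpha_beta beta1 rho0 adm0 numberY (s n) It.
have rep := @representativeP R W t (v t) _ dWt WC dv vfin vC cv.
have dwf : @density _ mR R (fun x => (weight x * f t x)%:E).
  apply: density_EFin => [|x]; last by rewrite mulr_ge0 ?weight_ge0.
  have mrt := measurableT_comp mrep (@pair1_measurable _ _ mR mR t).
  exact: (measurable_funM (@nonneg_weight R).1 (measurable_funM mpos (measurable_funM mrt mwinv))).
(* The representative is cut off outside of the half line; this is harmless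
   because the limit density carries no mass there. *)
have negv : mass lebR (v t) `]-oo, 0] = 0.
  apply: cvg_unique (cv _ (measurable_itv _)) _ => //.
  rewrite (_ : (fun n => _) = cst 0); first exact: cvg_cst.
  apply/funext => n; rewrite /mass integral0_eq// => x.
  rewrite /= in_itv /= => x0; rewrite /wapprox.
  by rewrite /approx (adm_support (adm _ _)) ?mule0//; apply/negP; rewrite -leNgt.
have negae : {ae lebR, forall x, x <= 0 -> v t x = 0%E}.
  have mn : @measurable _ mR `]-oo, 0]%classic by exact: measurable_itv.
  have : ae_eq lebR `]-oo, 0]%classic (v t) (cst 0%E).
    have mvn := measurable_funTS dv.1 : @measurable_fun _ _ mR _ `]-oo, 0]%classic (v t).
    apply: (ae_eq_integral_abs lebR mn mvn).1.
    have E0 := massE dv vC mn; rewrite negv in E0.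
    rewrite -[RHS]E0; apply: eq_integral => x _; rewrite gee0_abs//; exact: dv.2.
  by apply: ae_mono => x H x0; apply: H; rewrite /= in_itv.
have wfv : {ae lebR, forall x, (weight x * f t x)%:E = v t x}.
  apply: ae_mono2 rep negae => x rx nx; rewrite /f posE.
  have [x0|x0] := ltrP 0 x; last by rewrite mul0r mulr0 nx.
  by rewrite mul1r mulrC divfK// gt_eqF// (lt_le_trans ltr01 (weight_ge1 x)).
have massv E : measurable E -> (\int[lebR]_(x in E) (weight x * f t x)%:E = \int[lebR]_(x in E) v t x)%E.
  move=> mE; apply: ae_eq_integral => //; try exact: density_measurable.
  by apply: ae_mono wfv => x H _.
split; first by rewrite massv.
by move=> E mE; rewrite /mass massv//; exact: cv.
Qed.

End limit.

(** * Quadratic pairings *)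

Section quadratic_pairing.
Context {R : realType}.
Notation mR := (measurableTypeR R).
Notation mom := (moment_of (@lebR R)).
Notation nonneg := (@nonneg_measurable _ mR R).
Notation test := (@test_fun _ mR R).
Notation test2 := (@test_fun _ (mR * mR)%type R).

Definition inner_pairing (w : R -> \bar R) (Psi : R * R -> R) (x : R) : R :=
  pairing (@lebR R) w (fun y => Psi (x, y)).

Definition pairing2 (w : R -> \bar R) (Psi : R * R -> R) : R :=
  pairing (@lebR R) w (inner_pairing w Psi).

Lemma test_section M Psi x : test2 M Psi -> test M (fun y => Psi (x, y)).
Proof.
move=> [mP bP]; split=> [|y]; last exact: bP.
exact: (measurableT_comp mP (@pair1_measurable _ _ mR mR x)).
Qed.

Section theory.
Variables (w : R -> \bar R) (C : R).
Hypotheses (dw : @density _ mR R w) (wC : (\int[lebR]_x w x <= C%:E)%E).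

Lemma test_inner_pairing M Psi : 0 <= M -> test2 M Psi -> test (M * C) (inner_pairing w Psi).
Proof.
move=> M0 tP; split=> [|x].
  have d1 : @density _ (mR * mR)%type R (fun u => (Psi u)%:E * w u.2)%E.
    apply: densityM; last exact: (@density_snd _ _ mR mR R w dw).
    by apply: density_EFin => [|u]; [exact: tP.1|have /andP[] := tP.2 u].
  have [mI _] := density_int2 lebR d1.
  exact: (measurableT_comp (fine_measurable measurableT) mI).
have tx := test_section x tP; apply/andP; split; first exact: (pairing_ge0 lebR dw tx).
apply: le_trans (pairing_cst dw wC M0).
have tM := @test_fun_cst _ mR R M M0.
have le y : Psi (x, y) <= (cst M : mR -> R) y by have /andP[] := tP.2 (x, y).
exact: (le_pairing dw wC tx tM le).
Qed.

Lemma pairing2_ge0 M Psi : 0 <= M -> test2 M Psi -> 0 <= pairing2 w Psi.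
Proof. by move=> M0 tP; exact: (pairing_ge0 lebR dw (test_inner_pairing M0 tP)). Qed.

Lemma pairing2_le M Psi : 0 <= M -> test2 M Psi -> 0 <= C -> pairing2 w Psi <= M * C * C.
Proof.
move=> M0 tP C0; have MC : 0 <= M * C by exact: mulr_ge0.
have ti := test_inner_pairing M0 tP.
apply: le_trans (pairing_cst dw wC MC).
have tM := @test_fun_cst _ mR R _ MC.
have le x : inner_pairing w Psi x <= (cst (M * C) : mR -> R) x by have /andP[] := ti.2 x.
exact: (le_pairing dw wC ti tM le).
Qed.

End theory.

(** The lemma [pairing_cvg] is used twice: for fixed [x] it gives pointwise
    convergence of the inner pairings, which are bounded test functions for the
    outer one. *)
Lemma pairing2_cvg (u : nat -> R -> \bar R) (C : R) (v : R -> \bar R) (M : R)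
    (Psi : nat -> R * R -> R) (Psi0 : R * R -> R) :
  (forall n, @density _ mR R (u n)) -> 0 <= C ->
  (forall n, (\int[lebR]_x u n x <= C%:E)%E) -> unif_countably_additive lebR u ->
  @density _ mR R v -> (\int[lebR]_x v x <= C%:E)%E ->
  (forall E, measurable E -> mass lebR (u n) E @[n --> \oo] --> mass lebR v E) ->
  0 <= M -> (forall n, test2 M (Psi n)) -> test2 M Psi0 ->
  (forall z, Psi n z @[n --> \oo] --> Psi0 z) ->
  pairing2 (u n) (Psi n) @[n --> \oo] --> pairing2 v Psi0.
Proof.
move=> du C0 uC uca dv vC uv M0 tP tP0 PP.
have MC : 0 <= M * C by exact: mulr_ge0.
apply: (pairing_cvg du C0 uC uca dv vC uv MC).
- by move=> n; apply: (test_inner_pairing (du n) (uC n) M0); exact: tP.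
- exact: (test_inner_pairing dv vC M0 tP0).
move=> x; apply: (pairing_cvg du C0 uC uca dv vC uv M0).
- by move=> n; exact: test_section.
- exact: test_section.
- by move=> y; exact: PP.
Qed.

(** The kernel divided by the weights is bounded on the quadrant. Outside of it
    the densities vanish, and the value 0 makes the bound global. *)
Definition weighted_symbol (K Theta : R * R -> R) (u : R * R) : R :=
  if (0 < u.1) && (0 < u.2) then Theta u * K u / (weight u.1 * weight u.2) else 0.

Definition weighted (w : R -> \bar R) (x : R) : \bar R := ((weight x)%:E * w x)%E.

Section collisions.
Variables (K Theta : R * R -> R) (M : R).
Hypotheses (mK : @measurable_fun _ _ (mR * mR)%type R setT K) (K0 : forall u, 0 <= K u)
  (K2 : forall x y, 0 < x -> 0 < y -> K (x, y) <= 2 * (weight x * weight y))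
  (M0 : 0 <= M) (tT : test2 M Theta).

Let weight_gt0 (x : R) : 0 < weight x.
Proof. exact: lt_le_trans ltr01 (weight_ge1 x). Qed.

Lemma test_weighted_symbol : test2 (2 * M) (weighted_symbol K Theta).
Proof.
have w2 (u : R * R) : 0 < weight u.1 * weight u.2 by rewrite mulr_gt0.
split=> [|[x y]].
  have mw1 : @measurable_fun _ _ (mR * mR)%type R setT (fun u => weight u.1).
    exact: (measurableT_comp (@nonneg_weight R).1 (@measurable_fst _ _ mR mR)).
  have mw2 : @measurable_fun _ _ (mR * mR)%type R setT (fun u => weight u.2).
    exact: (measurableT_comp (@nonneg_weight R).1 (@measurable_snd _ _ mR mR)).
  have mp : @measurable _ mR `]0, +oo[%classic by exact: measurable_itv.
  have m1 : @measurable_fun _ _ (mR * mR)%type R setT (fun u => \1_`]0, +oo[ u.1).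
    exact: (measurableT_comp (measurable_indic mp) (@measurable_fst _ _ mR mR)).
  have m2 : @measurable_fun _ _ (mR * mR)%type R setT (fun u => \1_`]0, +oo[ u.2).
    exact: (measurableT_comp (measurable_indic mp) (@measurable_snd _ _ mR mR)).
  rewrite (_ : weighted_symbol K Theta = (fun u => \1_`]0, +oo[ u.1 * \1_`]0, +oo[ u.2 *
      (Theta u * K u * (weight u.1 * weight u.2) `^ (-1)))).
    have mww := measurableT_comp (measurable_powR (-1)) (measurable_funM mw1 mw2).
    exact: (measurable_funM (measurable_funM m1 m2) (measurable_funM (measurable_funM tT.1 mK) mww)).
  apply/funext => -[x y]; rewrite /weighted_symbol /= !indicE !mem_setE !in_itv /= !andbT.
  rewrite powR_inv1; last by rewrite mulr_ge0 ?weight_ge0.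
  by case: (0 < x)%R; case: (0 < y)%R; rewrite ?mulr1 ?mul1r ?mul0r ?mulr0 ?mul0r.
rewrite /weighted_symbol /=; case: ifPn => [/andP[x0 y0]|_]; last first.
  by rewrite lexx mulr_ge0.
have /andP[t0 tM] := tT.2 (x, y); have k2 := K2 x0 y0; have ww := w2 (x, y).
rewrite divr_ge0 ?(ltW ww)//= ?mulr_ge0// ler_pdivrMr//.
have -> : 2 * M * (weight x * weight y) = M * (2 * (weight x * weight y)) by ring.
exact: (ler_pM t0 (K0 _) tM k2).
Qed.

Lemma collisions_pairing (w : R -> \bar R) (C : R) : @density _ mR R w ->
  (forall x, ~ 0 < x -> w x = 0%E) -> (\int[lebR]_x weighted w x <= C%:E)%E ->
  collisions lebR K (fun u => (Theta u)%:E) w =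
  (pairing2 (weighted w) (weighted_symbol K Theta))%:E.
Proof.
move=> dw w0 wC; have tS := test_weighted_symbol.
have dww : @density _ mR R (weighted w) by exact: (density_mom (@nonneg_weight R) dw).
have M2 : 0 <= 2 * M by rewrite mulr_ge0.
rewrite /pairing2 -(pairingE dww wC (test_inner_pairing dww wC M2 tS)).
apply: eq_integral => x _.
rewrite /inner_pairing -(pairingE dww wC (test_section x tS)).
have dS : @density _ mR R (fun y => (weighted_symbol K Theta (x, y))%:E * weighted w y)%E.
  apply: densityM => //; apply: density_EFin; first exact: (test_section x tS).1.
  by move=> y; have /andP[] := tS.2 (x, y).
rewrite muleC -int_densityZe//; last exact: dww.2.
apply: eq_integral => y _; rewrite /weighted /weighted_symbol /=.
have [x0|/w0->] := pselect (0 < x); last by rewrite mule0 !mul0e !mule0.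
have [y0|/w0->] := pselect (0 < y); last by rewrite !mule0.
rewrite x0 y0 /=.
have wx := weight_gt0 x; have wy := weight_gt0 y.
set a := w x; set b := w y.
transitivity ((Theta (x, y) * K (x, y))%:E * (a * b))%E.
  by rewrite EFinM muleA.
transitivity ((weight x)%:E * ((Theta (x, y) * K (x, y) / (weight x * weight y))%:E * (weight y)%:E) * (a * b))%E.
  by rewrite -!EFinM; congr (_%:E * _)%E; field; rewrite !gt_eqF.
rewrite -!muleA; congr (_ * _)%E; rewrite [RHS]muleCA; congr (_ * _)%E.
by rewrite muleCA.
Qed.

End collisions.

End quadratic_pairing.

(** * The equation in the limit *)

Section step_functions.
Context {R : realType}.
Notation mR := (measurableTypeR R).
Local Notation hstep := (@time_step R).

Lemma telescope_steps (m q1 q2 : nat -> R) h k :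
  (forall j, (j < k)%N -> m j.+1 + h * q1 j = m j + h * q2 j) ->
  m k + h * \sum_(j < k) q1 j = m 0%N + h * \sum_(j < k) q2 j.
Proof.
elim: k => [|k IH] H; first by rewrite !big_ord0.
have := H k (ltnSn k); have := IH (fun j jk => H j (leqW jk)).
rewrite !big_ord_recr /= !mulrDr; lra.
Qed.

Lemma fine_balance (a b : \bar R) (c d h : R) : a \is a fin_num -> b \is a fin_num ->
  (b + h%:E * c%:E = a + h%:E * d%:E)%E -> fine b + h * c = fine a + h * d.
Proof. by case: a b => [a| |] [b| |] //= _ _ []. Qed.

Lemma fine_sum_eq (a b c d : \bar R) : a \is a fin_num -> b \is a fin_num ->
  c \is a fin_num -> d \is a fin_num -> fine a + fine b = fine c + fine d ->
  (a + b = c + d)%E.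
Proof. by case: a b c d => [a| |] [b| |] [c| |] [d| |] //= _ _ _ _ H; congr EFin. Qed.

Lemma lim_eventually_eq (a b : nat -> R) (la lb : R) :
  (exists N, forall n, (N <= n)%N -> a n = b n) ->
  a n @[n --> \oo] --> la -> b n @[n --> \oo] --> lb -> la = lb.
Proof.
move=> [N ab] ca cb; apply: (@cvg_unique _ (@Rhausdorff R) _ _ _ _ ca).
apply/cvg_realP => e e0; have [M HM] := (cvg_realP _ _).1 cb _ e0.
exists (maxn N M) => n; rewrite geq_max => /andP[nN nM].
by rewrite ab//; exact: HM.
Qed.

Lemma limr_le_seq (a : nat -> R) l c : a n @[n --> \oo] --> l ->
  (forall n, a n <= c) -> l <= c.
Proof.
move=> ca ac; rewrite -(cvg_lim (@Rhausdorff R) ca).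
by apply: limr_le; [apply/cvg_ex; exists l|exact: nearW].
Qed.

Lemma integral_cst_itv (a b c : R) : a <= b ->
  (\int[lebR]_(t in `[a, b[) c%:E = (c * (b - a))%:E)%E.
Proof.
move=> ab; have H : @lebesgue_measure R `[a, b[%classic = (b - a)%:E.
  rewrite lebesgue_measure_itv /= lte_fin -EFinD; case: ltrP => // ba.
  by congr EFin; apply/eqP; rewrite eq_sym subr_eq0 eq_le ba ab.
rewrite (@integral_cst _ mR R lebR)// EFinM; congr (_ * _)%E; exact: H.
Qed.

Lemma measurable_steps_fun n (q : nat -> R) :
  @measurable_fun _ _ mR R setT (fun t => q (steps n t)).
Proof.
move=> _ U mU; rewrite setTI.
rewrite (_ : _ @^-1` U = \bigcup_(k in [set k | U (q k)]) [set t : mR | steps n t = k]).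
  by apply: bigcup_measurable => k _; exact: measurable_steps.
by apply/seteqP; split => [t Ht|t [k /= Uk tk]] /=; [exists (steps n t)|rewrite tk].
Qed.

Lemma integral_steps n (q : nat -> R) k : (forall j, 0 <= q j) ->
  (\int[lebR]_(t in `[0%R, (hstep n * k%:R)%R[) (q (steps n t))%:E =
   (hstep n * \sum_(j < k) q j)%:E)%E.
Proof.
move=> q0; have h0 := time_step_gt0 n : 0 < hstep n.
elim: k => [|k IH].
  by rewrite mulr0 set_itv_ge ?bnd_simp -?leNgt// integral_set0 big_ord0 mulr0.
have sp : `[0, hstep n * k.+1%:R[%classic =
    `[0, hstep n * k%:R[%classic `|` `[hstep n * k%:R, hstep n * k.+1%:R[%classic :> set R.
  apply/seteqP; split=> t /=; rewrite !in_itv /=.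
    move=> /andP[-> ->]; rewrite andbT /=.
    by case: (ltrP t (hstep n * k%:R)) => ?; [left|right].
  move=> [/andP[-> /lt_le_trans]|/andP[kt ->]]; first by apply; rewrite ler_pM2l// ler_nat.
  by rewrite andbT (le_trans _ kt)// mulr_ge0// ltW.
have mf := measurable_steps_fun n q.
rewrite sp (@ge0_integral_setU _ mR R lebR)//; last 3 first.
- apply/measurable_EFinP; exact: measurable_funTS.
- by move=> r _; rewrite lee_fin.
- apply/disj_setPS => t [] /=; rewrite !in_itv /= => /andP[_ tk] /andP[/(lt_le_trans tk)].
  by rewrite ltxx.
rewrite IH big_ord_recr /= mulrDr EFinD; congr (_ + _)%E.
transitivity (\int[lebR]_(t in `[(hstep n * k%:R)%R, (hstep n * k.+1%:R)%R[) (q k)%:E)%E.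
  apply: eq_integral => t /set_mem; rewrite /= in_itv /= => /andP[kt tk].
  congr (q _)%:E; apply/eqP; rewrite eqn_leq.
  rewrite -ltnS -(ltr_nat R) -(ltr_pM2l h0).
  have t0 : 0 <= t by rewrite (le_trans _ kt)// mulr_ge0// ltW.
  rewrite (le_lt_trans (steps_le n t0) tk) /=.
  by rewrite steps_ge kt orbT.
rewrite integral_cst_itv; last by rewrite ler_pM2l// ler_nat.
by rewrite -natr1; congr EFin; ring.
Qed.

(** The time integral of a step function is its Riemann sum up to the last,
    incomplete step. *)
Lemma integral_steps_approx n (q : nat -> R) b t : 0 <= t -> (forall j, 0 <= q j) ->
  (forall j, hstep n * j%:R <= t -> q j <= b) ->
  exists2 r, 0 <= r <= hstep n * b &
  (\int[lebR]_(t in `[0%R, t[) (q (steps n t))%:E =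
   (hstep n * \sum_(j < steps n t) q j + r)%:E)%E.
Proof.
move=> t0 q0 qb; have h0 := time_step_gt0 n : 0 < hstep n.
set k := steps n t; have kt : hstep n * k%:R <= t by exact: steps_le.
have sp : `[0, t[%classic =
    `[0, hstep n * k%:R[%classic `|` `[hstep n * k%:R, t[%classic :> set R.
  apply/seteqP; split=> r /=; rewrite !in_itv /=.
    move=> /andP[-> ->]; rewrite andbT /=.
    by case: (ltrP r (hstep n * k%:R)) => ?; [left|right].
  move=> [/andP[-> /lt_le_trans]|/andP[kr ->]]; first by apply.
  by rewrite andbT (le_trans _ kr)// mulr_ge0// ltW.
have mf := measurable_steps_fun n q.
rewrite sp (@ge0_integral_setU _ mR R lebR)//; last 3 first.
- apply/measurable_EFinP; exact: measurable_funTS.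
- by move=> r _; rewrite lee_fin.
- apply/disj_setPS => r [] /=; rewrite !in_itv /= => /andP[_ tk] /andP[/(lt_le_trans tk)].
  by rewrite ltxx.
rewrite integral_steps//.
have -> : (\int[lebR]_(r in `[(hstep n * k%:R)%R, t[) (q (steps n r))%:E =
    \int[lebR]_(r in `[(hstep n * k%:R)%R, t[) (q k)%:E)%E.
  apply: eq_integral => r /set_mem; rewrite /= in_itv /= => /andP[kr rt].
  congr (q _)%:E; apply/eqP; rewrite eqn_leq steps_mono//=; last exact: ltW.
  by rewrite steps_ge kr orbT.
rewrite integral_cst_itv//.
exists (q k * (t - hstep n * k%:R)); last by rewrite -EFinD.
rewrite mulr_ge0 ?subr_ge0//= mulrC; apply: ler_pM => //.
- by rewrite subr_ge0.
- have := steps_gt n t; rewrite -/k -natr1 mulrDr mulr1; lra.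
- exact: qb.
Qed.

End step_functions.

Section weak_equation.
Context {R : realType}.
Notation mR := (measurableTypeR R).
Notation mom := (moment_of (@lebR R)).
Notation nonneg := (@nonneg_measurable _ mR R).
Notation test := (@test_fun _ mR R).
Notation test2 := (@test_fun _ (mR * mR)%type R).
Variables (frag : R -> R * R -> R) (beta0 p B alpha beta : R).
Hypotheses (law : fragmentation_law frag beta0 p B) (p1 : 1 < p)
  (beta02 : 2 <= beta0) (B0 : 0 <= B)
  (alpha0 : 0 <= alpha) (alpha_beta : alpha <= beta) (beta1 : beta <= 1).
Variables (f0 : R -> \bar R) (rho : R).
Hypotheses (rho0 : 0 < rho) (adm0 : admissible rho f0).
Variables (T : \bar R) (Y : R -> R).
Local Notation path := (euler_seq frag alpha beta f0).
Local Notation hstep := (@time_step R).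
Local Notation I := (time_interval T).
Local Notation K := (truncated_kernel alpha beta).
Local Notation K0 := (kernel2 alpha beta).
Hypothesis numberY : forall t, I t -> forall n k, hstep n * k%:R <= t ->
  number frag alpha beta f0 n k <= Y t.
Local Notation approx := (approx frag alpha beta f0).
Local Notation wapprox := (wapprox frag alpha beta f0).
Variables (s : nat -> nat) (f : R -> R -> R).
Hypotheses (s_ge : forall n, (n <= s n)%N)
  (mf : @measurable_fun _ _ (mR * mR)%type R setT (fun u => f u.1 u.2))
  (f_ge0 : forall t x, 0 <= f t x) (f_supp : forall t x, ~ 0 < x -> f t x = 0)
  (f_bound : forall t, I t -> (\int[lebR]_x (weight x * f t x)%:E <= (Y t + rho)%:E)%E)
  (f_lim : forall t, I t -> forall E, measurable E ->
    mass lebR (wapprox (s n) t) E @[n --> \oo] --> mass lebR (fun x => (weight x * f t x)%:E) E).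

Definition section_density (t : R) (x : R) : \bar R := (f t x)%:E.
Local Notation F := section_density.

Let adm n k : admissible rho (path n k).
Proof. exact: (euler_admissible law beta02 alpha0 alpha_beta beta1 rho0 adm0). Qed.

Let dpath n k : @density _ mR R (path n k). Proof. exact: adm_density (adm n k). Qed.

Let V t := Y t + rho.
Let V0 t : I t -> 0 <= V t.
Proof. exact: (bound_ge0 law beta02 alpha0 alpha_beta beta1 rho0 adm0 numberY). Qed.

Let I_le r t : I t -> 0 <= r -> r <= t -> I r.
Proof. by move=> [_ tT] r0 rt; split=> //; apply: le_lt_trans tT; rewrite lee_fin. Qed.

Lemma density_F t : @density _ mR R (F t).
Proof.
apply: density_EFin => [|x]; last exact: f_ge0.
exact: (measurableT_comp mf (@pair1_measurable _ _ mR mR t)).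
Qed.

Lemma F_supp t x : ~ 0 < x -> F t x = 0%E.
Proof. by move=> x0; rewrite /F f_supp. Qed.

Lemma density_wF t : @density _ mR R (weighted (F t)).
Proof. exact: (density_mom (@nonneg_weight R) (density_F t)). Qed.

Lemma wF_bound t : I t -> (\int[lebR]_x weighted (F t) x <= (V t)%:E)%E.
Proof. exact: f_bound. Qed.

Lemma mass_wF_cvg t : I t -> forall E, measurable E ->
  mass lebR (wapprox (s n) t) E @[n --> \oo] --> mass lebR (weighted (F t)) E.
Proof. exact: f_lim. Qed.

Let dW n t : @density _ mR R (wapprox n t).
Proof. exact: (density_wapprox law beta02 alpha0 alpha_beta beta1 rho0 adm0). Qed.

Let WC n t : I t -> (\int[lebR]_x wapprox n t x <= (V t)%:E)%E.
Proof. exact: (wapprox_bound law beta02 alpha0 alpha_beta beta1 rho0 adm0 numberY). Qed.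

Let Wuca t : I t -> unif_countably_additive lebR (fun n => wapprox (s n) t).
Proof.
move=> It E mE dec cap e e0.
have [j Hj] := approx_uca law p1 beta02 B0 alpha0 alpha_beta beta1 rho0 adm0 numberY It mE dec cap e0.
by exists j => n; exact: Hj.
Qed.

Lemma pairing_wF_cvg t M g : I t -> test M g ->
  pairing lebR (wapprox (s n) t) g @[n --> \oo] --> pairing lebR (weighted (F t)) g.
Proof.
move=> It tg.
have M0 : 0 <= M by have /andP[a b] := tg.2 0; exact: le_trans a b.
apply: (pairing_cvg (fun n => dW (s n) t) (V0 It) (fun n => WC (s n) It) (Wuca It)
  (density_wF t) (wF_bound It) (mass_wF_cvg It) M0 (fun=> tg) tg) => x.
exact: cvg_cst.
Qed.

Section symbol.
Variables (M : R) (Theta : R * R -> R).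
Hypotheses (M0 : 0 <= M) (tT : test2 M Theta).

Definition rate_at (n j : nat) : R :=
  pairing2 (weighted (path n j)) (weighted_symbol (K n) Theta).
Definition limit_rate (t : R) : R := pairing2 (weighted (F t)) (weighted_symbol K0 Theta).

Let M2 : 0 <= 2 * M. Proof. by rewrite mulr_ge0. Qed.

Let tS n : test2 (2 * M) (weighted_symbol (K n) Theta).
Proof.
exact: (test_weighted_symbol (measurable_truncated_kernel alpha beta n)
  (@truncated_kernel_ge0 R alpha beta n)
  (@truncated_kernel_weight R alpha beta alpha0 alpha_beta beta1 n) M0 tT).
Qed.

Let tS0 : test2 (2 * M) (weighted_symbol K0 Theta).
Proof.
exact: (test_weighted_symbol (measurable_kernel2 alpha beta)
  (@kernel2_ge0 R alpha beta) (@kernel2_le R alpha beta alpha0 alpha_beta beta1) M0 tT).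
Qed.

Let dwpath n j : @density _ mR R (weighted (path n j)).
Proof. exact: (density_mom (@nonneg_weight R) (dpath n j)). Qed.

Let wpath_bound t n j : I t -> hstep n * j%:R <= t ->
  (\int[lebR]_x weighted (path n j) x <= (V t)%:E)%E.
Proof.
by move=> It; exact: (path_weight law beta02 alpha0 alpha_beta beta1 rho0 adm0 (numberY It)).
Qed.

Let wpath_finite n j :
  (\int[lebR]_x weighted (path n j) x <= (fine (mom (fun=> 1%R) (path n j)) + rho)%:E)%E.
Proof. exact: adm_weight (adm n j). Qed.

Lemma rate_at_ge0 n j : 0 <= rate_at n j.
Proof. exact: (pairing2_ge0 (dwpath n j) (wpath_finite n j) M2 (tS n)). Qed.

Lemma rate_at_le t n j : I t -> hstep n * j%:R <= t -> rate_at n j <= 2 * M * V t * V t.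
Proof.
by move=> It jt; exact: (pairing2_le (dwpath n j) (wpath_bound It jt) M2 (tS n) (V0 It)).
Qed.

Lemma rate_atE n j : collisions lebR (K n) (fun u => (Theta u)%:E) (path n j) = (rate_at n j)%:E.
Proof.
exact: (collisions_pairing (measurable_truncated_kernel alpha beta n)
  (@truncated_kernel_ge0 R alpha beta n)
  (@truncated_kernel_weight R alpha beta alpha0 alpha_beta beta1 n) M0 tT
  (dpath n j) (adm_support (adm n j)) (wpath_finite n j)).
Qed.

Lemma limit_rateE t : I t ->
  collisions lebR K0 (fun u => (Theta u)%:E) (F t) = (limit_rate t)%:E.
Proof.
move=> It.
exact: (collisions_pairing (measurable_kernel2 alpha beta)
  (@kernel2_ge0 R alpha beta) (@kernel2_le R alpha beta alpha0 alpha_beta beta1) M0 tT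
  (density_F t) (@F_supp t) (wF_bound It)).
Qed.

(** The truncated kernels are eventually equal to the kernel at each point, so
    the symbols converge pointwise and [pairing2_cvg] applies. *)
Lemma rate_cvg t : I t -> rate_at (s n) (steps (s n) t) @[n --> \oo] --> limit_rate t.
Proof.
move=> It.
apply: (pairing2_cvg (fun n => dW (s n) t) (V0 It) (fun n => WC (s n) It) (Wuca It)
  (density_wF t) (wF_bound It) (mass_wF_cvg It) M2 (fun n => tS (s n)) tS0) => z.
apply/cvg_realP => e e0; exists (Num.truncn (K0 z)) => n nz.
rewrite /weighted_symbol; case: ifP => _; last by rewrite subrr normr0 ltW.
rewrite /truncated_kernel min_l ?subrr ?normr0 ?(ltW e0)//.
rewrite (le_trans (ltW (truncnS_gt _)))// ler_nat ltnS.
exact: leq_trans nz (s_ge n).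
Qed.

(** Dominated convergence in time, the rates being uniformly bounded before
    time [t]. *)
Lemma integral_rate_cvg t : I t ->
  hstep (s n) * \sum_(j < steps (s n) t) rate_at (s n) j @[n --> \oo] -->
    fine (\int[lebR]_(r in `[0%R, t[) (limit_rate r)%:E)%E /\
  (\int[lebR]_(r in `[0%R, t[) (limit_rate r)%:E)%E \is a fin_num.
Proof.
move=> It; have t0 : 0 <= t by case: It.
pose b := 2 * M * V t * V t.
have b0 : 0 <= b by rewrite !mulr_ge0 ?V0.
have early n r j : 0 <= r -> r <= t -> (j <= steps n r)%N -> hstep n * j%:R <= t.
  move=> r0 rt jr; apply: le_trans rt; apply: le_trans (steps_le n r0).
  by apply: ler_wpM2l; [apply: ltW; exact: time_step_gt0|rewrite ler_nat].
have mI : @measurable _ mR `[0, t[%classic by exact: measurable_itv.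
pose q (n : nat) (r : R) := (rate_at (s n) (steps (s n) r))%:E.
have mq n : @measurable_fun _ _ mR _ `[0, t[%classic (q n).
  apply/measurable_EFinP; apply: measurable_funTS.
  exact: (measurable_steps_fun (s n) (rate_at (s n))).
have qb n r : `[0, t[%classic r -> (`|q n r| <= b%:E)%E.
  rewrite /= in_itv /= => /andP[r0 rt].
  rewrite lee_fin (ger0_norm (rate_at_ge0 _ _)).
  by apply: (rate_at_le It); exact: early r0 (ltW rt) (leqnn _).
have qcv r : `[0, t[%classic r -> q n r @[n --> \oo] --> (limit_rate r)%:E.
  rewrite /= in_itv /= => /andP[r0 rt]; apply: cvg_EFin; first exact: nearW.
  by apply: rate_cvg; exact: I_le It r0 (ltW rt).
have ib : (lebR : {measure set mR -> \bar R}).-integrable `[0, t[%classic (cst b%:E).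
  apply/integrableP; split; first exact: measurable_cst.
  have -> : (\int[lebR]_(x in `[0%R, t[) `|cst b%:E x| = \int[lebR]_(x in `[0%R, t[) b%:E)%E.
    by apply: eq_integral => x _ /=; rewrite ger0_norm.
  by rewrite integral_cst_itv// ltry.
have cvI := @dominated_cvg _ mR R lebR _ mI q (fun r => (limit_rate r)%:E) (cst b%:E)
  mq qcv (fun _ _ => isT) ib qb.
pose c n := hstep (s n) * \sum_(j < steps (s n) t) rate_at (s n) j.
have rem n : exists2 r, 0 <= r <= hstep (s n) * b &
    (\int[lebR]_(r in `[0%R, t[) q n r = (c n + r)%:E)%E.
  apply: (@integral_steps_approx _ (s n) (rate_at (s n)) b t t0 (rate_at_ge0 (s n))).
  by move=> j jt; exact: rate_at_le It jt.
have cb n : 0 <= c n <= t * b.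
  rewrite mulr_ge0 ?sumr_ge0//=; [|apply: ltW; exact: time_step_gt0|by move=> j _; exact: rate_at_ge0].
  apply: (@le_trans _ _ (hstep (s n) * \sum_(j < steps (s n) t) b)).
    apply: ler_wpM2l; first by apply: ltW; exact: time_step_gt0.
    apply: ler_sum => j _; apply: rate_at_le It _.
    exact: early t0 (lexx t) (ltnW (ltn_ord j)).
  rewrite sumr_const card_ord -mulr_natl mulrA; apply: ler_wpM2r => //.
  exact: steps_le.
pose J := (\int[lebR]_(r in `[0%R, t[) (limit_rate r)%:E)%E.
have J0 : (0 <= J)%E.
  apply: integral_ge0 => r /=; rewrite in_itv /= => /andP[r0 rt].
  rewrite lee_fin; apply: (pairing2_ge0 (density_wF r) _ M2 tS0).
  exact: wF_bound (I_le It r0 (ltW rt)).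
have Jfin : J \is a fin_num.
  rewrite ge0_fin_numE//; apply: (@le_lt_trans _ _ (t * b + b)%:E); last exact: ltry.
  have JE : limn (fun n => \int[lebR]_(r in `[0%R, t[) q n r)%E = J.
    exact: (cvg_lim (@ereal_hausdorff R) cvI).
  rewrite -JE; apply: lime_le; first by apply/cvg_ex; exists J.
  apply: nearW => n; have [r /andP[r0 rb] ->] := rem n; rewrite lee_fin.
  apply: lerD; first by have /andP[] := cb n.
  apply: le_trans rb _; rewrite -[X in _ <= X]mul1r; apply: ler_wpM2r => //.
  by apply: le_trans (time_step_le _) _; rewrite invf_le1// ler1n.
split=> //.
have fcv : fine (\int[lebR]_(r in `[0%R, t[) q n r)%E @[n --> \oo] --> fine J.
  by apply: fine_cvg; rewrite fineK.
apply/cvg_realP => e e0.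
have e2 : 0 < e / 2 by rewrite divr_gt0.
have [N HN] := (cvg_realP _ _).1 fcv _ e2.
exists (maxn N (Num.truncn (b / (e / 2)))) => n; rewrite geq_max => /andP[nN nb].
have := HN n nN; have [r /andP[r0 rb] ->] := rem n; rewrite /= -/(c n).
have : hstep (s n) * b <= e / 2.
  apply: (@le_trans _ _ ((s n).+1%:R^-1 * b)).
    by apply: ler_wpM2r => //; exact: time_step_le.
  rewrite mulrC ler_pdivrMr// mulrC -ler_pdivrMr//.
  rewrite (le_trans (ltW (truncnS_gt _)))// ler_nat ltnS.
  exact: leq_trans nb (s_ge n).
by rewrite !ler_norml => h1 /andP[h2 h3]; apply/andP; split; lra.
Qed.

End symbol.

(** The real version of [fragments], which [weighted_symbol] needs;
    [gain_symbolE] relates the two on the quadrant. *)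
Definition gain_symbol (phi : R -> R) (u : R * R) : R :=
  if (0 < u.1) && (0 < u.2) then fine (fragments lebR frag phi u) else 0.

Section moments.
Variables (phi : R -> R) (C : R).
Hypotheses (nphi : nonneg phi) (C0 : 0 <= C) (phiC : forall x, phi x <= C * weight x).

Let g x : R := phi x * weight x `^ (-1).

Let gE x : g x * weight x = phi x.
Proof.
rewrite /g powR_inv1 ?weight_ge0// divfK// gt_eqF//.
exact: lt_le_trans ltr01 (weight_ge1 x).
Qed.

Let tg : test C g.
Proof.
split=> [|x].
  exact: (measurable_funM nphi.1 (measurableT_comp (measurable_powR (-1)) (@nonneg_weight R).1)).
rewrite mulr_ge0 ?nphi.2 ?powR_ge0//= /g powR_inv1 ?weight_ge0//.
by rewrite ler_pdivrMr// (lt_le_trans ltr01 (weight_ge1 x)).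
Qed.

Let momE (w : R -> \bar R) : mom phi w = (\int[lebR]_x ((g x)%:E * weighted w x))%E.
Proof. by apply: eq_integral => x _; rewrite /weighted muleA -EFinM gE. Qed.

Lemma mom_limit_fin t : I t -> mom phi (F t) \is a fin_num.
Proof. by move=> It; rewrite momE (pairingE (density_wF t) (wF_bound It) tg). Qed.

Lemma mom_path_fin n j : mom phi (path n j) \is a fin_num.
Proof.
have nw : nonneg (fun x => C * weight x).
  by apply: nonneg_funM; [exact: nonneg_cst|exact: nonneg_weight].
apply: (mom_fin (dpath n j) nphi nw phiC).
rewrite (momZ (dpath n j) C0 (@nonneg_weight R)).
have C0' : (0 <= C%:E)%E by rewrite lee_fin.
apply: le_lt_trans (lee_wpmul2l C0' (adm_weight (adm n j))) _.
by rewrite -EFinM ltry.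
Qed.

Lemma mom_cvg t : I t ->
  fine (mom phi (approx (s n) t)) @[n --> \oo] --> fine (mom phi (F t)).
Proof.
move=> It.
rewrite (momE (F t)) (_ : (fun n => _) = (fun n => pairing lebR (wapprox (s n) t) g)).
  exact: (pairing_wF_cvg It tg).
by apply/funext => n; rewrite momE.
Qed.

End moments.

Section bounded_test.
Variables (phi : R -> R) (C : R).
Hypotheses (nphi : nonneg phi) (phiC : forall x, phi x <= C).

Let C0 : 0 <= C. Proof. exact: le_trans (nphi.2 0) (phiC 0). Qed.

Lemma test_fst : test2 C (fun u => phi u.1).
Proof.
split=> [|u]; last by rewrite nphi.2 phiC.
exact: (measurableT_comp nphi.1 (@measurable_fst _ _ mR mR)).
Qed.

Lemma gain_symbolE x y : 0 < x -> 0 < y ->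
  fragments lebR frag phi (x, y) = (gain_symbol phi (x, y))%:E.
Proof.
move=> x0 y0; rewrite /gain_symbol /= x0 y0 fineK// ge0_fin_numE.
  by apply: le_lt_trans (fragments_le_number law C0 nphi phiC x0 y0) _; exact: ltry.
exact: (density_fragments lebR (frag_measurable law) (frag_ge0 law) nphi).2.
Qed.

Lemma test_gain_symbol : test2 (C * beta0) (gain_symbol phi).
Proof.
have df := density_fragments lebR (frag_measurable law) (frag_ge0 law) nphi.
have b0 : 0 <= beta0 by exact: le_trans beta02.
split=> [|[x y]]; last first.
  have [x0|x0] := boolP (0 < x); last by rewrite /gain_symbol /= (negbTE x0) lexx mulr_ge0.
  have [y0|y0] := boolP (0 < y); last first.
    by rewrite /gain_symbol /= (negbTE y0) andbF lexx mulr_ge0.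
  rewrite -!lee_fin -gain_symbolE// (fragments_le_number law C0 nphi phiC x0 y0) andbT.
  exact: df.2.
have mp : @measurable _ mR `]0, +oo[%classic by exact: measurable_itv.
have m1 : @measurable_fun _ _ (mR * mR)%type R setT (fun u => \1_`]0, +oo[ u.1).
  exact: (measurableT_comp (measurable_indic mp) (@measurable_fst _ _ mR mR)).
have m2 : @measurable_fun _ _ (mR * mR)%type R setT (fun u => \1_`]0, +oo[ u.2).
  exact: (measurableT_comp (measurable_indic mp) (@measurable_snd _ _ mR mR)).
rewrite (_ : gain_symbol phi = (fun u => \1_`]0, +oo[ u.1 * \1_`]0, +oo[ u.2 *
    fine (fragments lebR frag phi u))).
  exact: (measurable_funM (measurable_funM m1 m2) (measurableT_comp (fine_measurable measurableT) df.1)).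
apply/funext => -[x y]; rewrite /gain_symbol /= !indicE !mem_setE !in_itv /= !andbT.
by case: (0 < x)%R; case: (0 < y)%R; rewrite ?mulr1 ?mul1r ?mul0r ?mulr0 ?mul0r.
Qed.

Lemma collisions_gain (k : R * R -> R) (w : R -> \bar R) : (forall x, ~ 0 < x -> w x = 0%E) ->
  collisions lebR k (fragments lebR frag phi) w =
  collisions lebR k (fun u => (gain_symbol phi u)%:E) w.
Proof.
move=> w0; apply: eq_integral => x _; apply: eq_integral => y _.
have [x0|/w0->] := pselect (0 < x); last by rewrite mul0e !mule0.
have [y0|/w0->] := pselect (0 < y); last by rewrite !mule0.
by rewrite gain_symbolE.
Qed.

Let phiCw x : phi x <= C * weight x.
Proof. apply: le_trans (phiC x) _; apply: ler_peMr => //; exact: weight_ge1. Qed.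

Let mfin n j := mom_path_fin nphi C0 phiCw n j.

(** The identities [breaks] are summed over the steps. For [n] larger than the
    bound on the number of particles no step is skipped. *)
Lemma discrete_equation t n k : I t -> Y t <= n.+1%:R -> (k <= steps n t)%N ->
  fine (mom phi (path n k)) +
    hstep n * \sum_(j < k) rate_at (fun u => phi u.1) n j =
  fine (mom phi f0) + hstep n * \sum_(j < k) rate_at (gain_symbol phi) n j.
Proof.
move=> It Yn kst; have t0 : 0 <= t by case: It.
have h0 := time_step_gt0 n : 0 < hstep n.
apply: (telescope_steps (m := fun k => fine (mom phi (path n k)))) => j jk.
have jt : hstep n * j%:R <= t.
  apply: le_trans (steps_le n t0); apply: ler_wpM2l; first exact: ltW.
  by rewrite ler_nat (leq_trans (ltnW jk)).
have [h' [_ h'E bw]] := step_breaks alpha beta law n (adm n j).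
rewrite h'E in bw; last first.
  have : number frag alpha beta f0 n j <= n.+1%:R by exact: le_trans (numberY It jt) Yn.
  rewrite /number => H; rewrite /time_step mulrC ler_pdivrMr ?exprn_gt0// mul1r expr2.
  exact: ler_wpM2l.
have H := bw _ nphi; rewrite -euler_seqS in H.
rewrite (collisions_gain _ (adm_support (adm n j))) in H.
have b0 : 0 <= beta0 by exact: le_trans beta02.
rewrite (rate_atE C0 test_fst n j) (rate_atE (mulr_ge0 C0 b0) test_gain_symbol n j) in H.
exact: (fine_balance (mfin n j) (mfin n j.+1) H).
Qed.

Theorem limit_equation t : I t ->
  (mom phi (F t) + \int[lebR]_(r in `[0%R, t[) collisions lebR K0 (fun u => (phi u.1)%:E) (F r) =
   mom phi f0 + \int[lebR]_(r in `[0%R, t[) collisions lebR K0 (fragments lebR frag phi) (F r))%E.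
Proof.
move=> It; have t0 : 0 <= t by case: It.
have b0 : 0 <= beta0 by exact: le_trans beta02.
have Cb : 0 <= C * beta0 by rewrite mulr_ge0.
have inI r : `[0, t[%classic r -> I r.
  by rewrite /= in_itv /= => /andP[r0 rt]; exact: I_le It r0 (ltW rt).
have [c1 f1] := integral_rate_cvg C0 test_fst It.
have [c2 f2] := integral_rate_cvg Cb test_gain_symbol It.
have -> : (\int[lebR]_(r in `[0%R, t[) collisions lebR K0 (fun u => (phi u.1)%:E) (F r) =
    \int[lebR]_(r in `[0%R, t[) (limit_rate (fun u => phi u.1) r)%:E)%E.
  by apply: eq_integral => r /set_mem/inI Ir; exact: (limit_rateE C0 test_fst Ir).
have -> : (\int[lebR]_(r in `[0%R, t[) collisions lebR K0 (fragments lebR frag phi) (F r) =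
    \int[lebR]_(r in `[0%R, t[) (limit_rate (gain_symbol phi) r)%:E)%E.
  apply: eq_integral => r /set_mem/inI Ir.
  by rewrite (collisions_gain _ (@F_supp r)); exact: (limit_rateE Cb test_gain_symbol Ir).
have cm := mom_cvg nphi phiCw It.
have finF := mom_limit_fin nphi phiCw It.
have fin0 := mfin 0 0.
apply: (fine_sum_eq finF f1 fin0 f2).
apply: (lim_eventually_eq _ (cvgD cm c1) (cvgD (cvg_cst (fine (mom phi f0))) c2)).
exists (Num.truncn (Y t)) => n Yn; rewrite /= /approx.
apply: (discrete_equation It _ (leqnn _)).
by rewrite (le_trans (ltW (truncnS_gt _)))// ler_nat ltnS (leq_trans Yn).
Qed.

End bounded_test.

Let L t := lipschitz_const beta0 rho (Y t).

Lemma limit_lipschitz r t u phi : I u -> 0 <= r -> r <= t -> t <= u -> nonneg phi ->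
  (forall x, phi x <= 1) ->
  `|fine (mom phi (F t)) - fine (mom phi (F r))| <= L u * (t - r).
Proof.
move=> Iu r0 rt tu np p1'.
have t0 : 0 <= t by exact: le_trans rt.
have It := I_le Iu t0 tu; have Ir := I_le It r0 rt.
have L0 : 0 <= L u.
  have v0 := V0 Iu.
  by rewrite /L /lipschitz_const !mulr_ge0// addr_ge0// (le_trans _ beta02).
have pw x : phi x <= 1 * weight x by rewrite mul1r; exact: le_trans (p1' x) (weight_ge1 x).
have ct := mom_cvg np pw It; have cr := mom_cvg np pw Ir.
apply/ler_addgt0Pr => e e0.
have e4 : 0 < e / 4 by rewrite divr_gt0.
have [N1 H1] := (cvg_realP _ _).1 ct _ e4; have [N2 H2] := (cvg_realP _ _).1 cr _ e4.
pose n := maxn (maxn N1 N2) (Num.truncn (L u / (e / 4))).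
have n1 : (N1 <= n)%N by rewrite !leq_max leqnn.
have n2 : (N2 <= n)%N by rewrite !leq_max leqnn orbT.
have := H1 n n1; have := H2 n n2.
have Lh : L u * hstep (s n) <= e / 4.
  apply: (@le_trans _ _ (L u * (s n).+1%:R^-1)).
    by apply: ler_wpM2l => //; exact: time_step_le.
  rewrite ler_pdivrMr// mulrC -ler_pdivrMr//.
  rewrite (le_trans (ltW (truncnS_gt _)))// ler_nat ltnS.
  by apply: leq_trans (s_ge n); rewrite leq_max leqnn orbT.
have hu : hstep (s n) * (steps (s n) t)%:R <= u by exact: le_trans (steps_le _ t0) tu.
have := @path_lipschitz _ _ _ _ _ _ _ law beta02 alpha0 alpha_beta beta1 _ _ rho0 adm0
  _ _ (numberY Iu) (s n) (steps (s n) r) (steps (s n) t - steps (s n) r) phi.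
have mono := steps_mono (s n) rt.
rewrite subnKC// => /(_ hu (le_trans t0 tu) np p1').
have hst : hstep (s n) * (steps (s n) t - steps (s n) r)%:R <= t - r + hstep (s n).
  rewrite natrB// mulrBr.
  have := steps_le (s n) t0; have := steps_gt (s n) r; rewrite -natr1 mulrDr mulr1.
  by lra.
have := ler_wpM2l L0 hst; rewrite mulrDr -/(L u).
rewrite /approx.
set a := pairing _ _ _; set a' := pairing _ _ _.
rewrite -[fine (mom phi (path (s n) (steps (s n) t)))]/a.
rewrite -[fine (mom phi (path (s n) (steps (s n) r)))]/a'.
set m := fine _; set m' := fine _.
move=> h1 h2; have {h1 h2} : `|a - a'| <= L u * (t - r) + e / 4.
  by apply: le_trans h2 _; apply: le_trans h1 _; rewrite lerD2l.
by rewrite !ler_norml => /andP[? ?] /andP[? ?] /andP[? ?]; apply/andP; split; lra.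
Qed.

Lemma limit_mass t : I t -> mom posp (F t) = rho%:E.
Proof.
move=> It.
have pw x : posp x <= 1 * weight x :> R by rewrite mul1r lerDr.
have c := mom_cvg (@nonneg_posp R) pw It.
rewrite -(fineK (mom_limit_fin (@nonneg_posp R) pw It)); congr EFin.
apply: (lim_eventually_eq _ c (cvg_cst rho)).
by exists 0%N => n _; rewrite (adm_mass (adm _ _)).
Qed.

(** The test function [phi] may grow faster than [weight], so that its moment
    is not continuous along the approximation; its truncations are, and
    monotone convergence removes them. *)
Lemma limit_le_mom t phi : I t -> nonneg phi ->
  (forall z x, 0 < z -> z < x -> phi z * x <= z * phi x) ->
  (mom phi (F t) <= mom phi f0)%E.
Proof.
move=> It np phiE.
pose q (j : nat) x := Num.min (phi x) j%:R.
have nq j : nonneg (q j).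
  split=> [|x]; last by rewrite le_min np.2 ler0n.
  by apply: measurable_minr => //; exact: np.1.
have qC (j : nat) x : q j x <= j%:R * weight x.
  by rewrite ge_min; apply/orP; right; rewrite ler_peMr// weight_ge1.
have bq j : (mom (q j) (F t) <= mom phi f0)%E.
  have c := mom_cvg (nq j) (qC j) It.
  have fq := mom_limit_fin (nq j) (qC j) It.
  have le n : (mom (q j) (approx (s n) t) <= mom phi f0)%E.
    apply: le_trans (euler_le_mom law beta02 alpha0 alpha_beta beta1 rho0 adm0 (s n) (steps (s n) t) np phiE).
    apply: (le_mom (dpath _ _) (adm_support (adm _ _)) (nq j) np) => x _.
    by rewrite ge_min lexx.
  have m0 : (0 <= mom phi f0)%E by exact: (mom_ge0 np (adm_density adm0)).
  have [mfin|minf] := boolP (mom phi f0 \is a fin_num); last first.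
    have /eqP -> : mom phi f0 == +oo%E by rewrite -leye_eq leNgt -ge0_fin_numE.
    exact: leey.
  rewrite -(fineK fq) -(fineK mfin) lee_fin.
  apply: (limr_le_seq c) => n; rewrite -lee_fin (fineK mfin).
  by rewrite fineK; [exact: le|exact: (mom_path_fin (nq j) (ler0n _ j) (qC j))].
pose g (j : nat) x := ((q j x)%:E * F t x)%E.
have dg j : @density _ mR R (g j) by exact: (density_mom (nq j) (density_F t)).
have ndg x : nondecreasing_seq (g ^~ x).
  move=> i j ij; apply: lee_wpmul2r; first by rewrite lee_fin f_ge0.
  by rewrite lee_fin le_min !ge_min lexx /= ler_nat ij orbT.
have lg x : g j x @[j --> \oo] --> ((phi x)%:E * F t x)%E.
  rewrite /g /F -EFinM; under eq_fun do rewrite -EFinM.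
  apply: cvg_EFin; first exact: nearW.
  apply: cvgMl; apply/cvg_realP => e e0; exists (Num.truncn (phi x)).+1 => j jx.
  rewrite /q min_l ?subrr ?normr0 ?(ltW e0)//.
  by rewrite (le_trans (ltW (truncnS_gt _)))// ler_nat.
have := @cvg_monotone_convergence _ mR R lebR setT measurableT g (fun j => (dg j).1)
  (fun j x _ => (dg j).2 x) (fun x _ => ndg x).
have -> : (\int[lebR]_x limn (g ^~ x) = mom phi (F t))%E.
  by apply: eq_integral => x _; exact: (cvg_lim (@ereal_hausdorff R) (lg x)).
move=> cv; rewrite -(cvg_lim (@ereal_hausdorff R) cv).
apply: lime_le; first by apply/cvg_ex; eexists; exact: cv.
by apply: nearW => j; exact: bq.
Qed.

End weak_equation.

(** * Solutions with non-negative test functions *)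

Section solutions.
Context {R : realType}.
Notation mR := (measurableTypeR R).
Notation mom := (moment_of (@lebR R)).
Notation nonneg := (@nonneg_measurable _ mR R).

(** What the limit is shown to satisfy, on the whole line and with non-negative
    quantities only. The equation counts ordered pairs: loss and gain of the
    first particle of each collision, against a non-negative bounded [phi]. *)
Record breakage_solution (frag : R -> R * R -> R) (k : R * R -> R) (T : \bar R)
    (f0 : R -> \bar R) (f : R -> R -> R) : Prop := {
  sol_measurable : @measurable_fun _ _ (mR * mR)%type R setT (fun u => f u.1 u.2);
  sol_ge0 : forall t x, 0 <= f t x;
  sol_support : forall t x, ~ 0 < x -> f t x = 0;
  sol_weight : forall t, time_interval T t -> (mom weight (section_density f t) < +oo)%E;
  sol_lipschitz : forall u, time_interval T u -> exists2 L : R, 0 <= L &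
    forall r t, 0 <= r -> r <= t -> t <= u -> forall phi, nonneg phi ->
    (forall x, phi x <= 1) ->
    `|fine (mom phi (section_density f t)) - fine (mom phi (section_density f r))| <= L * (t - r);
  sol_mass : forall t, time_interval T t -> mom posp (section_density f t) = mom posp f0;
  sol_le_mom : forall t, time_interval T t -> forall phi, nonneg phi ->
    (forall z x, 0 < z -> z < x -> phi z * x <= z * phi x) ->
    (mom phi (section_density f t) <= mom phi f0)%E;
  sol_collisions : forall t, time_interval T t ->
    (\int[lebR]_(r in `[0%R, t[) collisions lebR k (fun=> 1%E) (section_density f r) < +oo)%E;
  sol_equation : forall t, time_interval T t -> forall phi C, nonneg phi ->
    (forall x, phi x <= C) ->
    (mom phi (section_density f t) +
     \int[lebR]_(r in `[0%R, t[) collisions lebR k (fun u => (phi u.1)%:E) (section_density f r) =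
     mom phi f0 +
     \int[lebR]_(r in `[0%R, t[) collisions lebR k (fragments lebR frag phi) (section_density f r))%E }.

Theorem solution_exists (frag : R -> R * R -> R) (beta0 p B alpha beta : R)
    (f0 : R -> \bar R) (rho : R) (T : \bar R) (Y : R -> R) :
  fragmentation_law frag beta0 p B -> 1 < p -> 2 <= beta0 -> 0 <= B ->
  0 <= alpha -> alpha <= beta -> beta <= 1 -> 0 < rho -> admissible rho f0 ->
  (0 < T)%E ->
  (forall t, time_interval T t -> forall n k, @time_step R n * k%:R <= t ->
    number frag alpha beta f0 n k <= Y t) ->
  exists f, breakage_solution frag (kernel2 alpha beta) T f0 f.
Proof.
move=> law p1 beta02 B0 alpha0 ab beta1 rho0 adm0 T0 numberY.
have [s [s_ge [f [mf f_ge0 f_supp lim]]]] :=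
  limit_exists law p1 beta02 B0 alpha0 ab beta1 rho0 adm0 T0 numberY.
have f_bound t (It : time_interval T t) := (lim t It).1.
have f_lim t (It : time_interval T t) := (lim t It).2.
have V0 t (It : time_interval T t) : 0 <= Y t + rho.
  exact: (bound_ge0 law beta02 alpha0 ab beta1 rho0 adm0 numberY It).
exists f; split.
- exact: mf.
- exact: f_ge0.
- exact: f_supp.
- by move=> t It; apply: le_lt_trans (f_bound t It) _; exact: ltry.
- move=> u Iu; exists (lipschitz_const beta0 rho (Y u)).
    by rewrite /lipschitz_const !mulr_ge0// ?V0// addr_ge0// (le_trans _ beta02).
  move=> r t r0 rt tu phi np p1'.
  exact: (limit_lipschitz law p1 beta02 B0 alpha0 ab beta1 rho0 adm0 numberY
    s_ge mf f_ge0 f_bound f_lim Iu r0 rt tu np p1').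
- move=> t It; rewrite (adm_mass adm0).
  exact: (limit_mass law p1 beta02 B0 alpha0 ab beta1 rho0 adm0 numberY mf f_ge0 f_bound f_lim It).
- move=> t It phi np phiE.
  exact: (limit_le_mom law p1 beta02 B0 alpha0 ab beta1 rho0 adm0 numberY mf f_ge0 f_bound f_lim It np phiE).
- move=> t It.
  have t1 := @test_fun_cst _ (mR * mR)%type R 1 ler01.
  have [_ fin] := integral_rate_cvg law p1 beta02 B0 alpha0 ab beta1 rho0 adm0 numberY
    s_ge mf f_ge0 f_bound f_lim ler01 t1 It.
  apply: (@le_lt_trans _ _ (\int[lebR]_(r in `[0%R, t[) (limit_rate alpha beta f (cst 1) r)%:E)%E); last first.
    by move: fin; rewrite fin_numElt => /andP[].
  rewrite le_eqVlt; apply/orP; left; apply/eqP; apply: eq_integral => r /set_mem.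
  rewrite /= in_itv /= => /andP[r0 rt].
  have Ir : time_interval T r by split=> //; apply: lt_trans It.2; rewrite lte_fin.
  exact: (limit_rateE alpha0 ab beta1 mf f_ge0 f_supp f_bound ler01 t1 Ir).
- move=> t It phi C np pC.
  exact: (limit_equation law p1 beta02 B0 alpha0 ab beta1 rho0 adm0 numberY s_ge mf f_ge0 f_supp f_bound f_lim np pC It).
Qed.

End solutions.

(** * Regularity in time *)

Section functions_on_the_half_line.
Context {R : realType}.
Notation mR := (measurableTypeR R).
Notation mom := (moment_of (@lebR R)).
Notation nonneg := (@nonneg_measurable _ mR R).
Implicit Types (g h : R -> R).

Lemma posP (x : R) : pos x <-> 0 < x.
Proof. by rewrite /pos /= in_itv /= andbT. Qed.

Lemma measurable_pos : @measurable _ mR (pos : set R).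
Proof. exact: measurable_itv. Qed.

Lemma integral_pos (G : R -> \bar R) : (forall x, ~ 0 < x -> G x = 0%E) ->
  (\int[leb]_(x in pos) G x = \int[lebR]_x G x)%E.
Proof.
move=> G0; rewrite integral_mkcond; apply: eq_integral => x _.
rewrite patchE; case: ifPn => // /negP; rewrite in_setE posP => x0.
by rewrite G0.
Qed.

Lemma moment_mom m h : (forall x, ~ 0 < x -> h x = 0) ->
  moment m h = mom (fun x => (x `^ m)%R) (fun x => (h x)%:E).
Proof.
move=> h0; rewrite /moment integral_pos; last by move=> x /h0->; rewrite mulr0.
by apply: eq_integral => x _; rewrite EFinM.
Qed.

Lemma normX_mom m h : (forall x, ~ 0 < x -> h x = 0) ->
  normX m h = mom (fun x => (x `^ m)%R) (fun x => `|h x|%:E).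
Proof.
move=> h0; rewrite /normX integral_pos; last by move=> x /h0->; rewrite normr0 mulr0.
by apply: eq_integral => x _; rewrite EFinM.
Qed.

Lemma in_X_mom m h : @measurable_fun _ _ mR R setT h -> (forall x, ~ 0 < x -> h x = 0) ->
  (mom (fun x => (x `^ m)%R) (fun x => `|h x|%:E) < +oo)%E -> in_X m h.
Proof.
move=> mh h0 fin; apply/integrableP; split.
  apply/measurable_EFinP; apply: measurable_funTS; exact: measurable_funM.
apply: le_lt_trans fin; rewrite le_eqVlt; apply/orP; left; apply/eqP.
rewrite integral_pos; last by move=> x /h0->; rewrite mulr0 abse0.
by apply: eq_integral => x _; rewrite /= normrM (ger0_norm (powR_ge0 _ _)) EFinM.
Qed.

Lemma powR_superlinear (m z x : R) : 1 <= m -> 0 < z -> z < x -> z `^ m * x <= z * x `^ m.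
Proof.
move=> m1 z0 zx; have x0 := lt_trans z0 zx.
have E y : 0 < y -> y `^ m = y * y `^ (m - 1).
  move=> y0; rewrite -{2}(powRr1 (ltW y0)) powR_mul//; congr (_ `^ _); ring.
rewrite (E z z0) (E x x0) -mulrA; apply: ler_wpM2l; first exact: ltW.
rewrite mulrC; apply: ler_wpM2l; first exact: ltW.
by apply: ge0_ler_powR; rewrite ?nnegrE ?subr_ge0 ?(ltW z0) ?(ltW x0) ?(ltW zx).
Qed.

Lemma powR_tail_superlinear (m M z x : R) : 1 <= m -> 0 < z -> z < x ->
  z `^ m * \1_`]M, +oo[ z * x <= z * (x `^ m * \1_`]M, +oo[ x).
Proof.
move=> m1 z0 zx; rewrite !indicE.
have [zM|zM] := boolP (z \in `]M, +oo[%classic).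
  have -> : x \in `]M, +oo[%classic.
    by move: zM; rewrite !inE /= !in_itv /= !andbT => /lt_trans; apply.
  by rewrite !mulr1; exact: powR_superlinear.
by rewrite mulr0 mul0r mulr_ge0 ?(ltW z0)// mulr_ge0// powR_ge0.
Qed.

Lemma time_interval_later (T : \bar R) t : time_interval T t ->
  exists2 u, t < u & time_interval T u.
Proof.
case=> t0; case: T => [T1| |] //.
  rewrite lte_fin => tT; exists ((t + T1) / 2); first by lra.
  by split; [lra|rewrite lte_fin; lra].
by move=> _; exists (t + 1); [rewrite ltrDl|split; [rewrite addr_ge0|exact: ltry]].
Qed.

End functions_on_the_half_line.

Section regularity.
Context {R : realType}.
Notation mR := (measurableTypeR R).
Notation mom := (moment_of (@lebR R)).
Notation nonneg := (@nonneg_measurable _ mR R).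
Variables (frag : R -> R * R -> R) (k : R * R -> R) (T : \bar R) (f0 : R -> \bar R)
  (f : R -> R -> R).
Hypothesis sol : breakage_solution frag k T f0 f.
Hypothesis df0 : @density _ mR R f0.
Local Notation F := (section_density f).
Local Notation I := (time_interval T).

Let f_ge0 := sol_ge0 sol.

Lemma sol_section t : @measurable_fun _ _ mR R setT (f t).
Proof. exact: (measurableT_comp (sol_measurable sol) (@pair1_measurable _ _ mR mR t)). Qed.

Lemma sol_density t : @density _ mR R (F t).
Proof. by apply: density_EFin; [exact: sol_section|exact: f_ge0]. Qed.

Let time_le r t : I t -> 0 <= r -> r <= t -> I r.
Proof. by move=> [_ tT] r0 rt; split=> //; apply: le_lt_trans tT; rewrite lee_fin. Qed.

Lemma sol_mom_fin t phi : I t -> nonneg phi -> (forall x, phi x <= 1) ->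
  mom phi (F t) \is a fin_num.
Proof.
move=> It np p1; apply: (mom_fin (sol_density t) np (@nonneg_weight R)).
  by move=> x; exact: le_trans (p1 x) (weight_ge1 x).
exact: (sol_weight sol It).
Qed.

Definition L1_dist (r t : R) : \bar R := mom (fun=> 1) (fun x => `|f t x - f r x|%:E).

(** The [L^1] distance is attained by testing with the indicators of the sets
    where the difference is non-negative and negative. *)
Lemma sol_L1_lipschitz u : I u -> exists2 L, 0 <= L &
  forall r t, 0 <= r -> r <= t -> t <= u -> (L1_dist r t <= (L * (t - r))%:E)%E.
Proof.
move=> Iu; have [L L0 HL] := sol_lipschitz sol Iu.
exists (2 * L); first by rewrite mulr_ge0.
move=> r t r0 rt tu.
have t0 : 0 <= t by exact: le_trans rt.
have It := time_le Iu t0 tu; have Ir := time_le It r0 rt.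
pose E := [set x | f r x <= f t x].
have mE : @measurable _ mR E.
  rewrite (_ : E = (fun x => f t x - f r x) @^-1` `[0, +oo[%classic).
    have md := measurable_funB (sol_section t) (sol_section r).
    by have := md measurableT _ (measurable_itv `[0, +oo[); rewrite setTI.
  by apply/seteqP; split=> x /=; rewrite in_itv /= andbT subr_ge0.
have nE := nonneg_indic mE; have nC := nonneg_indic (measurableC mE).
have i1 (D : set R) (x : R) : \1_D x <= 1 :> R by rewrite indicE; case: (_ \in _).
have A1 := HL r t r0 rt tu _ nE (i1 E).
have A2 := HL r t r0 rt tu _ nC (i1 (~` E)).
have a1 := sol_mom_fin It nE (i1 E); have a2 := sol_mom_fin Ir nE (i1 E).
have a3 := sol_mom_fin It nC (i1 (~` E)); have a4 := sol_mom_fin Ir nC (i1 (~` E)).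
have dabs : @density _ mR R (fun x => `|f t x - f r x|%:E).
  apply: density_EFin => //.
  exact: (measurableT_comp (@normr_measurable R setT) (measurable_funB (sol_section t) (sol_section r))).
have n1 := nonneg_cst (@ler01 R).
have d1 := density_mom n1 dabs.
have dEt := density_mom nE (sol_density t); have dEr := density_mom nE (sol_density r).
have dCt := density_mom nC (sol_density t); have dCr := density_mom nC (sol_density r).
have B : (L1_dist r t + (mom \1_E (F r) + mom \1_(~` E) (F t)) =
    mom \1_E (F t) + mom \1_(~` E) (F r))%E.
  rewrite /L1_dist /moment_of.
  rewrite -(int_densityD lebR dEr dCt) -(int_densityD lebR dEt dCr).
  rewrite -(int_densityD lebR d1 (densityD dEr dCt)); apply: eq_integral => x _.
  rewrite /section_density -!EFinM -!EFinD mul1r; congr EFin.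
  rewrite !indicE in_setC; have [xE|xE] := boolP (x \in E); rewrite /= ?mul1r ?mul0r ?addr0 ?add0r.
    by have /set_mem/= xle := xE; rewrite ger0_norm ?subr_ge0// subrK.
  have /negP := xE; rewrite in_setE /E /= => /negP; rewrite -ltNge => xlt.
  by rewrite ltr0_norm ?subr_lt0// opprB subrK.
have D0 : (0 <= L1_dist r t)%E by exact: (mom_ge0 n1 dabs).
move: B A1 A2 D0 a1 a2 a3 a4; case: (L1_dist r t) => [d| |] //;
  case: (mom \1_E (F r)) => [x1| |] //; case: (mom \1_(~` E) (F t)) => [x2| |] //;
  case: (mom \1_E (F t)) => [x3| |] //; case: (mom \1_(~` E) (F r)) => [x4| |] //=.
move=> [B] A1 A2 _ _ _ _ _; rewrite lee_fin.
by move: A1 A2; rewrite !ler_norml => /andP[? ?] /andP[? ?]; lra.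
Qed.

Lemma normX0_dist r t : normX 0 (fun x => f t x - f r x) = L1_dist r t.
Proof.
rewrite normX_mom; last by move=> x x0; rewrite !(sol_support sol)// subrr.
by apply: eq_integral => x _; rewrite powRr0.
Qed.

Lemma sol_in_X m t : I t ->
  (mom (fun x => (x `^ m)%R) f0 < +oo)%E -> 1 <= m -> in_X m (f t).
Proof.
move=> It fin m1; apply: (in_X_mom (sol_section t) (sol_support sol t)).
apply: le_lt_trans fin.
apply: le_trans (sol_le_mom sol It (nonneg_powR m) _).
  by rewrite le_eqVlt; apply/orP; left; apply/eqP; apply: eq_integral => x _; rewrite ger0_norm.
by move=> z x z0 zx; exact: powR_superlinear.
Qed.

(** Below [M] the norm of [X_m] is controlled by that of [L^1]; the tails above
    [M] have superlinear moments, which are bounded by those of the initial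
    datum. *)
Lemma sol_X_dist_small m u : 1 <= m -> (mom (fun x => (x `^ m)%R) f0 < +oo)%E -> I u ->
  forall e, 0 < e -> exists2 d, 0 < d & forall r t, 0 <= r -> r <= t -> t <= u ->
  t - r <= d -> (normX m (fun x => f t x - f r x)%R <= e%:E)%E.
Proof.
move=> m1 fin Iu e e0; have [L L0 HL] := sol_L1_lipschitz Iu.
have e4 : 0 < e / 4 by rewrite divr_gt0.
have [M M1 HM] := small_tail df0 (nonneg_powR m) fin e4.
pose c := M `^ m; have c0 : 0 <= c by exact: powR_ge0.
pose d := e / (2 * (c + 1) * (L + 1)).
have c1 : 0 < c + 1 by rewrite ltr_wpDl.
have L1 : 0 < L + 1 by rewrite ltr_wpDl.
have d0 : 0 < d by rewrite divr_gt0// !mulr_gt0.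
exists d => // r t r0 rt tu trd.
have t0 : 0 <= t by exact: le_trans rt.
have It := time_le Iu t0 tu; have Ir := time_le It r0 rt.
have nt : nonneg (fun x => x `^ m * \1_`]M, +oo[ x) by exact: nonneg_tail_powR.
have tail w (Iw : I w) : (mom (fun x => (x `^ m * \1_`]M, +oo[ x)%R) (F w) <= (e / 4)%:E)%E.
  apply: le_trans (sol_le_mom sol Iw nt _) HM => z x z0 zx.
  exact: powR_tail_superlinear.
have dt := density_mom nt (sol_density t); have dr := density_mom nt (sol_density r).
have dabs : @density _ mR R (fun x => `|f t x - f r x|%:E).
  apply: density_EFin => //.
  exact: (measurableT_comp (@normr_measurable R setT) (measurable_funB (sol_section t) (sol_section r))).
have nc := nonneg_cst c0.
have dc := density_mom nc dabs.
have dm := density_mom (nonneg_powR m) dabs.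
rewrite normX_mom; last by move=> x x0; rewrite !(sol_support sol)// subrr.
apply: (@le_trans _ _ (\int[lebR]_x (c%:E * (`|f t x - f r x|%R)%:E +
    ((x `^ m * \1_`]M, +oo[ x)%R%:E * F t x + (x `^ m * \1_`]M, +oo[ x)%R%:E * F r x))))%E.
  apply: (@le_int_density _ mR R lebR _ _ dm (densityD dc (densityD dt dr))) => x.
  rewrite /section_density -!EFinM -!EFinD lee_fin.
  have fr := f_ge0 r x; have ft := f_ge0 t x; have xm := powR_ge0 x m.
  have ab : `|f t x - f r x| <= f t x + f r x by apply: le_trans (ler_normB _ _) _; rewrite !ger0_norm.
  rewrite indicE; have [xM|xM] := boolP (x \in `]M, +oo[%classic).
    rewrite mulr1 -mulrDr; apply: ler_wpDl; first by rewrite mulr_ge0.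
    exact: ler_wpM2l.
  rewrite mulr0 !mul0r addr0 addr0.
  have [x0|x0] := ltrP 0 x; last first.
    by rewrite !(sol_support sol) ?subrr ?normr0 ?mulr0// => /(le_lt_trans x0); rewrite ltxx.
  apply: ler_wpM2r => //; apply: ge0_ler_powR; rewrite ?nnegrE ?(ltW x0)//.
  - exact: le_trans m1.
  - exact: le_trans M1.
  - move: xM; rewrite notin_setE /= in_itv /= andbT => /negP; by rewrite -leNgt.
rewrite (int_densityD lebR dc (densityD dt dr)) (int_densityD lebR dt dr).
have HL1 : (\int[lebR]_x (c%:E * (`|f t x - f r x|%R)%:E) <= (c * (L * (t - r)))%:E)%E.
  rewrite (int_densityZ lebR c0 dabs) EFinM.
  apply: lee_wpmul2l; first by rewrite lee_fin.
  have := HL r t r0 rt tu; rewrite /L1_dist mom1; exact.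
apply: (le_trans (leeD HL1 (leeD (tail t It) (tail r Ir)))).
rewrite -!EFinD lee_fin.
have : c * (L * (t - r)) <= (c + 1) * ((L + 1) * d).
  apply: ler_pM => //; first by rewrite mulr_ge0// subr_ge0.
    by rewrite lerDl.
  by apply: ler_pM => //; rewrite ?subr_ge0// lerDl.
have -> : (c + 1) * ((L + 1) * d) = e / 2 by rewrite /d; field; rewrite !gt_eqF.
lra.
Qed.

Let normX_sym m r t :
  normX m (fun x => f t x - f r x) = normX m (fun x => f r x - f t x).
Proof. by rewrite /normX; apply: eq_integral => x _; rewrite distrC. Qed.

Lemma sol_in_X0 t : I t -> in_X 0 (f t).
Proof.
move=> It; apply: (in_X_mom (sol_section t) (sol_support sol t)).
apply: le_lt_trans (sol_weight sol It).
apply: (@le_int_density _ mR R lebR) => [||x].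
- apply: (density_mom (nonneg_powR 0)); apply: density_EFin => //.
  exact: (measurableT_comp (@normr_measurable R setT) (sol_section t)).
- exact: (density_mom (@nonneg_weight R) (sol_density t)).
rewrite powRr0 ger0_norm//; apply: lee_wpmul2r; first by rewrite lee_fin.
by rewrite lee_fin weight_ge1.
Qed.

Let in_X0_diff r t : I r -> I t -> in_X 0 (fun x => f t x - f r x).
Proof.
move=> Ir It.
apply: in_X_mom; [exact: (measurable_funB (sol_section t) (sol_section r))| |].
  by move=> x x0; rewrite !(sol_support sol)// subrr.
rewrite -normX_mom; last by move=> x x0; rewrite !(sol_support sol)// subrr.
have r0 : 0 <= r by case: Ir.
have t0 : 0 <= t by case: It.
have [rt|/ltW tr] := lerP r t.
  have [L L0 HL] := sol_L1_lipschitz It.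
  by rewrite normX0_dist; apply: le_lt_trans (HL r t r0 rt (lexx t)) (ltry _).
have [L L0 HL] := sol_L1_lipschitz Ir.
by rewrite normX_sym normX0_dist; apply: le_lt_trans (HL t r t0 tr (lexx r)) (ltry _).
Qed.

(** A continuous linear form is Lipschitz for the norm of [X_0], and so is the
    solution in time. *)
Lemma sol_weakly_continuous : weakly_continuous 0 T f.
Proof.
split=> [t It|l [lin [C HC]]]; first exact: sol_in_X0.
apply/subspace_continuousP => t It.
have [u tu Iu] := time_interval_later It; have [L L0 HL] := sol_L1_lipschitz Iu.
apply/cvgrPdist_le => e e0.
pose d := Num.min (u - t) (e / (`|C| * L + 1)).
have CL0 : 0 < `|C| * L + 1 by rewrite ltr_wpDl// mulr_ge0.
have d0 : 0 < d by rewrite lt_min subr_gt0 tu divr_gt0.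
rewrite /prop_near1 /=; apply/nbhs_ballP; exists d => // r /=; rewrite /ball /= => trd Ir.
have lE : l (f t) - l (f r) = l (fun x => f t x - f r x).
  have := lin (-1) (f r) (f t) (sol_in_X0 Ir) (sol_in_X0 It).
  rewrite (_ : (fun x => -1 * f r x + f t x) = (fun x => f t x - f r x)).
    by move=> ->; ring.
  by apply/funext => x; ring.
rewrite lE -lee_fin; apply: le_trans (HC _ (in_X0_diff Ir It)) _.
pose a : R := `|t - r|; have a0 : 0 <= a by exact: normr_ge0.
have D : (normX 0 (fun x => f t x - f r x)%R <= (L * a)%:E)%E.
  have r0 : 0 <= r by case: Ir.
  have t0 : 0 <= t by case: It.
  have ru : r <= u.
    move: trd; rewrite /d lt_min => /andP[+ _]; rewrite ltr_norml => /andP[? _]; lra.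
  have [rt|/ltW tr] := lerP r t.
    have E : a = t - r by rewrite /a ger0_norm// subr_ge0.
    by rewrite normX0_dist E; apply: (HL r t r0 rt); exact: ltW.
  have E : a = r - t by rewrite /a distrC ger0_norm// subr_ge0.
  by rewrite normX_sym normX0_dist E; exact: (HL t r t0 tr ru).
have nX0 : (0 <= normX 0 (fun x => f t x - f r x)%R)%E.
  by apply: integral_ge0 => x _; rewrite lee_fin mulr_ge0// powR_ge0.
apply: (@le_trans _ _ (`|C|%:E * normX 0 (fun x => f t x - f r x)%R)%E).
  by apply: lee_wpmul2r => //; rewrite lee_fin ler_norm.
have C0 : (0 <= `|C|%:E)%E by rewrite lee_fin.
apply: le_trans (lee_wpmul2l C0 D) _; rewrite -EFinM lee_fin mulrA.
apply: (@le_trans _ _ ((`|C| * L + 1) * a)).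
  by apply: (ler_wpM2r a0); rewrite lerDl.
rewrite -ler_pdivlMl// mulrC; apply: ltW; apply: lt_le_trans trd _.
by rewrite ge_min lexx orbT.
Qed.

Lemma cvge0_seq (a : nat -> \bar R) : (forall n, 0 <= a n)%E ->
  (forall e, 0 < e -> exists N, forall n, (N <= n)%N -> (a n <= e%:E)%E) ->
  a n @[n --> \oo] --> 0%E.
Proof.
move=> a0 H; apply/fine_cvgP; split.
  have [N HN] := H 1 ltr01; exists N => // n /HN an.
  by rewrite ge0_fin_numE//; exact: le_lt_trans an (ltry _).
apply/cvg_realP => e e0; have [N HN] := H e e0; exists N => n /HN an.
rewrite subr0 ger0_norm ?fine_ge0//=.
by rewrite -lee_fin fineK// ge0_fin_numE//; exact: le_lt_trans an (ltry _).
Qed.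

(** The solution is locally uniformly continuous in time with values in [X_m],
    so that its restrictions to time grids converge to it. With [(n + 1) ^ 3]
    cells of length [(n + 1) ^ -2] the grid reaches time [n + 1]. *)
Lemma sol_strongly_measurable m T' : 1 <= m -> (mom (fun x => (x `^ m)%R) f0 < +oo)%E ->
  (T' <= T)%E -> strongly_measurable_X m T' f.
Proof.
move=> m1 fin TT.
pose c (n i : nat) : R := time_step n * i%:R.
pose h (n i : nat) : R -> R := if pselect (I (c n i)) then f (c n i) else fun=> 0.
have hX n i : in_X m (h n i).
  rewrite /h; case: pselect => Ii; first exact: sol_in_X.
  rewrite /in_X; under eq_fun do rewrite mulr0; exact: integrable0.
pose N (n : nat) := (n.+1 ^ 3)%N.
pose A (n i : nat) : set R := [set t | steps n t = i].
exists (fun n t x => \sum_(i < N n) \1_(A n i) t * h n i x); split.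
  move=> n; exists (N n), (fun i => A n i), (fun i => h n i); split=> //.
  by move=> i; exact: measurable_steps.
apply: aeW => t [t0 tT'].
have It : I t by split; [exact: ltW|exact: lt_le_trans TT].
apply: cvge0_seq => [n|e e0].
  by apply: integral_ge0 => x _; rewrite lee_fin mulr_ge0// powR_ge0.
have [d d0 Hd] := sol_X_dist_small m1 fin It e0.
exists (maxn (Num.truncn t) (Num.truncn d^-1)) => n; rewrite geq_max => /andP[nt nd].
have t0' := ltW t0.
have rt : c n (steps n t) <= t by exact: steps_le.
have h0 := time_step_gt0 n : 0 < @time_step R n.
have r0 : 0 <= c n (steps n t) by rewrite mulr_ge0// ltW.
have Ir := time_le It r0 rt.
have sN : (steps n t < N n)%N.
  rewrite -(ltr_nat R) -(ltr_pM2l h0); apply: le_lt_trans rt _.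
  apply: (@lt_le_trans _ _ n.+1%:R).
    by apply: lt_le_trans (truncnS_gt _) _; rewrite ler_nat.
  rewrite /N natrX /time_step (exprSr _ 2) mulrA mulVf ?mul1r//.
have sE x : \sum_(i < N n) \1_(A n i) t * h n i x = f (c n (steps n t)) x.
  rewrite (bigD1 (Ordinal sN))//= big1 ?addr0; last first.
    move=> i /eqP ni; rewrite indicE memNset ?mul0r// => /= si.
    by apply: ni; apply/val_inj.
  rewrite indicE mem_set//= mul1r /h; case: pselect => [Ij|nIj]; [exact: erefl|by case: (nIj Ir)].
rewrite (_ : (fun x => _) = (fun x => f (c n (steps n t)) x - f t x)); last first.
  by apply/funext => x; rewrite sE.
rewrite -normX_sym; apply: Hd => //.
have := steps_gt n t; rewrite -natr1 mulrDr mulr1 -/(c n _) => tc.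
have : @time_step R n <= d.
  apply: le_trans (time_step_le n) _; rewrite invf_ple ?posrE//.
  by rewrite (le_trans (ltW (truncnS_gt _)))// ler_nat.
lra.
Qed.

Lemma sol_in_Linfty_X m T' : 1 <= m -> (mom (fun x => (x `^ m)%R) f0 < +oo)%E ->
  (T' <= T)%E -> in_Linfty_X m T' f.
Proof.
move=> m1 fin TT.
have It t : open_time_interval T' t -> I t.
  by move=> [t0 tT']; split; [exact: ltW|exact: lt_le_trans TT].
split; first by apply: aeW => t /It It'; exact: sol_in_X.
  exact: sol_strongly_measurable.
exists (fine (mom (fun x => (x `^ m)%R) f0)); apply: aeW => t /It It'.
have m0 := mom_ge0 (nonneg_powR m) df0.
rewrite fineK ?ge0_fin_numE// (normX_mom _ (sol_support sol t)).
apply: le_trans (sol_le_mom sol It' (nonneg_powR m) _); last first.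
  by move=> z x z0 zx; exact: powR_superlinear.
rewrite le_eqVlt; apply/orP; left; apply/eqP.
by apply: eq_integral => x _; rewrite ger0_norm.
Qed.

End regularity.

(** * Triple integrals *)

Section sigma_finite_product.
Context d1 d2 (T1 : measurableType d1) (T2 : measurableType d2) (R : realType)
  (m1 : {sigma_finite_measure set T1 -> \bar R}) (m2 : {sigma_finite_measure set T2 -> \bar R}).

(** The product measure again, under a name that carries the structure of a
    sigma-finite measure, so that it can be a factor of another product. *)
Definition sigma_finite_prod : set (T1 * T2) -> \bar R := (m1 \x m2)%E.

HB.instance Definition _ := Measure.copy sigma_finite_prod
  ((m1 \x m2)%E : {measure set (T1 * T2)%type -> \bar R}).

Let sigma_finite_prodT : sigma_finite setT sigma_finite_prod.
Proof.
have /sigma_finiteP[F [TF ndF Foo]] := sigma_finiteT m1.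
have /sigma_finiteP[G [TG ndG Goo]] := sigma_finiteT m2.
exists (fun n => F n `*` G n).
  rewrite -setXTT TF TG predeqE => -[x y]; split.
    move=> [/= [n _ Fnx] [k _ Gky]]; exists (maxn n k) => //; split.
    - by move: x Fnx; exact/subsetPset/ndF/leq_maxl.
    - by move: y Gky; exact/subsetPset/ndG/leq_maxr.
  by move=> [n _ []/= ? ?]; split; exists n.
move=> k; have [mF Fk] := Foo k; have [mG Gk] := Goo k.
split; first exact: measurableX.
by rewrite /sigma_finite_prod product_measure1E// lte_mul_pinfty// ge0_fin_numE.
Qed.

HB.instance Definition _ := Measure_isSigmaFinite.Build _ _ _ sigma_finite_prod sigma_finite_prodT.

End sigma_finite_product.

Section triple_integrals.
Context d1 d2 d3 (T1 : measurableType d1) (T2 : measurableType d2) (T3 : measurableType d3)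
  (R : realType) (m1 : {sigma_finite_measure set T1 -> \bar R})
  (m2 : {sigma_finite_measure set T2 -> \bar R}) (m3 : {sigma_finite_measure set T3 -> \bar R}).

Lemma tonelli3 (G : T1 * (T2 * T3) -> \bar R) : density G ->
  (\int[m1 \x (m2 \x m3)]_u G u = \int[m1]_r \int[m2]_x \int[m3]_y G (r, (x, y)))%E.
Proof.
move=> dG.
have H := @fubini_tonelli1 _ _ T1 (T2 * T3)%type R m1
  (sigma_finite_prod m2 m3) G dG.1 dG.2.
apply: (eq_trans H); apply: eq_integral => r _.
have dr : density (fun u => G (r, u)).
  split=> [|u]; last exact: dG.2.
  exact: (measurableT_comp dG.1 (@pair1_measurable _ _ T1 (T2 * T3)%type r)).
exact: (fubini_tonelli1 _ dr.1 dr.2).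
Qed.

Lemma integrable_prod3 (D : set (T1 * (T2 * T3))) (g : T1 * (T2 * T3) -> R) :
  measurable D -> density (fun u => (g u)%:E) ->
  (\int[m1]_r \int[m2]_x \int[m3]_y (g (r, (x, y)) * \1_D (r, (x, y)))%:E < +oo)%E ->
  (m1 \x (m2 \x m3))%E.-integrable D (fun u => (g u)%:E).
Proof.
move=> mD dg fin; apply/integrableP; split.
  by apply: measurable_funTS; exact: dg.1.
apply: le_lt_trans fin.
have dG : density (fun u => (g u * \1_D u)%:E).
  apply: density_EFin => [|u].
    by apply: measurable_funM; [apply/measurable_EFinP; exact: dg.1|exact: measurable_indic].
  by rewrite mulr_ge0 ?indicE ?ler0n//; have := dg.2 u; rewrite lee_fin.
have E := @integral_mkcond _ (T1 * (T2 * T3))%type R (m1 \x sigma_finite_prod m2 m3)%E D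
  (fun u => `|(g u)%:E|)%E.
rewrite -(tonelli3 dG) le_eqVlt; apply/orP; left; apply/eqP; apply: (eq_trans E).
apply: eq_integral => u _; rewrite patchE indicE; case: ifPn => _.
  by rewrite mulr1 gee0_abs//; exact: dg.2.
by rewrite mulr0.
Qed.

End triple_integrals.

(** * Signed collision integrals *)

Section signed_collisions.
Context {R : realType}.
Notation mR := (measurableTypeR R).
Notation mom := (moment_of (@lebR R)).
Notation nonneg := (@nonneg_measurable _ mR R).
Notation nonneg2 := (@nonneg_measurable _ (mR * mR)%type R).
Notation test2 := (@test_fun _ (mR * mR)%type R).

Lemma integral_sub (D : set R) (P Q : R -> \bar R) : @measurable _ mR D ->
  @density _ mR R P -> @density _ mR R Q ->
  (\int[lebR]_(x in D) P x < +oo)%E -> (\int[lebR]_(x in D) Q x < +oo)%E ->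
  (\int[lebR]_(x in D) (P x - Q x) = \int[lebR]_(x in D) P x - \int[lebR]_(x in D) Q x)%E.
Proof.
move=> mD dP dQ fP fQ.
have int (S : R -> \bar R) : @density _ mR R S -> (\int[lebR]_(x in D) S x < +oo)%E ->
    (lebR : {measure set mR -> \bar R}).-integrable D S.
  move=> dS fS; apply/integrableP; split; first exact: (measurable_funTS dS.1).
  apply: le_lt_trans fS; rewrite le_eqVlt; apply/orP; left; apply/eqP.
  by apply: eq_integral => x _; rewrite gee0_abs//; exact: dS.2.
exact: (@integralB _ mR R lebR D mD P Q (int P dP fP) (int Q dQ fQ)).
Qed.

Lemma integral_open (t : R) (G : R -> \bar R) : @measurable_fun _ _ mR _ setT G ->
  (\int[leb]_(r in `]0%R, t[) G r = \int[lebR]_(r in `[0%R, t[) G r)%E.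
Proof.
by move=> mG; exact: (@integral_itv_obnd_cbnd R 0 (BLeft t) G (measurable_funTS mG)).
Qed.

Variables (frag : R -> R * R -> R) (k : R * R -> R) (T : \bar R) (f0 : R -> \bar R)
  (f : R -> R -> R).
Hypotheses (mk : @measurable_fun _ _ (mR * mR)%type R setT k) (k0 : forall u, 0 <= k u)
  (k2 : forall x y, 0 < x -> 0 < y -> k (x, y) <= 2 * (weight x * weight y))
  (ks : forall x y, k (x, y) = k (y, x)).
Hypothesis sol : breakage_solution frag k T f0 f.
Local Notation F := (section_density f).
Local Notation I := (time_interval T).
Local Notation coll Th r := (collisions lebR k (fun u => (Th u)%:E) (F r)).

Let dF t : @density _ mR R (F t). Proof. exact: sol_density sol t. Qed.
Let F0 t x : ~ 0 < x -> F t x = 0%E.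
Proof. by move=> x0; rewrite /section_density (sol_support sol). Qed.

Let dTh Th : nonneg2 Th -> @density _ (mR * mR)%type R (fun u => (Th u)%:E).
Proof. by move=> [mT T0]; exact: density_EFin. Qed.

Lemma density_collision_rate Th : nonneg2 Th -> @density _ mR R (fun r => coll Th r).
Proof.
move=> nT; have dT := dTh nT.
have dk : @density _ (mR * mR)%type R (fun u => (k u)%:E) by exact: density_EFin.
have df : @density _ (mR * mR)%type R (fun u => (f u.1 u.2)%:E).
  by apply: density_EFin; [exact: sol_measurable sol|move=> u; exact: sol_ge0 sol _ _].
have p1 : @measurable_fun _ _ ((mR * mR) * mR)%type (mR * mR)%type setT (fun q => (q.1.2, q.2)).
  apply: measurable_fun_pair => /=; last exact: measurable_snd.
  by apply: (measurableT_comp (@measurable_snd _ _ mR mR)); exact: measurable_fst.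
have p2 : @measurable_fun _ _ ((mR * mR) * mR)%type (mR * mR)%type setT (fun q => (q.1.1, q.2)).
  apply: measurable_fun_pair => /=; last exact: measurable_snd.
  by apply: (measurableT_comp (@measurable_fst _ _ mR mR)); exact: measurable_fst.
have p3 : @measurable_fun _ _ ((mR * mR) * mR)%type (mR * mR)%type setT (fun q => q.1).
  exact: measurable_fst.
have comp (h : R * R -> \bar R) (g : (mR * mR) * mR -> R * R) :
    @density _ (mR * mR)%type R h ->
    @measurable_fun _ _ ((mR * mR) * mR)%type (mR * mR)%type setT g ->
    @density _ ((mR * mR) * mR)%type R (fun q => h (g q)).
  by move=> [mh h0] mg; split=> [|q]; [exact: (measurableT_comp mh mg)|exact: h0].
have d3 := densityM (comp _ _ dT p1) (densityM (comp _ _ dk p1) (densityM (comp _ _ df p3) (comp _ _ df p2))).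
exact: (density_int2 lebR (density_int2 lebR d3)).
Qed.

(** Finiteness at each of the three nested integrals, which is what the
    subtraction of two collision integrals requires, one integral at a time. *)
Record finite_symbol (Th : R * R -> R) : Prop := {
  symbol_nonneg : nonneg2 Th;
  symbol_inner : forall r x, I r ->
    (\int[lebR]_y ((Th (x, y))%:E * ((k (x, y))%:E * (F r x * F r y))) < +oo)%E;
  symbol_rate : forall r, I r -> (coll Th r < +oo)%E;
  symbol_total : forall t, I t -> (\int[lebR]_(r in `[0%R, t[) coll Th r < +oo)%E }.

Let inI r t : I t -> `[0, t[%classic r -> I r.
Proof.
move=> [_ tT]; rewrite /= in_itv /= => /andP[r0 rt]; split=> //.
by apply: lt_trans tT; rewrite lte_fin.
Qed.

Let dinner Th r x : nonneg2 Th ->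
  @density _ mR R (fun y => (Th (x, y))%:E * ((k (x, y))%:E * (F r x * F r y)))%E.
Proof.
move=> nT; have [m p] := density_collisions mk k0 (dTh nT) (dF r).
split=> [|y]; last exact: p (x, y).
exact: (measurableT_comp m (@pair1_measurable _ _ mR mR x)).
Qed.

Let dslice Th r : nonneg2 Th ->
  @density _ mR R (fun x => \int[lebR]_y ((Th (x, y))%:E * ((k (x, y))%:E * (F r x * F r y))))%E.
Proof. by move=> nT; exact: (density_int2 lebR (density_collisions mk k0 (dTh nT) (dF r))). Qed.

Lemma signed_collisions Th1 Th2 t : finite_symbol Th1 -> finite_symbol Th2 -> I t ->
  (\int[leb]_(r in `]0%R, t[) \int[lebR]_x \int[lebR]_y
      ((Th1 (x, y) - Th2 (x, y)) * k (x, y) * f r x * f r y)%:E =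
   \int[lebR]_(r in `[0%R, t[) coll Th1 r - \int[lebR]_(r in `[0%R, t[) coll Th2 r)%E.
Proof.
move=> g1 g2 It; have n1 := symbol_nonneg g1; have n2 := symbol_nonneg g2.
have d1 := density_collision_rate n1; have d2 := density_collision_rate n2.
have mI : @measurable _ mR `[0, t[%classic by exact: measurable_itv.
rewrite -(integral_sub mI d1 d2 (symbol_total g1 It) (symbol_total g2 It)).
rewrite -integral_open; last exact: (emeasurable_funB d1.1 d2.1).
apply: eq_integral => r /set_mem rt.
have Ir : I r by apply: (inI It); move: rt; rewrite /= !in_itv /= => /andP[/ltW-> ->].
transitivity (\int[lebR]_x
  (\int[lebR]_y ((Th1 (x, y))%:E * ((k (x, y))%:E * (F r x * F r y))) -
   \int[lebR]_y ((Th2 (x, y))%:E * ((k (x, y))%:E * (F r x * F r y)))))%E; last first.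
  exact: (integral_sub measurableT (dslice r n1) (dslice r n2) (symbol_rate g1 Ir) (symbol_rate g2 Ir)).
apply: eq_integral => x _.
rewrite -(integral_sub measurableT (dinner r x n1) (dinner r x n2) (symbol_inner g1 x Ir) (symbol_inner g2 x Ir)).
apply: eq_integral => y _; rewrite /section_density -!EFinM -EFinB; congr EFin; ring.
Qed.

Lemma finite_symbolD Th1 Th2 : finite_symbol Th1 -> finite_symbol Th2 ->
  finite_symbol (fun u => Th1 u + Th2 u) /\
  forall t, I t -> (\int[lebR]_(r in `[0%R, t[) coll (fun u => (Th1 u + Th2 u)%R) r =
    \int[lebR]_(r in `[0%R, t[) coll Th1 r + \int[lebR]_(r in `[0%R, t[) coll Th2 r)%E.
Proof.
move=> g1 g2; have n1 := symbol_nonneg g1; have n2 := symbol_nonneg g2.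
have n12 : nonneg2 (fun u => Th1 u + Th2 u).
  by split=> [|u]; [exact: (measurable_funD n1.1 n2.1)|rewrite addr_ge0 ?n1.2 ?n2.2].
have cE r : coll (fun u => (Th1 u + Th2 u)%R) r = (coll Th1 r + coll Th2 r)%E.
  exact: (collisionsD lebR mk k0 (dTh n1) (dTh n2) (dF r)).
have d1 := density_collision_rate n1; have d2 := density_collision_rate n2.
have tot t : I t -> (\int[lebR]_(r in `[0%R, t[) coll (fun u => (Th1 u + Th2 u)%R) r =
    \int[lebR]_(r in `[0%R, t[) coll Th1 r + \int[lebR]_(r in `[0%R, t[) coll Th2 r)%E.
  move=> It; transitivity (\int[lebR]_(r in `[0%R, t[) (coll Th1 r + coll Th2 r))%E.
    by apply: eq_integral => r _; exact: cE.
  apply: (@ge0_integralD _ mR R lebR) => //; try exact: measurable_itv.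
  - by move=> r _; exact: d1.2.
  - exact: (measurable_funTS d1.1).
  - by move=> r _; exact: d2.2.
  - exact: (measurable_funTS d2.1).
split; last exact: tot.
split=> //.
- move=> r x Ir.
  have -> : (\int[lebR]_y ((Th1 (x, y) + Th2 (x, y))%R%:E * ((k (x, y))%:E * (F r x * F r y))) =
     \int[lebR]_y ((Th1 (x, y))%:E * ((k (x, y))%:E * (F r x * F r y))) +
     \int[lebR]_y ((Th2 (x, y))%:E * ((k (x, y))%:E * (F r x * F r y))))%E.
    rewrite -(int_densityD lebR (dinner r x n1) (dinner r x n2)); apply: eq_integral => y _.
    by rewrite /section_density -!EFinM -EFinD; congr EFin; ring.
  by apply: lte_add_pinfty; [exact: (symbol_inner g1 x Ir)|exact: (symbol_inner g2 x Ir)].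
- by move=> r Ir; rewrite cE; apply: lte_add_pinfty; [exact: symbol_rate g1 r Ir|exact: symbol_rate g2 r Ir].
- by move=> t It; rewrite tot//; apply: lte_add_pinfty; [exact: symbol_total g1 t It|exact: symbol_total g2 t It].
Qed.

(** The inner integral is finite because the kernel is at most linear in [y],
    the others by [sol_weight] and [sol_collisions]. *)
Lemma finite_symbol_bounded Th M : 0 <= M -> test2 M Th -> finite_symbol Th.
Proof.
move=> M0 tT; have nT : nonneg2 Th.
  by split=> [|u]; [exact: tT.1|have /andP[] := tT.2 u].
have n1 : nonneg2 (fun=> 1) by split=> [|u] //.
have d1 := density_collision_rate n1.
have wfin r : I r -> (mom weight (F r) <= (fine (mom weight (F r)))%:E)%E.
  move=> Ir; rewrite fineK// ge0_fin_numE; first exact: sol_weight sol r Ir.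
  exact: (mom_ge0 (@nonneg_weight R) (dF r)).
split=> //.
- move=> r x Ir.
  have [x0|x0] := pselect (0 < x); last first.
    rewrite integral0_eq ?ltry// => y _; rewrite (F0 r x0) mul0e !mule0//.
  have wx : 0 <= M * (2 * weight x) * f r x.
    by rewrite mulr_ge0 ?(sol_ge0 sol)// !mulr_ge0// weight_ge0.
  have dW := density_mom (@nonneg_weight R) (dF r).
  have wx' : (0 <= (M * (2 * weight x) * f r x)%:E)%E by rewrite lee_fin.
  apply: (@le_lt_trans _ _ ((M * (2 * weight x) * f r x)%:E * mom weight (F r))%E).
    rewrite /moment_of -(int_densityZ lebR wx dW).
    have dW' := densityM (density_cste wx') dW.
    apply: (@le_int_density _ mR R lebR _ _ (dinner r x nT) dW') => y.
    have [y0|y0] := pselect (0 < y); last by rewrite (F0 r y0) !mule0.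
    rewrite /section_density -!EFinM lee_fin.
    have fx := sol_ge0 sol r x; have fy := sol_ge0 sol r y.
    have /andP[t0 tM] := tT.2 (x, y).
    have H := ler_pM t0 (k0 (x, y)) tM (k2 x0 y0).
    have H2 := ler_wpM2r (mulr_ge0 fx fy) H.
    by move: H2; lra.
  apply: le_lt_trans (lee_wpmul2l wx' (wfin r Ir)) _.
  by rewrite -EFinM ltry.
- move=> r Ir.
  by rewrite (collisions_pairing mk k0 k2 M0 tT (dF r) (@F0 r) (wfin r Ir)) ltry.
- move=> t It; have c1 := sol_collisions sol It.
  have d1' : @density _ mR R (fun r => M%:E * coll (fun=> 1%R) r)%E.
    by apply: densityM d1; apply: density_cste; rewrite lee_fin.
  apply: (@le_lt_trans _ _ (\int[lebR]_(r in `[0%R, t[) (M%:E * coll (fun=> 1%R) r))%E).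
    apply: (@ge0_le_integral _ mR R lebR) => //; try exact: measurable_itv.
    - by move=> r _; exact: (density_collision_rate nT).2.
    - exact: (measurable_funTS (density_collision_rate nT).1).
    - exact: (measurable_funTS d1'.1).
    move=> r _; rewrite -(collisionsZ lebR mk k0 M0 (dTh n1) (dF r)).
    apply: (le_collisions lebR mk k0 (dTh nT) _ (dF r)).
      by apply: densityM (dTh n1); split=> // u; rewrite lee_fin.
    by move=> x y _ _; rewrite mule1 lee_fin; have /andP[] := tT.2 (x, y).
  rewrite (@ge0_integralZl_EFin _ mR R lebR)//; last 2 first.
  - by move=> r _; exact: d1.2.
  - exact: (measurable_funTS d1.1).
  by apply: lte_mul_pinfty; [rewrite lee_fin|by []|exact: c1].
Qed.

Lemma finite_symbol_swap Th : finite_symbol Th -> nonneg2 (fun u => Th (u.2, u.1)) ->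
  forall t, (\int[lebR]_(r in `[0%R, t[) coll (fun u => Th (u.2, u.1)) r =
    \int[lebR]_(r in `[0%R, t[) coll Th r)%E.
Proof.
move=> g ns t; apply: eq_integral => r _.
exact: (collisions_swap lebR mk k0 ks (dTh (symbol_nonneg g)) (dF r)).
Qed.

(** A function that vanishes almost everywhere may be unbounded, so that it is
    not covered by the bounded symbols; its collision integrals are zero
    because densities do not charge null sets. *)
Lemma null_symbol e : nonneg e -> {ae leb, forall x : R, e x = 0} ->
  finite_symbol (fun u => e u.1 + e u.2) /\
  forall t, I t -> (\int[lebR]_(r in `[0%R, t[) coll (fun u => (e u.1 + e u.2)%R) r = 0)%E.
Proof.
move=> ne e0.
have n1 : nonneg2 (fun u => e u.1).
  by split=> [|u]; [exact: (measurableT_comp ne.1 (@measurable_fst _ _ mR mR))|exact: ne.2].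
have n2 : nonneg2 (fun u => e u.2).
  by split=> [|u]; [exact: (measurableT_comp ne.1 (@measurable_snd _ _ mR mR))|exact: ne.2].
have null (P : R -> \bar R) : @density _ mR R P -> (\int[lebR]_x ((e x)%:E * P x) = 0)%E.
  move=> dP; have dm := density_mom ne dP.
  transitivity (\int[lebR]_x (cst 0%E x : \bar R))%E; last exact: integral0.
  apply: (@ae_eq_integral _ mR R lebR setT (cst 0%E)) => //; first exact: dm.1.
  by apply: ae_mono e0 => x ex _; rewrite /= ex mul0e.
have c1 r : coll (fun u => e u.1) r = 0%E.
  rewrite (collisions_fst lebR mk k0 ne (dF r)); apply: null.
  by apply: densityM (dF r); exact: (density_rate lebR mk k0 (dF r)).
have c2 r : coll (fun u => e u.2) r = 0%E.
  by rewrite -(c1 r) -(collisions_swap lebR mk k0 ks (dTh n1) (dF r)).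
have int0 t (G : R -> \bar R) : (forall r, G r = 0%E) ->
    (\int[lebR]_(r in `[0%R, t[) G r = 0)%E.
  by move=> G0; apply: integral0_eq => r _; exact: G0.
have g2 : finite_symbol (fun u => e u.2).
  split=> //; last 2 first.
  - by move=> r _; rewrite c2 ltry.
  - by move=> t _; rewrite (int0 t _ c2) ltry.
  move=> r x Ir; rewrite (_ : (\int[lebR]_y _)%E = 0%E)//.
  rewrite /=; apply: null.
  have [m p] := density_pair mk k0 (dF r); split=> [|y]; last exact: p (x, y).
  exact: (measurableT_comp m (@pair1_measurable _ _ mR mR x)).
have g1 : finite_symbol (fun u => e u.1).
  split=> //; last 2 first.
  - by move=> r _; rewrite c1 ltry.
  - by move=> t _; rewrite (int0 t _ c1) ltry.
  move=> r x Ir.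
  have t1 := @test_fun_cst _ (mR * mR)%type R 1 ler01.
  have b1 := finite_symbol_bounded ler01 t1.
  have := symbol_inner b1 x Ir; have di := dinner r x (symbol_nonneg b1).
  have -> : (\int[lebR]_y ((e (x, y).1)%:E * ((k (x, y))%:E * (F r x * F r y))) =
      (e x)%:E * \int[lebR]_y ((cst 1%R (x, y))%:E * ((k (x, y))%:E * (F r x * F r y))))%E.
    rewrite -(int_densityZ lebR (ne.2 x) di); apply: eq_integral => y _.
    by rewrite mul1e.
  by move=> fin; apply: lte_mul_pinfty; [rewrite lee_fin; exact: ne.2|by []|exact: fin].
have [g12 tot] := finite_symbolD g1 g2.
split; first exact: g12.
by move=> t It; rewrite (tot t It) (int0 t _ c1) (int0 t _ c2) adde0.
Qed.

End signed_collisions.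

(** * The weak formula *)

(** The bookkeeping of the two equations: [a] and [c] are the positive and
    negative parts of the test function, [A] and [C] their moments at the two
    times, [J] the collision integrals of their loss symbols and [Jg] those of
    their gain symbols. The doubled terms come from symmetrization and the
    zeros from null functions. *)
Lemma balance_of_equations (R : realType) (At A0 Ct C0 Jga Ja Jgc Jc : \bar R) :
  At \is a fin_num -> A0 \is a fin_num -> Ct \is a fin_num -> C0 \is a fin_num ->
  Jga \is a fin_num -> Ja \is a fin_num -> Jgc \is a fin_num -> Jc \is a fin_num ->
  (At + Ja = A0 + Jga)%E -> (Ct + Jc = C0 + Jgc)%E ->
  ((At + C0) - (Ct + A0) =
   2^-1%:E * (((Jga + Jga) + (Jc + Jc) + 0) - ((Jgc + Jgc) + (Ja + Ja) + 0)))%E.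
Proof.
do 8! move=> /fineK <-.
rewrite -!EFinD => -[e1] [e2]; rewrite -?EFinM; congr EFin; lra.
Qed.

Section weak_formula.
Context {R : realType}.
Notation mR := (measurableTypeR R).
Notation mom := (moment_of (@lebR R)).
Notation nonneg := (@nonneg_measurable _ mR R).
Notation nonneg2 := (@nonneg_measurable _ (mR * mR)%type R).
Notation test2 := (@test_fun _ (mR * mR)%type R).
Variables (frag : R -> R * R -> R) (beta0 p B : R).
Hypotheses (law : fragmentation_law frag beta0 p B) (beta02 : 2 <= beta0).
Variables (k : R * R -> R) (T : \bar R) (h0 : R -> R) (f : R -> R -> R).
Hypotheses (mk : @measurable_fun _ _ (mR * mR)%type R setT k) (k0 : forall u, 0 <= k u)
  (k2 : forall x y, 0 < x -> 0 < y -> k (x, y) <= 2 * (weight x * weight y))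
  (ks : forall x y, k (x, y) = k (y, x)).
Hypotheses (nh : nonneg h0) (hsupp : forall x, ~ 0 < x -> h0 x = 0)
  (hnum : (mom (fun=> 1%R) (fun x => (h0 x)%:E) < +oo)%E).
Hypothesis sol : breakage_solution frag k T (fun x => (h0 x)%:E) f.
Local Notation F := (section_density f).
Local Notation I := (time_interval T).
Local Notation coll Th r := (collisions lebR k (fun u => (Th u)%:E) (F r)).
Variable b : R -> R -> R -> R.
Hypothesis bE : forall z x y, 0 < z -> 0 < x -> 0 < y -> b z x y = frag z (x, y) + frag z (y, x).

Lemma collision_integrable t : I t ->
  (leb \x (leb \x leb))%E.-integrable (`]0%R, t[ `*` (pos `*` pos))
    (fun u : R * (R * R) => (k (u.2.1, u.2.2) * f u.1 u.2.1 * f u.1 u.2.2)%:E).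
Proof.
move=> It.
apply: (@integrable_prod3 _ _ _ mR mR mR R lebR lebR lebR
  (`]0, t[ `*` (pos `*` pos)) (fun u => k (u.2.1, u.2.2) * f u.1 u.2.1 * f u.1 u.2.2)).
- apply: measurableX; first exact: measurable_itv.
  by apply: measurableX; exact: measurable_itv.
- apply: density_EFin => [|u]; last by rewrite !mulr_ge0 ?k0 ?(sol_ge0 sol).
  have p1 : @measurable_fun _ _ (mR * (mR * mR))%type (mR * mR)%type setT (fun q => (q.1, q.2.1)).
    apply: measurable_fun_pair => /=; first exact: measurable_fst.
    by apply: (measurableT_comp (@measurable_fst _ _ mR mR)); exact: measurable_snd.
  have p2 : @measurable_fun _ _ (mR * (mR * mR))%type (mR * mR)%type setT (fun q => (q.1, q.2.2)).
    apply: measurable_fun_pair => /=; first exact: measurable_fst.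
    by apply: (measurableT_comp (@measurable_snd _ _ mR mR)); exact: measurable_snd.
  have p3 : @measurable_fun _ _ (mR * (mR * mR))%type (mR * mR)%type setT (fun q => (q.2.1, q.2.2)).
    apply: measurable_fun_pair => /=.
      by apply: (measurableT_comp (@measurable_fst _ _ mR mR)); exact: measurable_snd.
    by apply: (measurableT_comp (@measurable_snd _ _ mR mR)); exact: measurable_snd.
  exact: (measurable_funM (measurable_funM (measurableT_comp mk p3)
    (measurableT_comp (sol_measurable sol) p1)) (measurableT_comp (sol_measurable sol) p2)).
have n1 : nonneg2 (fun=> 1) by split=> [|u] //.
have d1 := density_collision_rate mk k0 sol n1.
apply: le_lt_trans (sol_collisions sol It).
have mI : @measurable _ mR `]0, t[%classic by exact: measurable_itv.
have <- := integral_open t d1.1.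
rewrite [leRHS]integral_mkcond le_eqVlt; apply/orP; left; apply/eqP.
apply: eq_integral => r _; rewrite patchE.
case: ifPn => [rt|rt]; last first.
  rewrite integral0_eq// => x _; rewrite integral0_eq// => y _.
  by rewrite indicE memNset ?mulr0// => -[/= rt' _]; move/negP: rt; apply; rewrite inE.
apply: eq_integral => x _; apply: eq_integral => y _.
rewrite mul1e /section_density -!EFinM; congr EFin => /=.
have [x0|x0] := pselect (0 < x); last by rewrite (sol_support sol)// !(mulr0, mul0r).
have [y0|y0] := pselect (0 < y); last by rewrite ((sol_support sol) r y)// !(mulr0, mul0r).
rewrite indicE mem_set ?mulr1 ?mulrA//; split; first exact: set_mem rt.
by split; apply/posP.
Qed.

Section bounded_test_function.
Variables (phi : R -> R) (C : R).
Hypotheses (mphi : measurable_fun pos phi)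
  (phiC : {ae leb, forall x : R, pos x -> `|phi x| <= C}) (C0 : 0 <= C).

Definition zero_ext (x : R) : R := (phi \_ pos) x.
(** A bounded function equal almost everywhere to the extension by 0; an
    essentially bounded [phi] is only bounded off a null set, while the
    equation for solutions asks for bounds everywhere. *)
Definition cut (x : R) : R := zero_ext x * \1_[set x | `|zero_ext x| <= C] x.

Definition pos_part (g : R -> R) (x : R) : R := Num.max (g x) 0.
Definition neg_part (g : R -> R) (x : R) : R := Num.max (- g x) 0.

Let a := pos_part cut.
Let c := neg_part cut.
Let e x := zero_ext x - cut x.

Let mext : @measurable_fun _ _ mR R setT zero_ext.
Proof. exact: (measurable_restrictT phi (@measurable_pos R)).1 mphi. Qed.

Let mcut : @measurable_fun _ _ mR R setT cut.
Proof.
apply: measurable_funM => //; apply: measurable_indic.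
rewrite (_ : [set x | _] = (fun x => `|zero_ext x|) @^-1` `]-oo, C]%classic).
  have mn := measurableT_comp (@normr_measurable R setT) mext.
  by have := mn measurableT _ (measurable_itv `]-oo, C]); rewrite setTI.
by apply/seteqP; split=> x /=; rewrite in_itv.
Qed.

Let me : @measurable_fun _ _ mR R setT e.
Proof. exact: (measurable_funB mext mcut). Qed.

Let n_pos g : @measurable_fun _ _ mR R setT g -> nonneg (pos_part g).
Proof.
move=> mg; split=> [|x]; last by rewrite le_max lexx orbT.
by apply: measurable_maxr => //; exact: mg.
Qed.

Let n_neg g : @measurable_fun _ _ mR R setT g -> nonneg (neg_part g).
Proof.
move=> mg; split=> [|x]; last by rewrite le_max lexx orbT.
by apply: measurable_maxr => //; apply: (measurableT_comp (@oppr_measurable R setT)).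
Qed.

Let partsE g x : g x = pos_part g x - neg_part g x.
Proof.
rewrite /pos_part /neg_part; have [g0|g0] := lerP (g x) 0.
  have ng : 0 <= - g x by rewrite oppr_ge0.
  by rewrite (max_l ng) sub0r opprK.
have ng : - g x <= 0 by rewrite oppr_le0 ltW.
by rewrite (max_r ng) subr0.
Qed.

Let cutC x : `|cut x| <= C.
Proof.
rewrite /cut indicE; have [/set_mem|_] := boolP (x \in _); rewrite ?mulr1 ?mulr0 ?normr0 //.
Qed.

Let aC x : a x <= C.
Proof. by rewrite ge_max C0 andbT; apply: le_trans (cutC x); exact: ler_norm. Qed.
Let cC x : c x <= C.
Proof. by rewrite ge_max C0 andbT; apply: le_trans (cutC x); rewrite -normrN; exact: ler_norm. Qed.

Let e0 : {ae leb, forall x : R, e x = 0}.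
Proof.
apply: ae_mono phiC => x px; rewrite /e /cut /zero_ext patchE.
case: ifPn => [/set_mem xp|_]; last by rewrite mul0r subrr.
rewrite indicE mem_set ?mulr1 ?subrr//= patchE mem_set//; exact: px.
Qed.

Let na : nonneg a := n_pos mcut.
Let nc : nonneg c := n_neg mcut.
Let ep := pos_part e.
Let en := neg_part e.

Local Notation ga := (gain_symbol frag a).
Local Notation gc := (gain_symbol frag c).

Let mfrag u : @measurable_fun _ _ mR R setT (frag ^~ u).
Proof. exact: (measurableT_comp (frag_measurable law) (@pair2_measurable _ _ mR (mR * mR)%type u)). Qed.

Let dfrag g u : nonneg g -> @density _ mR R (fun z => (g z)%:E * (frag z u)%:E)%E.
Proof.
move=> ng; apply: (density_mom ng); apply: density_EFin; [exact: mfrag|].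
by move=> z; exact: frag_ge0 law _ _.
Qed.

(** The integral defining [zeta] is over the fragments of both particles and
    ignores null sets, so [phi] may be replaced by [cut] in it, but not in the
    two terms [phi x] and [phi y]. *)
Lemma zetaE x y : 0 < x -> 0 < y ->
  zeta b phi x y = (ga (x, y) + ga (y, x)) - (gc (x, y) + gc (y, x)) - phi x - phi y.
Proof.
move=> x0 y0; rewrite /zeta; congr (_ - _ - _).
have xy0 : 0 < x + y by rewrite addr_gt0.
pose m z := frag z (x, y) + frag z (y, x).
have mm : @measurable_fun _ _ mR R setT m by exact: (measurable_funD (mfrag (x, y)) (mfrag (y, x))).
have mD : @measurable _ mR `]0, x + y[%classic by exact: measurable_itv.
have Dpos z : `]0, x + y[%classic z -> 0 < z by rewrite /= in_itv /= => /andP[].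
have m_out z : ~ `]0, x + y[%classic z -> m z = 0.
  rewrite /= in_itv /= => /negP zD; rewrite /m !(frag_support law) ?addr0//=.
    by apply/negP => /andP[z0 zy]; move: zD; rewrite z0 (lt_trans zy)// ltrDr.
  by apply/negP => /andP[z0 zy]; move: zD; rewrite z0 (lt_trans zy)// ltrDl.
have E1 : (\int[leb]_(z in `]0%R, (x + y)%R[) (phi z * b z x y)%:E =
    \int[lebR]_(z in `]0%R, (x + y)%R[) (zero_ext z * m z)%:E)%E.
  apply: eq_integral => z /set_mem/Dpos z0.
  by rewrite /zero_ext patchE mem_set ?bE//; apply/posP.
have E2 : (\int[lebR]_(z in `]0%R, (x + y)%R[) (zero_ext z * m z)%:E =
    \int[lebR]_(z in `]0%R, (x + y)%R[) (cut z * m z)%:E)%E.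
  apply: (@ae_eq_integral _ mR R lebR _ (fun z => (cut z * m z)%:E)) => //.
  - by apply/measurable_EFinP; apply: measurable_funTS; exact: measurable_funM.
  - by apply/measurable_EFinP; apply: measurable_funTS; exact: measurable_funM.
  apply: ae_mono e0 => z ez _; congr (_ * _)%:E.
  by apply/eqP; rewrite -subr_eq0; apply/eqP.
have E3 : (\int[lebR]_(z in `]0%R, (x + y)%R[) (cut z * m z)%:E =
    \int[lebR]_z (cut z * m z)%:E)%E.
  rewrite integral_mkcond; apply: eq_integral => z _; rewrite patchE.
  by case: ifPn => // /negP zD; rewrite m_out ?mulr0// => H; apply: zD; rewrite inE.
have fE g : nonneg g -> (forall z, g z <= C) ->
    (\int[lebR]_z ((g z)%:E * (frag z (x, y))%:E + (g z)%:E * (frag z (y, x))%:E) =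
     (gain_symbol frag g (x, y) + gain_symbol frag g (y, x))%:E)%E.
  move=> ng gC; rewrite (int_densityD lebR (dfrag (x, y) ng) (dfrag (y, x) ng)) EFinD.
  by rewrite -(gain_symbolE law ng gC x0 y0) -(gain_symbolE law ng gC y0 x0).
have da := densityD (dfrag (x, y) na) (dfrag (y, x) na).
have dc := densityD (dfrag (x, y) nc) (dfrag (y, x) nc).
have E4 : (\int[lebR]_z (cut z * m z)%:E =
    (ga (x, y) + ga (y, x))%:E - (gc (x, y) + gc (y, x))%:E)%E.
  rewrite -(fE a na aC) -(fE c nc cC).
  rewrite -(integral_sub measurableT da dc); first last.
  - by rewrite (fE c nc cC) ltry.
  - by rewrite (fE a na aC) ltry.
  apply: eq_integral => z _; rewrite -!EFinM -!EFinD; congr EFin.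
  by rewrite (partsE cut z) -/(a z) -/(c z) /m; ring.
by rewrite /Rintegral (eq_trans E1 (eq_trans E2 (eq_trans E3 E4))).
Qed.

Let J Th t : \bar R := (\int[lebR]_(r in `[0%R, t[) coll Th r)%E.

(** Symmetrization doubles the collision integral, the kernel being symmetric;
    this is where the factor one half of the weak formula comes from. *)
Let symmetric_symbol Th M : 0 <= M -> test2 M Th ->
  finite_symbol k T f (fun u => Th u + Th (u.2, u.1)) /\
  forall t, I t -> J (fun u => Th u + Th (u.2, u.1)) t = (J Th t + J Th t)%E.
Proof.
move=> M0 tT; have g := finite_symbol_bounded mk k0 k2 sol M0 tT.
have ts : test2 M (fun u => Th (u.2, u.1)).
  split=> [|u]; last exact: tT.2.
  have ms : @measurable_fun _ _ (mR * mR)%type (mR * mR)%type setT (fun u => (u.2, u.1)).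
    by apply: measurable_fun_pair => /=; [exact: measurable_snd|exact: measurable_fst].
  exact: (measurableT_comp tT.1 ms).
have gs := finite_symbol_bounded mk k0 k2 sol M0 ts.
have [g2 tot] := finite_symbolD mk k0 sol g gs.
split; first exact: g2.
move=> t It; apply: (eq_trans (tot t It)).
have E := finite_symbol_swap mk k0 ks sol g (symbol_nonneg gs) t.
exact: (congr1 (fun z => J Th t + z)%E E).
Qed.

Let num_fin g (w : R -> \bar R) : nonneg g -> (forall x, g x <= C) -> @density _ mR R w ->
  (mom (fun=> 1%R) w < +oo)%E -> mom g w \is a fin_num.
Proof.
move=> ng gC dw fin.
have le x : g x <= C * 1 by rewrite mulr1.
have n1 := nonneg_cst (@ler01 R).
have nC : nonneg (fun x : R => C * 1) by apply: nonneg_cst; rewrite mulr1.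
apply: (mom_fin dw ng nC le).
rewrite (momZ dw C0 n1); apply: lte_mul_pinfty; [by rewrite lee_fin|by []|exact: fin].
Qed.

Let mom1F t : I t -> (mom (fun=> 1%R) (F t) < +oo)%E.
Proof.
move=> It; apply: le_lt_trans (sol_weight sol It).
apply: (@le_int_density _ mR R lebR) => [||x].
- exact: (density_mom (nonneg_cst ler01) (sol_density sol t)).
- exact: (density_mom (@nonneg_weight R) (sol_density sol t)).
apply: lee_wpmul2r; first by rewrite lee_fin (sol_ge0 sol).
by rewrite lee_fin weight_ge1.
Qed.

Let dh : @density _ mR R (fun x => (h0 x)%:E).
Proof. exact: (nonneg_density nh). Qed.

Let equation g t : I t -> nonneg g -> (forall x, g x <= C) ->
  (mom g (F t) + J (fun u => g u.1) t =
   mom g (fun x => (h0 x)%:E) + J (gain_symbol frag g) t)%E.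
Proof.
move=> It ng gC.
have E : (\int[lebR]_(r in `[0%R, t[) collisions lebR k (fragments lebR frag g) (F r) =
    J (gain_symbol frag g) t)%E.
  apply: eq_integral => r _; apply: (collisions_gain law ng gC) => x x0.
  by rewrite /section_density (sol_support sol).
exact: (eq_trans (sol_equation sol It ng gC) (congr1 (fun z => mom g (fun x => (h0 x)%:E) + z)%E E)).
Qed.

Let J_fin Th M t : I t -> 0 <= M -> test2 M Th -> J Th t \is a fin_num.
Proof.
move=> It M0 tT; have g := finite_symbol_bounded mk k0 k2 sol M0 tT.
rewrite ge0_fin_numE; first exact: (symbol_total g It).
apply: integral_ge0 => r _; exact: (density_collision_rate mk k0 sol (symbol_nonneg g)).2.
Qed.

(** Both sides are differences of non-negative quantities: the left-hand side
    of moments of [a] and [c], the right-hand side of collision integrals of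
    their symmetrized symbols and of null symbols. The equations for [a] and
    for [c] relate them. *)
Lemma weak_formula (fin : R -> R) t : measurable_fun pos fin ->
  {ae leb, forall x : R, pos x -> fin x = h0 x} -> I t ->
  (\int[leb]_(x in pos) (phi x * (f t x - fin x))%:E =
   2^-1%:E *
   \int[leb]_(s in `]0%R, t[) \int[leb]_(x in pos) \int[leb]_(y in pos)
     (zeta b phi x y * k (x, y) * f s x * f s y)%:E)%E.
Proof.
move=> mfin fae It.
have b0 : 0 <= beta0 by exact: le_trans beta02.
have Cb : 0 <= C * beta0 by rewrite mulr_ge0.
have partsx x : zero_ext x = a x - c x + (ep x - en x).
  by rewrite -(partsE cut x) -(partsE e x) /e; ring.
have extE x : pos x -> zero_ext x = phi x by move=> px; rewrite /zero_ext patchE mem_set.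
have ext0 x : ~ 0 < x -> zero_ext x = 0.
  by move=> x0; rewrite /zero_ext patchE memNset//; apply/posP.
have cut0 x : ~ 0 < x -> cut x = 0 by move=> x0; rewrite /cut ext0// mul0r.
have L : (\int[leb]_(x in pos) (phi x * (f t x - fin x))%:E =
    (mom a (F t) + mom c (fun x => (h0 x)%:E)) - (mom c (F t) + mom a (fun x => (h0 x)%:E)))%E.
  have mft := measurable_funTS (sol_section sol t) : @measurable_fun _ _ mR R pos (f t).
  have mh := measurable_funTS nh.1 : @measurable_fun _ _ mR R pos h0.
  have mc := measurable_funTS mcut : @measurable_fun _ _ mR R pos cut.
  have L1 : (\int[leb]_(x in pos) (phi x * (f t x - fin x))%:E =
      \int[leb]_(x in pos) (cut x * (f t x - h0 x))%:E)%E.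
    apply: (@ae_eq_integral _ mR R lebR pos (fun x => (cut x * (f t x - h0 x))%:E)).
    - exact: measurable_pos.
    - by apply/measurable_EFinP; exact: (measurable_funM mphi (measurable_funB mft mfin)).
    - by apply/measurable_EFinP; exact: (measurable_funM mc (measurable_funB mft mh)).
    apply: ae_mono2 e0 fae => x ex fx px; rewrite (fx px); congr (_ * _)%:E.
    by rewrite -(extE x px); apply/eqP; rewrite -subr_eq0; apply/eqP.
  rewrite L1 integral_pos; last by move=> x x0; rewrite cut0// mul0r.
  have d1 := density_mom na (sol_density sol t); have d2 := density_mom nc dh.
  have d3 := density_mom nc (sol_density sol t); have d4 := density_mom na dh.
  rewrite /moment_of -(int_densityD lebR d1 d2) -(int_densityD lebR d3 d4).
  have fi g w : @density _ mR R w -> nonneg g -> (forall x, g x <= C) ->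
      (mom (fun=> 1%R) w < +oo)%E -> (\int[lebR]_x ((g x)%:E * w x) < +oo)%E.
    by move=> dw ng gC fin1; have := num_fin ng gC dw fin1; rewrite fin_numElt => /andP[].
  rewrite -(integral_sub measurableT (densityD d1 d2) (densityD d3 d4)); first last.
  - rewrite (int_densityD lebR d3 d4); apply: lte_add_pinfty.
      exact: (fi c _ (sol_density sol t) nc cC (mom1F It)).
    exact: (fi a _ dh na aC hnum).
  - rewrite (int_densityD lebR d1 d2); apply: lte_add_pinfty.
      exact: (fi a _ (sol_density sol t) na aC (mom1F It)).
    exact: (fi c _ dh nc cC hnum).
  apply: eq_integral => x _; rewrite /section_density -!EFinM -!EFinD; congr EFin.
  by rewrite (partsE cut x) -/(a x) -/(c x); ring.
have tga := test_gain_symbol law beta02 na aC.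
have tgc := test_gain_symbol law beta02 nc cC.
have ta := test_fst na aC; have tc := test_fst nc cC.
have [sga Jga] := symmetric_symbol Cb tga; have [sgc Jgc] := symmetric_symbol Cb tgc.
have [sa Ja] := symmetric_symbol C0 ta; have [sc Jc] := symmetric_symbol C0 tc.
have ep0 : {ae leb, forall x : R, ep x = 0}.
  by apply: ae_mono e0 => x ex; rewrite /ep /pos_part ex max_r.
have en0 : {ae leb, forall x : R, en x = 0}.
  by apply: ae_mono e0 => x ex; rewrite /en /neg_part ex oppr0 max_r.
have [sep Jep] := null_symbol mk k0 k2 ks sol (n_pos me) ep0.
have [sen Jen] := null_symbol mk k0 k2 ks sol (n_neg me) en0.
have [s1 J1] := finite_symbolD mk k0 sol sga sc.
have [S1 JJ1] := finite_symbolD mk k0 sol s1 sen.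
have [s2 J2] := finite_symbolD mk k0 sol sgc sa.
have [S2 JJ2] := finite_symbolD mk k0 sol s2 sep.
have Rt : (\int[leb]_(s in `]0%R, t[) \int[leb]_(x in pos) \int[leb]_(y in pos)
     (zeta b phi x y * k (x, y) * f s x * f s y)%:E =
   ((J ga t + J ga t) + (J (fun u => c u.1) t + J (fun u => c u.1) t) + 0) -
   ((J gc t + J gc t) + (J (fun u => a u.1) t + J (fun u => a u.1) t) + 0))%E.
  have T1 := eq_trans (JJ1 t It) (f_equal2 adde (eq_trans (J1 t It)
    (f_equal2 adde (Jga t It) (Jc t It))) (Jen t It)).
  have T2 := eq_trans (JJ2 t It) (f_equal2 adde (eq_trans (J2 t It)
    (f_equal2 adde (Jgc t It) (Ja t It))) (Jep t It)).
  apply: (eq_trans _ (f_equal2 (fun u v => u - v)%E T1 T2)).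
  apply: (eq_trans _ (signed_collisions mk k0 sol S1 S2 It)).
  apply: eq_integral => r _.
  rewrite integral_pos; last first.
    move=> x x0; apply: integral0_eq => y _.
    by rewrite (sol_support sol r x0) mulr0 mul0r.
  apply: eq_integral => x _; rewrite integral_pos; last first.
    by move=> y y0; rewrite (sol_support sol r y0) mulr0.
  apply: eq_integral => y _; congr EFin.
  have [x0|x0] := pselect (0 < x); last by rewrite (sol_support sol r x0) !(mulr0, mul0r).
  have [y0|y0] := pselect (0 < y); last by rewrite (sol_support sol r y0) !(mulr0, mul0r).
  have px : zero_ext x = phi x by apply: extE; exact/posP.
  have py : zero_ext y = phi y by apply: extE; exact/posP.
  congr (_ * _ * _ * _); rewrite (zetaE x0 y0) -px -py (partsx x) (partsx y) /ep /en /=; ring.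
rewrite L Rt.
apply: balance_of_equations.
- exact: (num_fin na aC (sol_density sol t) (mom1F It)).
- exact: (num_fin na aC dh hnum).
- exact: (num_fin nc cC (sol_density sol t) (mom1F It)).
- exact: (num_fin nc cC dh hnum).
- exact: (J_fin It Cb tga).
- exact: (J_fin It C0 ta).
- exact: (J_fin It Cb tgc).
- exact: (J_fin It C0 tc).
- exact: (equation It na aC).
- exact: (equation It nc cC).
Qed.

End bounded_test_function.

End weak_formula.

(** * From the data to the theorem *)

Section data.
Context {R : realType}.
Notation mR := (measurableTypeR R).
Notation mom := (moment_of (@lebR R)).
Notation nonneg := (@nonneg_measurable _ mR R).

Lemma integral_restriction (D : set R) (G H : R -> \bar R) : (forall z, D z -> G z = H z) ->
  (forall z, ~ D z -> G z = 0%E) -> (\int[leb]_z G z = \int[leb]_(z in D) H z)%E.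
Proof.
move=> GH G0; rewrite [RHS]integral_mkcond; apply: eq_integral => z _; rewrite patchE.
by case: ifPn => [/set_mem/GH//|/negP zD]; apply: G0 => Dz; apply: zD; rewrite inE.
Qed.

Section single_particle_fragments.
Variables (b bbar : R -> R -> R -> R) (beta0 p Bp : R).
Hypotheses (hbbar : nonneg_measurable3 bbar) (hii : no_mass_transfer b bbar)
  (hiii : fragments_bounded b beta0) (hiv : power_integrable bbar p Bp) (p0 : 0 < p).

(** The function [bbar] restricted to fragments smaller than the parent and
    extended by 0 to the whole space, where measurability and signs hold
    without restriction. *)
Definition particle_fragments (z : R) (u : R * R) : R :=
  if [&& 0 < z < u.1, 0 < u.1 & 0 < u.2] then bbar z u.1 u.2 else 0.

Let pfE z x y : 0 < x -> 0 < y -> `]0, x[%classic z -> particle_fragments z (x, y) = bbar z x y.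
Proof. by move=> x0 y0; rewrite /= in_itv /particle_fragments /= x0 y0 => ->. Qed.

Let pf0 z x y : ~ `]0, x[%classic z -> particle_fragments z (x, y) = 0.
Proof. by move=> /negP; rewrite /= in_itv /particle_fragments /= => /negbTE ->. Qed.

Lemma daughters_particles z x y : 0 < z -> 0 < x -> 0 < y ->
  b z x y = particle_fragments z (x, y) + particle_fragments z (y, x).
Proof.
move=> z0 x0 y0; have [-> // _ _] := hii x0 y0.
rewrite /particle_fragments /= !indicE !mem_setE !in_itv /= x0 y0 !andbT.
by case: (0 < z < x); case: (0 < z < y); rewrite ?mulr1 ?mulr0.
Qed.

Let measurable_pf : @measurable_fun _ _ (mR * (mR * mR))%type R setT
  (fun u => particle_fragments u.1 u.2).
Proof.
pose D : set (mR * (mR * mR)) := pos `*` (pos `*` pos).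
have mD : measurable D.
  by apply: measurableX; [|apply: measurableX]; exact: measurable_pos.
have m1 : @measurable_fun _ _ (mR * (mR * mR))%type R setT
    ((fun u : R * (R * R) => bbar u.1 u.2.1 u.2.2) \_ D).
  exact: (measurable_restrictT _ mD).1 hbbar.1.
have md : @measurable_fun _ _ (mR * (mR * mR))%type R setT (fun u => u.2.1 - u.1).
  apply: measurable_funB; last exact: measurable_fst.
  by apply: (measurableT_comp (@measurable_fst _ _ mR mR)); exact: measurable_snd.
have mE : measurable [set u : mR * (mR * mR) | u.1 < u.2.1].
  have := md measurableT _ (measurable_itv `]0, +oo[); rewrite setTI.
  by congr measurable; apply/seteqP; split=> u /=; rewrite in_itv /= andbT subr_gt0.
rewrite (_ : (fun u => _) = (fun u => ((fun u : R * (R * R) => bbar u.1 u.2.1 u.2.2) \_ D) u *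
    \1_[set u : mR * (mR * mR) | u.1 < u.2.1] u)).
  by apply: measurable_funM => //; exact: measurable_indic.
apply/funext => -[z [x y]]; rewrite /particle_fragments patchE indicE /=.
have -> : ((z, (x, y)) \in [set u : mR * (mR * mR) | u.1 < u.2.1]) = (z < x).
  by apply/idP/idP; rewrite inE.
have -> : ((z, (x, y)) \in D) = [&& 0 < z, 0 < x & 0 < y].
  by apply/idP/idP => [/set_mem[/posP-> [/posP-> /posP->]]//|/and3P[z0 x0 y0]];
     rewrite inE; split; [|split]; exact/posP.
by case: (0 < z); case: (z < x); case: (0 < x); case: (0 < y); rewrite ?mulr1 ?mulr0.
Qed.

Lemma particle_fragments_law : fragmentation_law particle_fragments beta0 p Bp.
Proof.
have pf_ge0 z u : 0 <= particle_fragments z u.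
  rewrite /particle_fragments; case: ifPn => // /and3P[/andP[z0 _] x0 y0].
  exact: hbbar.2.
have dens x y : @density _ mR R (fun z => (particle_fragments z (x, y))%:E).
  apply: density_EFin => [|z]; last exact: pf_ge0.
  exact: (measurableT_comp measurable_pf (@pair2_measurable _ _ mR (mR * mR)%type (x, y))).
split.
- exact: measurable_pf.
- exact: pf_ge0.
- by move=> z u /negbTE zu; rewrite /particle_fragments zu.
- move=> x y x0 y0; have [_ <- _] := hii x0 y0.
  apply: integral_restriction => z zx; first by rewrite pfE.
  by rewrite pf0// mule0.
- move=> x y x0 y0; rewrite -(int_densityD lebR (dens x y) (dens y x)).
  apply: le_trans (hiii x0 y0); rewrite le_eqVlt; apply/orP; left; apply/eqP.
  apply: integral_restriction => z.
    rewrite /= in_itv /= => /andP[z0 zxy].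
    by rewrite (daughters_particles z0 x0 y0) EFinD.
  rewrite /= in_itv /= => /negP zxy; rewrite !pf0 ?adde0//= in_itv /=.
    by apply/negP; apply: contra zxy => /andP[-> zy]; rewrite (lt_trans zy)// ltrDr.
  by apply/negP; apply: contra zxy => /andP[-> zx]; rewrite (lt_trans zx)// ltrDl.
- move=> x y x0 y0; apply: le_trans (hiv x0 y0).
  rewrite le_eqVlt; apply/orP; left; apply/eqP.
  apply: integral_restriction => z zx; first by rewrite pfE.
  by rewrite pf0// powR0// gt_eqF.
Qed.

End single_particle_fragments.

Section initial_datum.
Variable fin : R -> R.
Hypotheses (hfin0 : in_X 0 fin) (hfin1 : in_Xplus 1 fin).

Definition initial_density (x : R) : R := pos_part (zero_ext fin) x.
Local Notation h0 := initial_density.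

Lemma measurable_initial : measurable_fun pos fin.
Proof.
have /integrableP[/measurable_EFinP m _] := hfin0.
rewrite (_ : fin = fun x => x `^ 0 * fin x); first exact: m.
by apply/funext => x; rewrite powRr0 mul1r.
Qed.

Lemma nonneg_initial : nonneg h0.
Proof.
split=> [|x]; last by rewrite le_max lexx orbT.
apply: measurable_maxr => //.
exact: (measurable_restrictT fin (@measurable_pos R)).1 measurable_initial.
Qed.

Lemma initial_support x : ~ 0 < x -> h0 x = 0.
Proof.
move=> x0; rewrite /initial_density /pos_part /zero_ext patchE memNset ?maxxx//.
exact/posP.
Qed.

Lemma initial_ae : {ae leb, forall x : R, pos x -> fin x = h0 x}.
Proof.
apply: ae_mono hfin1.2 => x fx px.
rewrite /initial_density /pos_part /zero_ext patchE mem_set// max_l//; exact: fx.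
Qed.

Lemma moment_initial m : moment m fin = mom (fun x => (x `^ m)%R) (fun x => (h0 x)%:E).
Proof.
rewrite -moment_mom; last exact: initial_support.
have mx : @measurable_fun _ _ mR R pos (fun x => x `^ m) by exact: measurable_funTS.
apply: (@ae_eq_integral _ mR R lebR pos (fun x => (x `^ m * h0 x)%:E)).
- exact: measurable_pos.
- by apply/measurable_EFinP; exact: (measurable_funM mx measurable_initial).
- apply/measurable_EFinP; apply: (measurable_funM mx).
  exact: (measurable_funTS nonneg_initial.1).
by apply: ae_mono initial_ae => x fx px; rewrite fx.
Qed.

Lemma initial_moment_finite m : in_X m fin ->
  (mom (fun x => (x `^ m)%R) (fun x => (h0 x)%:E) < +oo)%E.
Proof.
move=> /integrableP[_ fm]; apply: le_lt_trans fm.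
rewrite -moment_mom; last exact: initial_support.
have mx : @measurable_fun _ _ mR R pos (fun x => x `^ m) by exact: measurable_funTS.
apply: (@ge0_le_integral _ mR R lebR); first exact: measurable_pos.
- by move=> x _; rewrite lee_fin mulr_ge0 ?powR_ge0// nonneg_initial.2.
- apply/measurable_EFinP; apply: (measurable_funM mx).
  exact: (measurable_funTS nonneg_initial.1).
- apply/measurable_EFinP; apply: (measurableT_comp (@normr_measurable R setT)).
  exact: (measurable_funM mx measurable_initial).
move=> x px; rewrite lee_fin normrM (ger0_norm (powR_ge0 _ _)); apply: ler_wpM2l; first exact: powR_ge0.
rewrite /initial_density /pos_part /zero_ext patchE mem_set// ge_max normr_ge0 andbT.
exact: ler_norm.
Qed.

End initial_datum.

Section conclusion.
Variables (alpha beta : R) (b bbar : R -> R -> R -> R) (beta0 p Bp : R) (fin : R -> R).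
Hypotheses (alpha0 : 0 <= alpha) (hab : alpha <= beta) (hb1 : beta <= 1)
  (hbbar : nonneg_measurable3 bbar) (hii : no_mass_transfer b bbar)
  (hbeta0 : 2 < beta0) (hiii : fragments_bounded b beta0)
  (hp : 1 < p < 2) (hBp : 0 < Bp) (hiv : power_integrable bbar p Bp)
  (hfin0 : in_X 0 fin) (hfin1 : in_Xplus 1 fin) (hrho : (0 < moment 1 fin)%E).

Local Notation frag := (particle_fragments bbar).
Local Notation f0 := (fun x => (initial_density fin x)%:E).
Local Notation rho := (fine (moment 1 fin)).

Let p1 : 1 < p. Proof. by case/andP: hp. Qed.
Let beta02 : 2 <= beta0. Proof. exact: ltW. Qed.

Let law : fragmentation_law frag beta0 p Bp.
Proof. exact: (particle_fragments_law hbbar hii hiii hiv (lt_trans ltr01 p1)). Qed.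

Let moment0 : moment 0 fin = mom (fun=> 1%R) f0.
Proof. by rewrite (moment_initial hfin0 hfin1); apply: eq_integral => x _; rewrite powRr0. Qed.

Let moment1 : moment 1 fin = mom posp f0.
Proof.
rewrite (moment_initial hfin0 hfin1); apply: (eq_mom (w := f0)) => [x x0|x x0].
  by rewrite initial_support.
by rewrite powRr1 ?pospE// ltW.
Qed.

Let f0_finite m : in_X m fin -> (mom (fun x => (x `^ m)%R) f0 < +oo)%E.
Proof. exact: initial_moment_finite. Qed.

Let number_finite : (mom (fun=> 1%R) f0 < +oo)%E.
Proof. by rewrite -moment0 (moment_initial hfin0 hfin1); exact: f0_finite. Qed.

Let mass_finite : moment 1 fin \is a fin_num.
Proof.
rewrite ge0_fin_numE; last exact: ltW.
by rewrite (moment_initial hfin0 hfin1); exact: f0_finite hfin1.1.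
Qed.

Lemma mass_gt0 : 0 < rho.
Proof. by rewrite -lte_fin fineK. Qed.

Lemma initial_admissible : admissible rho f0.
Proof.
split.
- exact: (nonneg_density (nonneg_initial hfin0)).
- by move=> x x0; rewrite initial_support.
- exact: number_finite.
- by rewrite -moment1 fineK.
Qed.

(** The power functions [x `^ m] with [m > 1] and [m = 1] are superlinear, so
    that moments decrease; the rest is the regularity and the weak formula of
    the preceding parts. *)
Lemma solution_is_weak T f : breakage_solution frag (kernel2 alpha beta) T f0 f ->
  mass_conserving_weak_solution (power_kernel alpha beta) b fin T f /\
  moments_controlled fin T f.
Proof.
move=> sol.
have opened (S : \bar R) (t : R) : open_time_interval S t -> time_interval S t.
  by move=> [t0 tS]; split=> //; exact: ltW.
have mk := measurable_kernel2 alpha beta.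
have k0 := @kernel2_ge0 R alpha beta.
have k2 := @kernel2_le R alpha beta alpha0 hab hb1.
have ks := @kernel2_sym R alpha beta.
have nh := nonneg_initial hfin0.
have df0 : @density _ mR R f0 by exact: (nonneg_density nh).
have momE t m : moment m (f t) = mom (fun x => (x `^ m)%R) (section_density f t).
  exact: (moment_mom _ (sol_support sol t)).
split; last first.
  move=> m m1 Xm t tT; split.
    apply: (sol_in_Linfty_X sol df0 (ltW m1) (f0_finite Xm)).
    by apply: ltW; case: tT.
  rewrite momE (moment_initial hfin0 hfin1).
  have It := opened _ _ tT.
  exact: (sol_le_mom sol It (nonneg_powR m)
    (fun z x z0 zx => powR_superlinear (ltW m1) z0 zx)).
split; last first.
  move=> t It; rewrite momE moment1 -(sol_mass sol It).
  apply: (eq_mom (w := section_density f t)) => [x x0|x x0].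
    by rewrite /section_density (sol_support sol t x0).
  by rewrite powRr1 ?pospE// ltW.
split.
- by move=> t It; apply: aeW => x _; exact: (sol_ge0 sol).
- exact: (sol_weakly_continuous sol).
- exact: (sol_in_Linfty_X sol df0 (lexx 1) (f0_finite hfin1.1) (lexx T)).
- move=> t tT; exact: (collision_integrable mk k0 sol (opened _ _ tT)).
move=> t phi tT [mphi [C phiC]].
have C0 : 0 <= Num.max C 0 by rewrite le_max lexx orbT.
have phiC' : {ae leb, forall x : R, pos x -> `|phi x| <= Num.max C 0}.
  by apply: ae_mono phiC => x xC px; rewrite le_max (xC px).
exact: (weak_formula law beta02 mk k0 k2 ks nh number_finite sol
  (daughters_particles hii) mphi phiC' C0 (measurable_initial hfin0)
  (initial_ae hfin1) (opened _ _ tT)).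
Qed.

Lemma global_solution : 1 <= alpha + beta <= 2 -> exists f,
  mass_conserving_weak_solution (power_kernel alpha beta) b fin +oo%E f /\
  moments_controlled fin +oo%E f.
Proof.
move=> hl.
have T0 : (0 < +oo :> \bar R)%E by exact: ltry.
have [f sol] := solution_exists law p1 beta02 (ltW hBp) alpha0 hab hb1 mass_gt0
  initial_admissible T0 (fun t It n k kt => number_bound_global law beta02 alpha0 hab hb1
    mass_gt0 initial_admissible hl kt).
by exists f; exact: solution_is_weak.
Qed.

Lemma local_solution : alpha + beta < 1 ->
  0 < T0 (alpha + beta) beta0 fin /\ exists f,
  mass_conserving_weak_solution (power_kernel alpha beta) b fin
    (T0 (alpha + beta) beta0 fin)%:E f /\
  moments_controlled fin (T0 (alpha + beta) beta0 fin)%:E f.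
Proof.
move=> l1; set S := T0 _ _ _.
have m0 : 0 < fine (moment 0 fin) by rewrite moment0; exact: (adm_number_gt0 mass_gt0 initial_admissible).
have c0 : 0 < (1 - (alpha + beta)) * (beta0 - 2) * rho `^ (alpha + beta).
  apply: mulr_gt0; last exact: powR_gt0 mass_gt0.
  by apply: mulr_gt0; rewrite subr_gt0.
have S0 : 0 < S by rewrite divr_gt0// powR_gt0.
split=> //.
have S0' : (0 < S%:E)%E by rewrite lte_fin.
have base t : time_interval S%:E t -> 0 < fine (mom (fun=> 1%R) f0) `^ (- (1 - (alpha + beta))) -
    (1 - (alpha + beta)) * ((beta0 - 2) * rho `^ (alpha + beta)) * t.
  move=> [_]; rewrite lte_fin /S /T0 ltr_pdivlMr// -moment0 opprB subr_gt0.
  by move=> H; apply: le_lt_trans H; rewrite le_eqVlt; apply/orP; left; apply/eqP; ring.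
have [f sol] := solution_exists law p1 beta02 (ltW hBp) alpha0 hab hb1 mass_gt0
  initial_admissible S0' (fun t It n k kt => number_bound_local law beta02 alpha0 hab hb1
    mass_gt0 initial_admissible l1 (base t It) kt).
by exists f; exact: solution_is_weak.
Qed.

End conclusion.

End data.

Theorem theorem1p4 (R : realType) (alpha beta : R)
  (hab : alpha <= beta) (hb1 : beta <= 1)
  (b : R -> R -> R -> R) (hb : daughter_distribution b)
  (hi : mass_preserving b)
  (bbar : R -> R -> R -> R) (hbbar : nonneg_measurable3 bbar)
  (hii : no_mass_transfer b bbar)
  (beta0 : R) (hbeta0 : 2 < beta0) (hiii : fragments_bounded b beta0)
  (p Bp : R) (hp : 1 < p < 2) (hBp : 0 < Bp) (hiv : power_integrable bbar p Bp)
  (fin : R -> R) (hfin0 : in_X 0 fin) (hfin1 : in_Xplus 1 fin)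
  (hrho : (0 < moment 1 fin)%E) :
  let lambda := alpha + beta in
  let K := power_kernel alpha beta in
  (1 <= lambda <= 2 ->
     exists f : R -> R -> R,
       mass_conserving_weak_solution K b fin +oo%E f /\
       moments_controlled fin +oo%E f) /\
  (0 <= lambda < 1 -> 0 <= alpha ->
     0 < T0 lambda beta0 fin /\
     exists f : R -> R -> R,
       mass_conserving_weak_solution K b fin (T0 lambda beta0 fin)%:E f /\
       moments_controlled fin (T0 lambda beta0 fin)%:E f).
Proof.
move=> lambda K; split=> [hl|/andP[l0 l1] a0].
  have a0 : 0 <= alpha by case/andP: hl; rewrite /lambda => l1 _; lra.
  exact: (global_solution a0 hab hb1 hbbar hii hbeta0 hiii hp hBp hiv hfin0 hfin1 hrho hl).
exact: (local_solution a0 hab hb1 hbbar hii hbeta0 hiii hp hBp hiv hfin0 hfin1 hrho l1).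
Qed.
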